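(* Let $C$ be a random vector in $\mathbb{R}_+^n$ satisfying the asymptotic homogeneity assumption (stated in the context) with exponent $\alpha$ and function $h$. Let $X_1,X_2,\dots$ be i.i.d. copies of $C$ and, for $\lambda>0$ and $K\ge1$, let $$\Phi_{\lambda,K}(p)=-\frac1\lambda\log\Big(\frac1K\sum_{k=1}^Ke^{-\lambda\langle p,X_k\rangle}\Big),\qquad p\in\Delta_n.$$ Let $c>0$ be a fixed constant and let $(\lambda_K)_{K\ge1}\subset(0,\infty)$ satisfy $\frac{\lambda_K}{K^{1/(n+\alpha)}}\to c$ as $K\to\infty$. Then the sequence $$K^{\frac1{n+\alpha}}\Phi_{\lambda_K,K}-\frac{K^{1/(n+\alpha)}\log K}{\lambda_K}$$ converges weakly, as $K\to\infty$, to a random concave function $\widetilde{\Psi}_c$ on $\Delta_n$.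
   Context: Let $n\ge2$, $\mathbb{R}_+^n:=(0,\infty)^n$, $\Delta_n:=\{p\in(0,1)^n:p_1+\cdots+p_n=1\}$, $\langle p,x\rangle=\sum_ip_ix_i$. Weak convergence is on the space $\widetilde{\mathcal{C}}$ of real-valued concave functions on $\Delta_n$ (automatically continuous), with the topology of uniform convergence on compact subsets of $\Delta_n$ and its Borel $\sigma$-algebra. Asymptotic homogeneity assumption: $C=(C_1,\dots,C_n)$ has a joint density $\rho$ on $\mathbb{R}_+^n$, and there exist $\alpha\in\mathbb{R}$ and a non-negative measurable function $h$ on $\mathbb{R}_+^n$ with $\int_{\mathbb{R}_+^n}h(x)\,dx\in(0,\infty]$ such that $\lim_{\kappa\to0^+}\kappa^{-\alpha}\rho(\kappa x)=h(x)$ for $x\in\mathbb{R}_+^n$, uniformly for $x\in\Delta_n$. Under this assumption $\alpha>-n$, $h$ is homogeneous of order $\alpha$ and integrable on bounded Borel subsets of $\mathbb{R}_+^n$. The paper's definition of $\widetilde{\Psi}_c$: $$\widetilde{\Psi}_c(p):=-\frac1c\log\Big(\sum_{x\in N}e^{-c\langle p,x\rangle}\Big),\qquad p\in\Delta_n,$$ where $N$ is a Poisson point process on $\mathbb{R}_+^n$ with intensity measure $dm(x)=h(x)\,dx$. *)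

(* Defs.v *)
From HB Require Import structures.
From mathcomp Require Import all_boot all_order all_algebra finmap.
From mathcomp Require Import all_classical all_reals all_analysis.
From mathcomp Require Import measurable_realfun.

Set Implicit Arguments.
Unset Strict Implicit.
Unset Printing Implicit Defensive.

Import Order.TTheory GRing.Theory Num.Theory.
Import numFieldNormedType.Exports.

Local Open Scope classical_set_scope.
Local Open Scope ring_scope.

(** R^n is ['rV[R]_n], with the sigma-algebra generated by the coordinates
    (the same construction as the library's instance on [n.-tuple R]). *)

Definition rV_display : measure_display.
Proof. exact: default_measure_display. Qed.

Section measurable_rV.
Context (R : realType) (n : nat).

Definition rV_coord (i : 'I_n) (x : 'rV[R]_n) : R := x 0 i.

Let rV_set0 : g_sigma_preimage rV_coord set0.
Proof. exact: sigma_algebra0. Qed.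

Let rV_setC A : g_sigma_preimage rV_coord A -> g_sigma_preimage rV_coord (~` A).
Proof. exact: sigma_algebraC. Qed.

Let rV_bigcup (F : (set 'rV[R]_n)^nat) :
  (forall i, g_sigma_preimage rV_coord (F i)) ->
  g_sigma_preimage rV_coord (\bigcup_i F i).
Proof. exact: sigma_algebra_bigcup. Qed.

HB.instance Definition _ := @isMeasurable.Build rV_display 'rV[R]_n
  (g_sigma_preimage rV_coord) rV_set0 rV_setC rV_bigcup.

Lemma measurable_rV_coord (i : 'I_n) : measurable_fun setT (rV_coord i).
Proof.
move=> _ Y mY; rewrite setTI; apply: sub_sigma_algebra => /=.
rewrite -bigcup_seq/=; exists i => /=; first by rewrite mem_index_enum.
by exists Y => //; rewrite setTI.
Qed.

Lemma measurable_fun_rV d (T : measurableType d) (f : T -> 'rV[R]_n) :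
  (forall i, measurable_fun setT (fun t => f t 0 i)) -> measurable_fun setT f.
Proof.
move=> mf _ Y mY; rewrite setTI.
have : sigma_algebra setT [set B : set 'rV[R]_n | measurable (f @^-1` B)].
  split => /=.
  - by rewrite preimage_set0; exact: measurable0.
  - by move=> A mA; rewrite setTD preimage_setC; exact: measurableC.
  - by move=> F mF; rewrite preimage_bigcup; exact: bigcup_measurable.
move=> /smallest_sub; apply; last exact: mY.
move=> B; rewrite -bigcup_seq => -[i _ [A mA <-]] /=.
by rewrite setTI; have := mf i measurableT A mA; rewrite setTI.
Qed.

End measurable_rV.

(** Lebesgue measure on R^n, as the [n]-fold product of [lebesgue_measure]:
    [lebesgue_rV n.+1] is [lebesgue_measure \x lebesgue_rV n] transported along
    R * R^n ~ R^(n.+1). *)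

Section lebesgue_rV.
Context (R : realType).

Definition rV_cons n (z : R * 'rV[R]_n) : 'rV[R]_n.+1 :=
  \row_i (if unlift ord0 i is Some j then z.2 0 j else z.1).

Definition rV_uncons n (x : 'rV[R]_n.+1) : R * 'rV[R]_n :=
  (x 0 ord0, \row_j x 0 (lift ord0 j)).

Lemma rV_consK n : cancel (@rV_cons n) (@rV_uncons n).
Proof.
case=> a x; rewrite /rV_cons /rV_uncons/= mxE unlift_none/=; congr pair.
by apply/rowP => j; rewrite !mxE liftK.
Qed.

Lemma rV_unconsK n : cancel (@rV_uncons n) (@rV_cons n).
Proof.
move=> x; apply/rowP => i; rewrite !mxE.
by case: unliftP => [j ->|->] //=; rewrite mxE.
Qed.

Lemma measurable_rV_cons n : measurable_fun setT (@rV_cons n).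
Proof.
apply: measurable_fun_rV => i; rewrite /rV_cons.
under eq_fun do rewrite mxE.
case: (unlift ord0 i) => [j|]; last exact: measurable_fst.
exact: (measurableT_comp (measurable_rV_coord j) measurable_snd).
Qed.

Lemma measurable_rV_uncons n : measurable_fun setT (@rV_uncons n).
Proof.
apply/measurable_fun_pairP; split; first exact: (measurable_rV_coord ord0).
apply: measurable_fun_rV => i; rewrite /rV_uncons/=.
under eq_fun do rewrite mxE.
exact: (measurable_rV_coord (lift ord0 i)).
Qed.

Definition lebesgue_rVS n (mu : {sigma_finite_measure set 'rV[R]_n -> \bar R}) :
    set 'rV[R]_n.+1 -> \bar R :=
  pushforward (@lebesgue_measure R \x mu)%E (@rV_cons n).

Section lebesgue_rVS_measure.
Context n (mu : {sigma_finite_measure set 'rV[R]_n -> \bar R}).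

Let lebesgue_rVS0 : lebesgue_rVS mu set0 = 0%E.
Proof. by rewrite /lebesgue_rVS /pushforward preimage_set0 measure0. Qed.

Let lebesgue_rVS_ge0 A : (0 <= lebesgue_rVS mu A)%E.
Proof. by rewrite /lebesgue_rVS /pushforward; exact: measure_ge0. Qed.

Let lebesgue_rVS_sigma_additive : semi_sigma_additive (lebesgue_rVS mu).
Proof.
pose push : {measure set 'rV[R]_n.+1 -> \bar R} :=
  measure_function_pushforward__canonical__measure_function_Measure
    (@lebesgue_measure R \x mu)%E (@measurable_rV_cons n).
exact: (@measure_semi_sigma_additive _ _ _ push).
Qed.

HB.instance Definition _ := isMeasure.Build _ _ _ (lebesgue_rVS mu)
  lebesgue_rVS0 lebesgue_rVS_ge0 lebesgue_rVS_sigma_additive.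

Let lebesgue_rVS_sigma_finite : sigma_finite setT (lebesgue_rVS mu).
Proof.
have /sigma_finiteP[F [FT ndF Foo]] := sigma_finiteT (@lebesgue_measure R).
have /sigma_finiteP[G [GT ndG Goo]] := sigma_finiteT mu.
exists (fun k => @rV_uncons n @^-1` (F k `*` G k)).
  apply/esym; rewrite -subTset => x _.
  have [k _ Fk] : (\bigcup_k F k) (rV_uncons x).1 by rewrite -FT.
  have [l _ Gl] : (\bigcup_k G k) (rV_uncons x).2 by rewrite -GT.
  exists (maxn k l) => //; split.
  - by move: Fk; exact/subsetPset/ndF/leq_maxl.
  - by move: Gl; exact/subsetPset/ndG/leq_maxr.
move=> k; have [mF Fk] := Foo k; have [mG Gk] := Goo k; split.
  rewrite -[X in measurable X]setTI; apply: measurable_rV_uncons => //.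
  exact: measurableX.
rewrite /lebesgue_rVS /pushforward -comp_preimage.
rewrite (_ : rV_uncons (n := n) \o _ = id); last first.
  by apply/funext => z; exact: rV_consK.
rewrite preimage_id product_measure1E//.
by rewrite lte_mul_pinfty// ge0_fin_numE.
Qed.

HB.instance Definition _ := Measure_isSigmaFinite.Build _ _ _ (lebesgue_rVS mu)
  lebesgue_rVS_sigma_finite.

End lebesgue_rVS_measure.

Fixpoint lebesgue_rV n : {sigma_finite_measure set 'rV[R]_n -> \bar R} :=
  match n with
  | 0 => \d_(0 : 'rV[R]_0)
  | m.+1 => lebesgue_rVS (lebesgue_rV m)
  end.

Lemma measurable_rV_box n (A : 'I_n -> set R) : (forall i, measurable (A i)) ->
  measurable [set x : 'rV[R]_n | forall i, A i (x 0 i)].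
Proof.
move=> mA; rewrite (_ : mkset _ = \bigcap_(i in [set: 'I_n]) (rV_coord i @^-1` A i)).
  apply: fin_bigcap_measurable => // i _; rewrite -[X in measurable X]setTI.
  exact: measurable_rV_coord.
by apply/seteqP; split=> x/= Ax i; [move=> _|]; exact: Ax.
Qed.

Lemma lebesgue_rV_box n (A : 'I_n -> set R) : (forall i, measurable (A i)) ->
  lebesgue_rV n [set x | forall i, A i (x 0 i)] =
  (\prod_(i < n) lebesgue_measure (A i))%E.
Proof.
elim: n A => [|n ih] A mA.
  by rewrite big_ord0 /= diracE mem_set// => -[].
have mA' i : measurable (A (lift ord0 i)) by exact: mA.
have mB := measurable_rV_box mA'.
rewrite big_ord_recl -ih// -product_measure1E//; last exact: mA.
rewrite /= /lebesgue_rVS /pushforward; congr (product_measure1 _ _ _).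
apply/seteqP; split=> -[a x]/=.
  move=> Aax; split=> [|j].
    by have := Aax ord0; rewrite mxE unlift_none.
  by have := Aax (lift ord0 j); rewrite mxE liftK.
by move=> [Aa Ax] i; rewrite mxE; case: unliftP => [j ->|->].
Qed.

End lebesgue_rV.

Section simplex.
Context (R : realType) (n : nat).

Definition orthant : set 'rV[R]_n := [set x | forall i, 0 < x 0 i].

Definition simplex : set 'rV[R]_n :=
  [set p | (forall i, 0 < p 0 i < 1) /\ \sum_i p 0 i = 1].

Definition dot (p x : 'rV[R]_n) : R := \sum_i p 0 i * x 0 i.

End simplex.
Arguments orthant R n : clear implicits.
Arguments simplex R n : clear implicits.

(** [{family compact, U -> V}] carries uniform convergence on compact subsets of
    [U]; [set_type A] carries the subspace topology of [A]. *)

Section concave.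
Context (R : realType) (n : nat).

Definition simplex_arrow := {family compact, set_type (simplex R n) -> R}.

Definition concave (f : set_type (simplex R n) -> R) : Prop :=
  forall (p q r : set_type (simplex R n)) (t : R), 0 <= t <= 1 ->
    val r = t *: val p + (1 - t) *: val q -> t * f p + (1 - t) * f q <= f r.

Definition concave_fun : Type :=
  set_type [set f : simplex_arrow | concave f].

HB.instance Definition _ := Topological.on concave_fun.

Lemma concave_cst0 :
  (fun=> 0 : R) \in [set f : simplex_arrow | concave f].
Proof. by rewrite inE => p q r t _ _; rewrite !mulr0 addr0. Qed.

HB.instance Definition _ :=
  isPointed.Build concave_fun (exist _ (fun=> 0 : R) concave_cst0).

Definition concave_val (f : concave_fun) : set_type (simplex R n) -> R := val f.

End concave.
Coercion concave_val : concave_fun >-> Funclass.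

Definition borel (E : ptopologicalType) := g_sigma_algebraType (@open E).
HB.instance Definition _ (E : ptopologicalType) := Measurable.on (borel E).

Section probability_notions.
Context d (Omega : measurableType d) (R : realType) (P : probability Omega R).

Definition mutually_independent d' (T : measurableType d') (I : choiceType)
    (X : I -> Omega -> T) : Prop :=
  forall (J : {fset I}) (E : I -> set T), (forall i, measurable (E i)) ->
    P (\bigcap_(i in [set` J]) (X i @^-1` E i)) =
    (\prod_(i <- J) P (X i @^-1` E i))%E.

Definition iid_copies d0 (Omega0 : measurableType d0) (P0 : probability Omega0 R)
    d' (T : measurableType d') (C : {RV P0 >-> T}) (X : nat -> {RV P >-> T}) :=
  mutually_independent X /\
  forall k (A : set T), measurable A ->
    distribution P (X k) A = distribution P0 C A.

Definition converges_weakly d' (Omega' : measurableType d')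
    (P' : probability Omega' R) (E : ptopologicalType)
    (Y : nat -> {RV P >-> borel E}) (Z : {RV P' >-> borel E}) : Prop :=
  forall F : E -> R, continuous F -> (exists M, forall f, `|F f| <= M) ->
    ('E_P[fun w => F (Y K w)] @[K --> \oo] --> 'E_P'[fun w => F (Z w)])%E.

(** A simple point process is encoded by the random set of its points; counts
    take values in the extended reals because a set may contain infinitely many
    points. *)
Definition npoints (T : choiceType) (N : Omega -> set T) (A : set T) :
    Omega -> \bar R :=
  fun w => counting (N w `&` A).

Definition poisson_process d' (T : measurableType d') (m : set T -> \bar R)
    (N : Omega -> set T) : Prop :=
  [/\ forall A, measurable A -> measurable_fun setT (npoints N A),
      forall A, measurable A -> (m A < +oo)%E -> forall k : nat,
        P [set w | npoints N A w = k%:R%:E] =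
        (expR (- fine (m A)) * fine (m A) ^+ k / k`!%:R)%:E,
      forall A, measurable A -> m A = +oo%E ->
        P [set w | npoints N A w = +oo%E] = 1%E
    & forall (l : nat) (A : 'I_l -> set T), (forall i, measurable (A i)) ->
        trivIset setT A -> mutually_independent (fun i => npoints N (A i))].

End probability_notions.

Section model.
Context (R : realType) (n : nat).

Definition density_on_orthant d (Omega : measurableType d)
    (P : probability Omega R) (C : {RV P >-> 'rV[R]_n}) (rho : 'rV[R]_n -> R) :=
  [/\ forall x, orthant R n x -> 0 <= rho x,
      measurable_fun (orthant R n) rho
    & forall A, measurable A -> distribution P C A =
        (\int[lebesgue_rV R n]_(x in A `&` orthant R n) (rho x)%:E)%E].

Definition asymptotically_homogeneous d (Omega : measurableType d)
    (P : probability Omega R) (C : {RV P >-> 'rV[R]_n})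
    (alpha : R) (h : 'rV[R]_n -> R) : Prop :=
  exists rho : 'rV[R]_n -> R,
    let rescaled (kappa : R) (x : 'rV[R]_n) :=
      kappa `^ (- alpha) * rho (kappa *: x) in
    [/\ density_on_orthant C rho,
        (forall x, orthant R n x -> 0 <= h x) /\ measurable_fun (orthant R n) h,
        (0 < \int[lebesgue_rV R n]_(x in orthant R n) (h x)%:E)%E,
        forall x, orthant R n x -> rescaled kappa x @[kappa --> 0^'+] --> h x
      & {uniform simplex R n, rescaled kappa @[kappa --> 0^'+] --> h}].

Definition intensity (h : 'rV[R]_n -> R) (A : set 'rV[R]_n) : \bar R :=
  (\int[lebesgue_rV R n]_(x in A `&` orthant R n) (h x)%:E)%E.

(** The i.i.d. copies X_1, X_2, ... are indexed from 0. *)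
Definition Phi (lambda : R) (K : nat) (x : nat -> 'rV[R]_n) (p : 'rV[R]_n) : R :=
  - lambda^-1 * ln (K%:R^-1 * \sum_(k < K) expR (- (lambda * dot p (x k)))).

(** Extended-real valued, since the sum over the infinite set [N] may diverge
    on a null event. *)
Definition Psi_tilde (c : R) (N : set 'rV[R]_n) (p : 'rV[R]_n) : \bar R :=
  ((- c^-1)%:E * lne (\esum_(x in N) (expR (- (c * dot p x)))%:E))%E.

End model.

(* Main.v *)
From HB Require Import structures.
Require Import Defs.
From mathcomp Require Import all_boot all_order all_algebra finmap.
From mathcomp Require Import all_classical all_reals all_analysis.
From mathcomp Require Import measurable_realfun.
From mathcomp Require Import ring lra.

Set Implicit Arguments.
Unset Strict Implicit.
Unset Printing Implicit Defensive.

Import Order.TTheory GRing.Theory Num.Theory.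
Import numFieldNormedType.Exports.

Local Open Scope classical_set_scope.
Local Open Scope ring_scope.

(** Write [beta] for [n + alpha], [a] for [K ^ (1 / beta)], [nu] for the law of [C]
    and [Y] for the normalised random function of index [K].

    The double exponential [gumbel s = exp (- exp (- s))] removes the logarithm:
    [gumbel ((lambda / a) Y p)] is the product over the sample of the factors
    [exp (- exp (- lambda <p, X_k>))] ([empirical_laplace]), and off a null event
    [gumbel (c Psi p)] is [exp (- S)] with [S] the sum over [N] of
    [exp (- c <p, x>)].  Since the [X_k] are independent, a mixed moment of the
    first family at finitely many points [p_i], with exponents [t_i], is the
    [K]-th power [(1 - x_K) ^ K] of one integral against [nu].  After the change of
    variable [x = K ^ (- 1 / beta) y], asymptotic homogeneity says that [K x_K]
    converges to the integral of [1 - exp (- sum_i t_i exp (- c <p_i, y>))] against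
    [h(y) dy] ([rescaled_integral_cvg]), so that the moments converge to [exp] of
    minus this integral.  By the formula for the Laplace functional of a Poisson
    process ([poisson_laplace]) this is the mixed moment of the [gumbel (c Psi p_i)].
    The variables lie in [0, 1], where polynomials are uniformly dense, so all
    expectations of Lipschitz functions of finitely many evaluations converge
    ([moments_lipschitz]); replacing [lambda / a] by its limit [c] costs nothing,
    by [gumbel_dist].

    It remains to pass from finitely many evaluations to the function space, and
    this is where concavity enters.  A concave function is controlled near a point
    by its values at the vertices and at the centre of a small simplex around it
    ([concave_osc]); hence concave functions that are close to [f] at the first [m]
    points of an enumeration of the rational points are uniformly close to [f] on
    compact sets once [m] is large ([concave_nbhs]).  Two things follow.  The Borel
    sets are generated by evaluations at rational points
    ([measurable_concave_fun]).  And a bounded continuous [F] is the pointwise limit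
    from below of Lipschitz functions of finitely many evaluations, namely of
    [f |-> inf_g (F g + m d_m(f, g))] with [d_m] the distance between the first [m]
    evaluations; the limit inferior of the expectations of [F] along [Y] is
    therefore at least the expectation of [F] along [Psi], and the same holds for
    [- F] ([weak_convergence_criterion]).

    The assumption on the density also gives what the Poisson process needs.  Near
    the origin the density is close to the homogeneous function [h], so that
    the shells of radius about [2 ^ (- j)] have probability at least of order
    [2 ^ (- j beta)]; this tends to zero, which forces [beta > 0] ([beta_gt0]).
    Consequently [h] has finite mass near the origin, infinite total mass, and is
    integrable against [exp (- a |x|)] for all [a > 0]: the process has infinitely
    many points, and the sums defining [Psi] converge, almost surely. *)

(** * Integrals against densities and independent variables *)
Section density.
Local Open Scope ereal_scope.
Context d1 d2 (S : measurableType d1) (T : measurableType d2) (R : realType).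
Variables (mu : {measure set S -> \bar R}) (nu : {measure set T -> \bar R}).
Variables (X : S -> T) (W : S -> R).
Hypotheses (mX : measurable_fun setT X) (mW : measurable_fun setT W)
  (W0 : forall x, (0 <= W x)%R).
Hypothesis nuE : forall A, measurable A ->
  nu A = \int[mu]_(x in X @^-1` A) (W x)%:E.

Import HBNNSimple.

(** The identity [nuE] on sets extends to simple functions by linearity and to
    nonnegative functions by monotone convergence.  Laws, densities and the exchange
    step in [expectation_prod_indep] are all instances. *)
Lemma integral_density (g : T -> \bar R) : measurable_fun setT g ->
  (forall y, 0 <= g y) ->
  \int[nu]_y g y = \int[mu]_x ((W x)%:E * g (X x)).
Proof.
move=> mg g0.
have mXA A : measurable A -> measurable (X @^-1` A).
  by move=> mA; rewrite -[_ @^-1` _]setTI; exact: mX.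
have indX A : (fun x => \1_A (X x) : R) = \1_(X @^-1` A).
  by apply/funext => x; rewrite !indicE.
have mWE : measurable_fun setT (EFin \o W) by exact/measurable_EFinP.
pose f_ := nnsfun_approx measurableT mg.
have cvf y : (f_ n y)%:E @[n --> \oo] --> g y by exact: cvg_nnsfun_approx.
have ndf y : {homo (fun n => (f_ n y)%:E) : m n / (m <= n)%N >-> m <= n}.
  by move=> m n mn; rewrite lee_fin; exact/lefP/nd_nnsfun_approx.
transitivity (limn (fun n => \int[nu]_y (f_ n y)%:E)).
  rewrite -monotone_convergence//.
  - by apply: eq_integral => y _; apply/esym/cvg_lim.
  - by move=> n; exact/measurable_EFinP/measurable_funP.
  - by move=> n y _; rewrite lee_fin.
rewrite [RHS](_ : _ = limn (fun n => \int[mu]_x ((W x)%:E * (f_ n (X x))%:E))).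
  congr (limn _); apply/funext => n.
  rewrite integralT_nnsfun sintegralE.
  have mi r : measurable_fun setT
      (fun x => (W x)%:E * (\1_(f_ n @^-1` [set r]) (X x))%:E).
    apply: emeasurable_funM => //; apply/measurable_EFinP; rewrite indX.
    by apply: measurable_indic; exact: mXA.
  transitivity (\sum_(k \in range (f_ n))
      \int[mu]_x (k%:E * ((W x)%:E * (\1_(f_ n @^-1` [set k]) (X x))%:E))).
    apply: eq_fsbigr => r; rewrite inE => -[y _ fy].
    rewrite ge0_integralZl//; last 2 first.
    - by move=> x _; rewrite mule_ge0// lee_fin.
    - by rewrite lee_fin -fy.
    congr (_ * _); rewrite nuE// integral_mkcond.
    apply: eq_integral => x _; rewrite patchE.
    rewrite (congr1 (@^~ x) (indX (f_ n @^-1` [set r]))) indicE.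
    by case: ifPn => xX; rewrite ?mule1 ?mule0//.
  rewrite -ge0_integral_fsum//; last 2 first.
  - by move=> r; apply: measurable_funeM.
  - move=> r x _; rewrite muleCA mule_ge0 ?lee_fin//.
    by rewrite -lee_fin; exact: nnfun_muleindic_ge0.
  apply: eq_integral => x _; rewrite [in RHS]fimfunE -fsumEFin//.
  rewrite ge0_mule_fsumr//; first by apply: eq_fsbigr => r _; rewrite muleCA EFinM.
  by move=> r; exact: nnfun_muleindic_ge0.
rewrite -monotone_convergence//.
- by apply: eq_integral => x _; apply/esym/cvg_lim => //; exact: cvgeZl.
- move=> n; apply: emeasurable_funM => //; apply/measurable_EFinP.
  by apply: measurableT_comp => //; exact: mX.
- by move=> n x _; rewrite mule_ge0// lee_fin.
- by move=> x _ m n mn; rewrite lee_wpmul2l ?lee_fin//; exact: ndf.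
Qed.

End density.

Lemma expectation_fin_num01 d (Omega : measurableType d) (R : realType)
    (P : probability Omega R) (f : Omega -> R) : measurable_fun setT f ->
  (forall w, 0 <= f w <= 1) -> (\int[P]_w (f w)%:E \is a fin_num)%E.
Proof.
move=> mf f01; rewrite ge0_fin_numE; last first.
  by apply: integral_ge0 => w _; rewrite lee_fin; case/andP: (f01 w).
apply: (@le_lt_trans _ _ (\int[P]_w cst 1%:E w)%E).
  apply: ge0_le_integral => //.
  - by move=> w _; rewrite lee_fin; case/andP: (f01 w).
  - exact/measurable_EFinP.
  - by move=> w _; rewrite lee_fin; case/andP: (f01 w).
by rewrite integral_cst//= probability_setT mule1 ltry.
Qed.

Section independence.
Local Open Scope ereal_scope.
Context d (Omega : measurableType d) (R : realType) (P : probability Omega R).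
Context d' (T : measurableType d') (I : choiceType) (X : I -> Omega -> T).
Hypotheses (mX : forall i, measurable_fun setT (X i))
  (X_indep : mutually_independent P X).

Let E (g : T -> R) i := fine (\int[P]_w (g (X i w))%:E).

Let E_indic A i : measurable A -> (E \1_A i)%:E = P (X i @^-1` A).
Proof.
move=> mA; have mXA : measurable (X i @^-1` A).
  by rewrite -[_ @^-1` _]setTI; exact: mX.
rewrite /E (_ : \int[P]_w _ = P (X i @^-1` A)) ?fineK ?fin_num_measure//.
by rewrite -[X in P X]setIT -integral_indic.
Qed.

(** Independence speaks of events, that is, of indicators.  The other factors are
    released one at a time: with the remaining factors fixed, both sides are measures
    in the event whose indicator stands for [g a], so [integral_density] carries the
    identity from indicators to [g a]. *)
Lemma expectation_prod_indep (J : {fset I}) (g : I -> T -> R) :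
  (forall i, measurable_fun setT (g i)) -> (forall i t, 0 <= g i t <= 1)%R ->
  \int[P]_w (\prod_(i <- J) g i (X i w))%:E = (\prod_(i <- J) E (g i) i)%:E.
Proof.
(* induction on a list of the indices whose factor may fail to be an indicator *)
suff main : forall (s : seq I) (g : I -> T -> R),
    (forall i, measurable_fun setT (g i)) -> (forall i t, 0 <= g i t <= 1)%R ->
    (forall i, i \notin s -> exists A, measurable A /\ g i = \1_A) ->
    \int[P]_w (\prod_(i <- J) g i (X i w))%:E = (\prod_(i <- J) E (g i) i)%:E.
  move=> mg g01.
  have [s sJ] : exists s : seq I, s =i J by exists (enum_fset J).
  pose g' i := if i \in s then g i else \1_set0.
  have g'E i : i \in J -> g' i = g i by rewrite /g' sJ => ->.
  have : \int[P]_w (\prod_(i <- J) g' i (X i w))%:E = (\prod_(i <- J) E (g' i) i)%:E.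
    apply: (main s).
    - by move=> i; rewrite /g'; case: ifP => // _; exact: measurable_indic.
    - by move=> i t; rewrite /g'; case: ifP => // _; rewrite indicE in_set0 lexx ler01.
    - by move=> i /negbTE; rewrite /g' => ->; exists set0.
  under eq_integral do under eq_big_seq => i iJ do rewrite (g'E _ iJ).
  by under [in RHS]eq_big_seq => i iJ do rewrite (g'E _ iJ).
elim=> [|a s ih] {}g mg g01 gind.
  have {gind} /choice[A gA] i : exists A, measurable A /\ g i = \1_A by exact: gind.
  transitivity (\int[P]_w (\1_(\bigcap_(i in [set` J]) (X i @^-1` A i)) w)%:E).
    apply: eq_integral => w _; congr EFin.
    rewrite indicE; case: (boolP (w \in _)) => [|].
      rewrite inE => wA; rewrite big_seq big1// => i iJ.
      by rewrite (gA i).2 indicE mem_set//; exact: wA.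
    rewrite notin_setE => wA.
    have [i iJ wi] : exists2 i, i \in J & ~ A i (X i w).
      apply: contrapT => /forall2NP h; apply: wA => i /= iJ.
      by have [] := h i => // /contrapT.
    by rewrite (big_rem _ iJ)/= (gA i).2 indicE memNset ?mul0r.
  rewrite integral_indic// ?setIT; last first.
    apply: fin_bigcap_measurable => // i _.
    by rewrite -[_ @^-1` _]setTI; apply: mX => //; exact: (gA i).1.
  apply: etrans; first exact: (X_indep J (fun i => (gA i).1)).
  rewrite -prodEFin; apply: eq_bigr => i _.
  by rewrite (gA i).2 E_indic//; exact: (gA i).1.
have [aJ|aJ] := boolP (a \in J); last first.
  pose g' i := if i == a then \1_set0 else g i.
  have g'E i : i \in J -> g' i = g i by rewrite /g'; case: eqVneq aJ => // -> /negbTE ->.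
  have : \int[P]_w (\prod_(i <- J) g' i (X i w))%:E = (\prod_(i <- J) E (g' i) i)%:E.
    apply: ih.
    - by move=> i; rewrite /g'; case: ifP => // _; exact: measurable_indic.
    - by move=> i t; rewrite /g'; case: ifP => // _; rewrite indicE in_set0 lexx ler01.
    - move=> i ias; rewrite /g'; have [_|ia] := eqVneq i a; first by exists set0.
      by apply: gind; rewrite inE negb_or ia.
  under eq_integral do under eq_big_seq => i iJ do rewrite (g'E _ iJ).
  by under [in RHS]eq_big_seq => i iJ do rewrite (g'E _ iJ).
pose W w := (\prod_(i <- rem a J) g i (X i w))%R.
have W0 w : (0 <= W w)%R.
  by apply: prodr_ge0 => i _; have /andP[] := g01 i (X i w).
have mW : measurable_fun setT W.
  by apply: measurable_prod => i _; apply: measurableT_comp => //; exact: mX.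
pose k := (\prod_(i <- rem a J) E (g i) i)%R.
have k0 : (0 <= k)%R.
  apply: prodr_ge0 => i _; apply/fine_ge0/integral_ge0 => w _.
  by rewrite lee_fin; case/andP: (g01 i (X i w)).
have ane i : i \in rem a J -> i != a by rewrite mem_rem_uniq ?fset_uniq// inE => /andP[].
(* the law of [X a] scaled by the other expectations is the image under [X a] of
   the measure with density [W] *)
pose Xa : {RV P >-> T} := mfun_Sub (mem_set (mX a)).
have nuE A : measurable A ->
    mscale (NngNum k0) (distribution P Xa) A = \int[P]_(w in X a @^-1` A) (W w)%:E.
  move=> mA; pose g' i := if i == a then \1_A else g i.
  have : \int[P]_w (\prod_(i <- J) g' i (X i w))%:E = (\prod_(i <- J) E (g' i) i)%:E.
    apply: ih.
    - by move=> i; rewrite /g'; case: ifP => // _; exact: measurable_indic.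
    - by move=> i t; rewrite /g'; case: ifP => // _; rewrite indicE; case: (_ \in _);
        rewrite ?lexx ?ler01.
    - move=> i ias; rewrite /g'; have [_|ia] := eqVneq i a; first by exists A.
      by apply: gind; rewrite inE negb_or ia.
  have g'E i : i \in rem a J -> g' i = g i by move=> /ane; rewrite /g' => /negbTE ->.
  rewrite (big_rem _ aJ)/= /mscale/= /distribution /pushforward -E_indic//.
  under [in X in _ = X -> _]eq_big_seq => i iJ do rewrite (g'E _ iJ).
  rewrite {2}/g' eqxx -/k muleC -EFinM => <-.
  rewrite [RHS]integral_mkcond; apply: eq_integral => w _.
  rewrite (big_rem _ aJ)/= patchE {1}/g' eqxx indicE.
  under eq_big_seq => i iJ do rewrite (g'E _ iJ).
  by rewrite -/(W w) -[w \in _]/(X a w \in A); case: ifP; rewrite ?mul1r ?mul0r.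
have mga : measurable_fun setT (EFin \o g a) by exact/measurable_EFinP.
have ga0 t : 0 <= (EFin \o g a) t by rewrite lee_fin; case/andP: (g01 a t).
have := integral_density (mX a) mW W0 nuE mga ga0.
rewrite ge0_integral_mscale// (_ : \int[_]_y _ = (E (g a) a)%:E); last first.
  rewrite /E fineK; last first.
    apply: expectation_fin_num01 => [|w]; last exact: g01.
    by apply: measurableT_comp => //; exact: mX.
  exact: (ge0_integral_distribution Xa mga ga0).
rewrite (big_rem _ aJ)/= -/k mulrC EFinM => ->.
by apply: eq_integral => w _; rewrite (big_rem _ aJ)/= mulrC.
Qed.

End independence.

(** * Lebesgue measure under homotheties *)
Section scaling.
Context (R : realType).
Local Notation leb := (@lebesgue_measure R).

(** Lebesgue measure equals [s] times its image under multiplication by [s], since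
    the two agree on half-open intervals. *)
Lemma ge0_integral_lebesgue_scale (s : R) (f : R -> \bar R) : 0 < s ->
  measurable_fun setT f -> (forall x, 0 <= f x)%E ->
  (\int[leb]_x f x = s%:E * \int[leb]_x f (s * x)%R)%E.
Proof.
move=> s0 mf f0; have ms : measurable_fun setT ( *%R s : R -> measurableTypeR R).
  exact: mulrl_measurable.
pose mu : {measure set (measurableTypeR R) -> \bar R} :=
  measure_function_pushforward__canonical__measure_function_Measure leb ms.
pose nu : {measure set (measurableTypeR R) -> \bar R} := mscale (NngNum (ltW s0)) mu.
have nuE : forall A, measurable A -> leb A = nu A.
  apply: lebesgue_measure_unique => _ [[a b]] _ <-.
  rewrite /nu/= /mscale/= /pushforward.
  have -> : *%R s @^-1` `]a, b]%classic = `]a / s, b / s]%classic.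
    apply/seteqP; split => x /=; rewrite !in_itv/=;
      by rewrite ltr_pdivrMr// ler_pdivlMr// (mulrC x).
  rewrite !lebesgue_measure_itv/= !lte_fin ltr_pM2r ?invr_gt0//.
  case: ifPn => _; last by rewrite mule0.
  by rewrite -!EFinB -EFinM mulrBr mulrC divfK ?gt_eqF// mulrC divfK ?gt_eqF.
transitivity (\int[nu]_x f x)%E.
  by apply: eq_measure_integral => A mA _; exact: nuE.
rewrite ge0_integral_mscale//; congr (_ * _)%E.
by rewrite ge0_integral_pushforward.
Qed.

Lemma measurable_rV_scale n (s : R) : measurable_fun setT ( *:%R s : 'rV[R]_n -> 'rV[R]_n).
Proof.
apply: measurable_fun_rV => i; under eq_fun do rewrite mxE.
by apply: measurable_funM => //; exact: measurable_rV_coord.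
Qed.

Lemma rV_cons_scale n (s : R) a (x : 'rV[R]_n) :
  s *: rV_cons (a, x) = rV_cons (s * a, s *: x).
Proof. by apply/rowP => i; rewrite !mxE; case: (unlift ord0 i) => [j|]; rewrite ?mxE. Qed.

(** One factor [s] for each coordinate, by Tonelli's theorem. *)
Lemma ge0_integral_lebesgue_rV_scale n (s : R) (f : 'rV[R]_n -> \bar R) : 0 < s ->
  measurable_fun setT f -> (forall x, 0 <= f x)%E ->
  (\int[lebesgue_rV R n]_x f x = (s ^+ n)%:E * \int[lebesgue_rV R n]_x f (s *: x)%R)%E.
Proof.
move=> s0; elim: n f => [|n ih] f mf f0.
  rewrite expr0 mul1e; apply: eq_integral => x _; congr f.
  by apply/rowP => -[].
(* the sigma-algebra of R is here the one carried by its Lebesgue measure *)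
have mc : @measurable_fun _ _ (measurableTypeR R * 'rV[R]_n)%type _ setT
    (@rV_cons R n) := @measurable_rV_cons R n.
have mrc (g : 'rV[R]_n.+1 -> \bar R) : measurable_fun setT g ->
    @measurable_fun _ _ (measurableTypeR R * 'rV[R]_n)%type _ setT
      (g \o @rV_cons R n).
  by move=> mg; exact: measurableT_comp mg mc.
have push (g : 'rV[R]_n.+1 -> \bar R) : measurable_fun setT g -> (forall x, 0 <= g x)%E ->
   (\int[lebesgue_rV R n.+1]_x g x = \int[leb]_a \int[lebesgue_rV R n]_x g (rV_cons (a, x)))%E.
  move=> mg g0.
  transitivity (\int[(leb \x lebesgue_rV R n)%E]_z g (rV_cons z))%E.
    exact: (ge0_integral_pushforward mc (leb \x lebesgue_rV R n)%E
      measurableT mg (in1W g0)).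
  by rewrite fubini_tonelli1//; exact: mrc.
have mfs (g : 'rV[R]_n.+1 -> \bar R) : measurable_fun setT g ->
    measurable_fun setT (g \o *:%R s).
  by move=> mg; apply: measurableT_comp => //; exact: measurable_rV_scale.
pose F := fun a => (\int[lebesgue_rV R n]_x f (rV_cons (a, s *: x)%R))%E.
have mg : measurable_fun setT (fun z : measurableTypeR R * 'rV[R]_n => f (rV_cons (z.1, s *: z.2))).
  apply: (measurableT_comp (mrc f mf)); apply/measurable_fun_pairP; split => /=.
    exact: measurable_fst.
  exact: (measurableT_comp (@measurable_rV_scale n s) measurable_snd).
have mF : measurable_fun setT F.
  exact: (measurable_fun_fubini_tonelli_F _ mg).
rewrite push// push//; last exact: mfs.
transitivity (\int[leb]_a ((s ^+ n)%:E * F a))%E.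
  apply: eq_integral => a _; rewrite ih//.
  by apply: measurableT_comp (mrc _ mf) _; exact: measurable_pair1.
rewrite ge0_integralZl//; last first.
- by rewrite lee_fin exprn_ge0// ltW.
- by move=> a _; exact: integral_ge0.
rewrite [in LHS](ge0_integral_lebesgue_scale s0)//; last by move=> a; exact: integral_ge0.
rewrite muleA -EFinM mulrC -exprS; congr (_ * _)%E.
by apply: eq_integral => a _; apply: eq_integral => x _; rewrite rV_cons_scale.
Qed.
End scaling.

(** * The Laplace functional of a Poisson process *)
Section exp_neg.
Context {R : realType}.
Implicit Types x y : \bar R.

(** The decreasing exponential on the extended half-line, zero at [+oo]: the sums
    over the points of a process may diverge. *)
Definition exp_neg y : R := if y \is a fin_num then expR (- `|fine y|) else 0.

Lemma exp_neg01 y : 0 <= exp_neg y <= 1.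
Proof.
rewrite /exp_neg; case: ifP => _; last by rewrite lexx ler01.
by rewrite expR_ge0 -expR0 ler_expR oppr_le0 normr_ge0.
Qed.

Lemma exp_negE (r : R) : 0 <= r -> exp_neg r%:E = expR (- r).
Proof. by move=> r0; rewrite /exp_neg/= ger0_norm. Qed.

Lemma exp_neg0 : exp_neg 0 = 1.
Proof. by rewrite exp_negE// oppr0 expR0. Qed.

Lemma exp_negD x y : (0 <= x)%E -> (0 <= y)%E ->
  exp_neg (x + y) = exp_neg x * exp_neg y.
Proof.
case: x => [x| |]; case: y => [y| |]//; rewrite ?lee_fin => x0 y0.
- by rewrite -EFinD !exp_negE ?addr_ge0// opprD expRD.
- by rewrite addey// /exp_neg/= mulr0.
- by rewrite addye// /exp_neg/= mul0r.
- by rewrite addye// /exp_neg/= mul0r.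
Qed.

Lemma exp_neg_sum (I : Type) (s : seq I) (f : I -> \bar R) :
  (forall i, 0 <= f i)%E ->
  exp_neg (\sum_(i <- s) f i)%E = \prod_(i <- s) exp_neg (f i).
Proof.
move=> f0; elim: s => [|a s ih]; first by rewrite !big_nil exp_neg0.
by rewrite !big_cons exp_negD ?ih// sume_ge0.
Qed.

Lemma measurable_exp_neg : measurable_fun setT exp_neg.
Proof.
apply: measurable_fun_ifT => //=.
- apply: (measurable_fun_bool true); rewrite setTI.
  rewrite (_ : _ @^-1` _ = ~` ([set -oo%E] `|` [set +oo%E])).
    by apply: measurableC; apply: measurableU; exact: emeasurable_set1.
  apply/seteqP; split => y /=; rewrite fin_numE.
    by move=> /andP[/eqP a /eqP b] [].
  by move=> /not_orP[/eqP a /eqP b]; rewrite a.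
- apply: measurableT_comp => //; apply: measurableT_comp => //.
  by apply: measurableT_comp => //; exact: measurable_fine.
Qed.

Lemma cvg_exp_neg (u : nat -> \bar R) l : (forall n, 0 <= u n)%E ->
  u n @[n --> \oo] --> l -> exp_neg (u n) @[n --> \oo] --> exp_neg l.
Proof.
move=> u0 ul; have l0 : (0 <= l)%E.
  by rewrite -(cvg_lim _ ul)//; apply: lime_ge; [exact: cvgP ul|exact: nearW].
case: l l0 ul => [l| |]//; rewrite ?lee_fin => l0 ul.
- rewrite exp_negE//.
  have fu : \forall n \near \oo, exp_neg (u n) = expR (- fine (u n)).
    move/fine_cvgP : ul => -[+ _]; apply: filterS => n fn.
    by rewrite /exp_neg fn ger0_norm// fine_ge0.
  apply: cvg_trans.
    apply: near_eq_cvg; near=> n; apply/esym; near: n; exact: fu.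
  have /cvgN h : fine (u n) @[n --> \oo] --> l by case/fine_cvgP : ul.
  by apply: (cvg_comp _ _ h); exact: continuous_expR.
- rewrite {2}/exp_neg/=; apply/cvgrPdist_lt => e e0.
  move/cvgeyPgt : ul => /(_ (- ln e)) ; apply: filterS => n un.
  rewrite sub0r normrN ger0_norm; last by case/andP: (exp_neg01 (u n)).
  rewrite /exp_neg; case: ifPn => // fn.
  rewrite ger0_norm ?fine_ge0//.
  rewrite -ltr_ln ?posrE ?expR_gt0// expRK ltrNl.
  by rewrite -lte_fin fineK.
Unshelve. all: by end_near. Qed.

End exp_neg.

Section esum_counting.
Context {R : realType} {T : choiceType}.
Local Open Scope ereal_scope.

Lemma esum_cst (S : set T) (a : R) : (0 <= a)%R ->
  \esum_(x in S) a%:E = a%:E * counting S.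
Proof.
move=> a0; rewrite /counting; case: ifPn => [/asboolP finS|/asboolPn infS].
  rewrite (@esum_fset R T S (fun=> a%:E))//.
  rewrite fsbig_finite//= sumEFin big_const_seq count_predT iter_addr addr0.
  by rewrite -EFinM mulr_natr.
have [->|aN0] := eqVneq a 0%R; first by rewrite mul0e esum1.
have {aN0}a0 : (0 < a)%R by rewrite lt_neqAle eq_sym aN0.
rewrite gt0_muley ?lte_fin//; apply/eqyP => A A0.
have [F FS AF] := infinite_set_fset (Num.truncn (A / a)).+1 infS.
apply: esum_ge; exists [set` F]; first by split.
rewrite fsbig_finite//= set_fsetK sumEFin big_const_seq count_predT iter_addr addr0.
rewrite lee_fin -mulr_natr mulrC -ler_pdivrMr//.
by rewrite (le_trans (ltW (truncnS_gt _)))// ler_nat.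
Qed.

(** Monotone convergence for the counting measure on [S]. *)
Lemma esum_lim_nd (S : set T) (f : nat -> T -> R) (g : T -> \bar R) :
  (forall n x, 0 <= f n x)%R ->
  (forall x, {homo (f^~ x) : m n / (m <= n)%N >-> (m <= n)%R}) ->
  (forall x, (f n x)%:E @[n --> \oo] --> g x) ->
  \esum_(x in S) (f n x)%:E @[n --> \oo] --> \esum_(x in S) g x.
Proof.
move=> f0 ndf fg.
have fleg n x : (f n x)%:E <= g x.
  rewrite -(cvg_lim _ (fg x))//; apply: lime_ge; first exact: cvgP (fg x).
  by exists n => // m /= nm; rewrite lee_fin ndf.
have nds : nondecreasing_seq (fun n => \esum_(x in S) (f n x)%:E).
  by move=> m n mn; apply: le_esum => x _; rewrite lee_fin ndf.
rewrite (_ : esum S g = ereal_sup (range (fun n => \esum_(x in S) (f n x)%:E))).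
  exact: ereal_nondecreasing_cvgn.
apply/eqP; rewrite eq_le; apply/andP; split; last first.
  by apply: ge_ereal_sup => _ [n _ <-]; exact: le_esum.
apply: ge_ereal_sup => _ [F [finF FS] <-].
have : (\sum_(x \in F) (f n x)%:E) @[n --> \oo] --> \sum_(x \in F) g x.
  rewrite fsbig_finite//=; under eq_fun do rewrite fsbig_finite//=.
  by apply: cvg_nnesum => // x _; apply: nearW => n; rewrite lee_fin.
move=> cF; rewrite -(cvg_lim _ cF)//; apply: lime_le; first exact: cvgP cF.
apply: nearW => n; apply: le_trans (_ : \esum_(x in S) (f n x)%:E <= _).
  by apply: esum_ge; exists F.
by apply: ereal_sup_ubound; exists n.
Qed.

End esum_counting.

Lemma nneseries_expR (R : realType) (x : R) : 0 <= x ->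
  (\sum_(k <oo) (x ^+ k / k`!%:R)%:E = (expR x)%:E)%E.
Proof.
move=> x0; rewrite /expR -EFin_lim; last exact: is_cvg_series_exp_coeff.
apply/congr_lim/funext => k /=; rewrite /series/= -sumEFin//.
Qed.

Section poisson.
Local Open Scope ereal_scope.
Context d (Omega : measurableType d) (R : realType) (P : probability Omega R).
Context d' (T : measurableType d') (m : {measure set T -> \bar R}).
Context (N : Omega -> set T) (N_poisson : poisson_process P m N).

Lemma npoints_ge0 A w : 0 <= npoints R N A w.
Proof. by rewrite /npoints /counting; case: ifP => // _; rewrite leey. Qed.

Lemma measurable_npoints A : measurable A -> measurable_fun setT (npoints R N A).
Proof. by case: N_poisson => + _ _ _; apply. Qed.

(** The Laplace transform of a Poisson variable.  The events of having exactly [k]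
    points fill the space, because their probabilities add up to one. *)
Lemma poisson_laplace_set (A : set T) (a : R) : measurable A -> m A < +oo ->
  (0 <= a)%R ->
  \int[P]_w (exp_neg (a%:E * npoints R N A w))%:E =
  (expR (- ((1 - expR (- a)) * fine (m A))))%:E.
Proof.
move=> mA mAoo a0; set mu := fine (m A).
have mu0 : (0 <= mu)%R by exact: fine_ge0.
pose E k := [set w | npoints R N A w = k%:R%:E :> \bar R].
have mE k : measurable (E k).
  have := measurable_npoints mA measurableT (emeasurable_set1 k%:R%:E).
  by rewrite setTI.
have pE k : P (E k) = (expR (- mu) * mu ^+ k / k`!%:R)%:E.
  by case: N_poisson => _ + _ _; apply.
have tE : trivIset setT E.
  apply/trivIsetP => i j _ _ ij; apply/seteqP; split => // w [/=].
  by rewrite /E/= => -> [] /eqP; rewrite eqr_nat (negbTE ij).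
have sumE (s : R) : (0 <= s)%R ->
    \sum_(k <oo) (s ^+ k)%:E * P (E k) = (expR (- mu + s * mu))%:E.
  move=> s0; transitivity (\sum_(k <oo) (expR (- mu))%:E * ((s * mu) ^+ k / k`!%:R)%:E).
    by apply: eq_eseriesr => k _; rewrite pE -!EFinM exprMn; congr EFin; ring.
  rewrite nneseriesZl; last by move=> k _; rewrite lee_fin divr_ge0// exprn_ge0// mulr_ge0.
  by rewrite nneseries_expR ?mulr_ge0// -EFinM -expRD.
have mU : measurable (\bigcup_k E k) by exact: bigcup_measurable.
have P1 : P (\bigcup_k E k) = 1.
  rewrite measure_bigcup// (_ : \sum_(_ <oo | _) _ = \sum_(k <oo) (1 ^+ k)%:E * P (E k)).
    by rewrite sumE// mul1r addNr expR0.
  rewrite eseries_mkcond.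
  by apply: eq_eseriesr => k _; rewrite in_setT expr1n mul1e.
have mf : measurable_fun setT (fun w => (exp_neg (a%:E * npoints R N A w))%:E : \bar R).
  apply/measurable_EFinP/measurableT_comp; first exact: measurable_exp_neg.
  by apply: measurable_funeM; exact: measurable_npoints.
rewrite (ge0_negligible_integral (N := ~` \bigcup_k E k))//; last 3 first.
- exact: measurableC.
- by move=> w _; rewrite lee_fin; case/andP: (exp_neg01 (a%:E * npoints R N A w)).
- by apply: etrans; first exact: probability_setC; rewrite ?P1 ?subee.
rewrite setTD setCK ge0_integral_bigcup//; last 2 first.
- exact: measurable_funTS.
- by move=> w _; rewrite lee_fin; case/andP: (exp_neg01 (a%:E * npoints R N A w)).
rewrite (_ : \sum_(_ <oo) _ = \sum_(k <oo) (expR (- a) ^+ k)%:E * P (E k)); last first.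
  apply: eq_eseriesr => k _.
  transitivity (\int[P]_(w in E k) cst (expR (- a) ^+ k)%:E w).
    apply: eq_integral => w; rewrite inE /E/= => ->.
    by rewrite -EFinM exp_negE ?mulr_ge0// -expRM_natr mulNr.
  by rewrite integral_cst.
by rewrite sumE ?expR_ge0//; congr ((expR _)%:E); ring.
Qed.

(** The counts of disjoint sets are independent, so the transform factorises. *)
Lemma poisson_laplace_simple l (A : 'I_l -> set T) (a : 'I_l -> R) :
  (forall i, measurable (A i)) -> trivIset setT A -> (forall i, m (A i) < +oo) ->
  (forall i, 0 <= a i)%R ->
  \int[P]_w (exp_neg (\sum_(i < l) (a i)%:E * npoints R N (A i) w))%:E =
  (expR (- \sum_(i < l) (1 - expR (- a i)) * fine (m (A i))))%:E.
Proof.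
move=> mA tA mAoo a0.
have indep : mutually_independent P (fun i => npoints R N (A i)).
  by case: N_poisson => _ _ _; apply.
pose g (i : 'I_l) (y : \bar R) : R := exp_neg ((a i)%:E * y).
have := @expectation_prod_indep _ _ _ P _ _ _ _ _ indep [fset i | i : 'I_l]%fset g.
have bigE (V : Type) (idx : V) (op : Monoid.com_law idx) (F : 'I_l -> V) :
    \big[op/idx]_(i <- [fset i | i : 'I_l]%fset) F i = \big[op/idx]_(i < l) F i.
  rewrite -[RHS]big_enum/=; apply: perm_big; apply: uniq_perm => //.
  - exact: fset_uniq.
  - exact: enum_uniq.
  - by move=> i; rewrite !inE/= mem_enum.
rewrite bigE; under eq_integral do rewrite bigE.
move=> h; transitivity (\int[P]_w (\prod_(i < l) g i (npoints R N (A i) w))%:E).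
  apply: eq_integral => w _; rewrite exp_neg_sum// => i.
  by rewrite mule_ge0 ?lee_fin// npoints_ge0.
rewrite {}h.
- rewrite -sumrN expR_sum; congr EFin; apply: eq_bigr => i _.
  by rewrite /g poisson_laplace_set.
- by move=> i; exact: measurable_npoints.
- by move=> i; apply: measurableT_comp; [exact: measurable_exp_neg|exact: measurable_funeM].
- by move=> i t; exact: exp_neg01.
Qed.

End poisson.

Import HBNNSimple.

(** The level zero is left out, by an empty set, so that every point of the sets
    carries a positive value: if [g] is integrable these sets have finite mass. *)
Lemma nnsfun_level_sets d (T : measurableType d) (R : realType) (g : {nnsfun T >-> R}) :
  exists l (A : 'I_l -> set T) (a : 'I_l -> R),
  [/\ forall i, measurable (A i), trivIset setT A, forall i, 0 <= a i,
      forall x, g x = \sum_(i < l) a i * \1_(A i) x &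
      forall i x, A i x -> 0 < a i /\ g x = a i].
Proof.
pose s : seq R := fset_set (range g).
have us : uniq s by exact: fset_uniq.
pose a (i : 'I_(size s)) := s`_i.
have gs x : g x \in s by rewrite in_fset_set// inE; exists x.
have a0 i : 0 <= a i.
  have : a i \in s by exact: mem_nth.
  by rewrite in_fset_set// inE => -[x _ <-].
pose A i := if a i == 0 then set0 else g @^-1` [set a i].
exists (size s), A, a; split => //.
- by move=> i; rewrite /A; case: ifP.
- move=> i j _ _ [x [+ +]]; rewrite /A; case: ifP => // _; case: ifP => // _ /= -> /eqP.
  by rewrite /a nth_uniq// => /eqP/val_inj.
- move=> x; rewrite [LHS](_ : _ = \sum_(i < size s) a i * (a i == g x)%:R).
    apply: eq_bigr => i _; rewrite indicE /A; have [->|ai0] := eqVneq (a i) 0;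
      first by rewrite !mul0r.
    congr (_ * (nat_of_bool _)%:R); apply/eqP/idP; rewrite inE /=; first by move=> ->.
    by move=> ->.
  have lt : (index (g x) s < size s)%N by rewrite index_mem.
  rewrite (bigD1 (Ordinal lt))//= /a/= nth_index// eqxx mulr1 big1 ?addr0// => i /eqP ij.
  case: eqVneq => [e|]; last by rewrite mulr0.
  by exfalso; apply: ij; apply: val_inj; rewrite /= -e index_uniq.
- move=> i x; rewrite /A; case: ifPn => // ai0 /= ->.
  by rewrite lt_neqAle eq_sym ai0 a0.
Qed.

Section poisson.
Local Open Scope ereal_scope.

Lemma esum_simple (R : realType) (T : choiceType) l (A : 'I_l -> set T)
   (a : 'I_l -> R) (S : set T) : (forall i, 0 <= a i)%R ->
  \esum_(x in S) (\sum_(i < l) a i * \1_(A i) x)%:E =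
  \sum_(i < l) (a i)%:E * counting (S `&` A i).
Proof.
move=> a0; transitivity (\esum_(x in S) \sum_(i < l) (a i * \1_(A i) x)%:E).
  by apply: eq_esum => x _; rewrite sumEFin.
rewrite esum_sum; last by move=> x i _ _; rewrite lee_fin mulr_ge0// indicE.
apply: eq_bigr => i _; rewrite -esum_cst// esum_mkcondr.
by apply: eq_esum => x _; rewrite indicE; case: ifP; rewrite ?mulr1 ?mulr0.
Qed.

Context d (Omega : measurableType d) (R : realType) (P : probability Omega R).
Context d' (T : measurableType d') (m : {measure set T -> \bar R}).
Context (N : Omega -> set T) (N_poisson : poisson_process P m N).

Let Z (f : T -> R) w : \bar R := \esum_(x in N w) (f x)%:E.

Lemma measurable_esum_poisson (f : T -> R) : measurable_fun setT f -> (forall x, 0 <= f x)%R ->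
  measurable_fun setT (Z f).
Proof.
move=> mf f0.
have mfE : measurable_fun setT (EFin \o f) by exact/measurable_EFinP.
pose f_ := nnsfun_approx measurableT mfE.
apply: (@emeasurable_fun_cvg _ _ _ setT (fun n => Z (f_ n))).
  move=> n; have [l [A [a [mA tA a0 gE _]]]] := nnsfun_level_sets (f_ n).
  rewrite (_ : Z _ = fun w => \sum_(i < l) (a i)%:E * npoints R N (A i) w).
    by apply: emeasurable_sum => i; apply: measurable_funeM;
      exact: measurable_npoints N_poisson _ _.
  apply/funext => w; rewrite /npoints -esum_simple//.
  by apply: eq_esum => x _; rewrite gE.
move=> w _; apply: esum_lim_nd => //.
- by move=> x k n kn; exact/lefP/nd_nnsfun_approx.
- by move=> x; apply: cvg_nnsfun_approx => // y _; rewrite lee_fin.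
Qed.

(** Both sides pass to the limit along simple functions increasing to [f]: the
    expectation by dominated convergence, the exponent by monotone convergence. *)
Lemma poisson_laplace (f : T -> R) : measurable_fun setT f -> (forall x, 0 <= f x)%R ->
  \int[m]_x (f x)%:E < +oo ->
  \int[P]_w (exp_neg (Z f w))%:E =
  (expR (- fine (\int[m]_x (1 - expR (- f x))%:E)))%:E.
Proof.
move=> mf f0 foo.
have mfE : measurable_fun setT (EFin \o f) by exact/measurable_EFinP.
pose f_ := nnsfun_approx measurableT mfE.
have ndf x : {homo (fun n => f_ n x) : k n / (k <= n)%N >-> (k <= n)%R}.
  by move=> k n kn; exact/lefP/nd_nnsfun_approx.
have cvf x : (f_ n x)%:E @[n --> \oo] --> (f x)%:E.
  by apply: cvg_nnsfun_approx => // y _; rewrite lee_fin.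
have fler n x : (f_ n x <= f x)%R.
  rewrite -lee_fin -(cvg_lim _ (cvf x))//; apply: lime_ge; first exact: cvgP (cvf x).
  by exists n => // k /= nk; rewrite lee_fin ndf.
have g0 (r : R) : (0 <= r)%R -> (0 <= 1 - expR (- r) <= r)%R.
  move=> r0; rewrite subr_ge0 -expR0 ler_expR oppr_le0 r0/= expR0.
  by have := expR_ge1Dx (- r)%R; lra.
pose L n := \int[m]_x (1 - expR (- f_ n x))%:E.
have mexp (g : T -> R) : measurable_fun setT g ->
    measurable_fun setT (fun x => (1 - expR (- g x))%:E : \bar R).
  by move=> mg; apply/measurable_EFinP; apply: measurable_funB => //;
     do 2 apply: measurableT_comp => //.
have Lfin (g : T -> R) : measurable_fun setT g -> (forall x, 0 <= g x <= f x)%R ->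
    \int[m]_x (1 - expR (- g x))%:E \is a fin_num.
  move=> mg gf; rewrite ge0_fin_numE; last first.
    by apply: integral_ge0 => x _; rewrite lee_fin; case/andP : (g0 (g x) (andP (gf x)).1).
  apply: le_lt_trans foo; apply: ge0_le_integral => //.
  - by move=> x _; rewrite lee_fin; case/andP : (g0 (g x) (andP (gf x)).1).
  - exact: mexp.
  - by move=> x _; rewrite lee_fin; have /andP[? ?] := gf x; have /andP[_ +] :=
      g0 (g x) (andP (gf x)).1; lra.
have cvL : L n @[n --> \oo] --> \int[m]_x (1 - expR (- f x))%:E.
  rewrite (_ : \int[m]_x (1 - expR (- f x))%:E =
               \int[m]_x limn (fun n => (1 - expR (- f_ n x))%:E)).
    apply: cvg_monotone_convergence => //.
    - by move=> n; apply: mexp.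
    - by move=> n x _; rewrite lee_fin; case/andP: (g0 (f_ n x) (fun_ge0 _)).
    - move=> x _ k n kn; rewrite lee_fin lerD2l lerN2 ler_expR lerN2; exact: ndf.
  apply: eq_integral => x _; apply/esym/cvg_lim => //.
  apply: cvg_EFin; first exact: nearW.
  apply: cvgB; first exact: cvg_cst.
  apply: (cvg_comp _ _ (cvgN (fine_cvg (cvf x)))); exact: continuous_expR.
have simpleE n : \int[P]_w (exp_neg (Z (f_ n) w))%:E = (expR (- fine (L n)))%:E.
  have [l [A [a [mA tA a0 gE Ax]]]] := nnsfun_level_sets (f_ n).
  have mAoo i : m (A i) < +oo.
    have [A0|[y Ay]] : A i = set0 \/ exists y, A i y.
      by have [->|/set0P] := eqVneq (A i) set0; [left|right].
      by rewrite A0 measure0.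
    have [ai0 _] := Ax _ _ Ay.
    rewrite -(@lte_pmul2l _ (a i)%:E)// ?lte_fin// gt0_muley ?lte_fin//.
    apply: le_lt_trans foo.
    rewrite -[X in m X]setIT -integral_indic// -ge0_integralZl//; last 2 first.
    - exact/measurable_EFinP.
    - by rewrite lee_fin ltW.
    apply: ge0_le_integral => //.
    - by move=> x _; rewrite mule_ge0 ?lee_fin// ltW.
    - by apply: measurable_funeM; exact/measurable_EFinP.
    - move=> x _; rewrite -EFinM lee_fin indicE; case: (boolP (x \in A i));
        rewrite ?mulr0// inE => Aix.
      by rewrite mulr1 -(Ax _ _ Aix).2.
  have -> : L n = \sum_(i < l) (1 - expR (- a i))%:E * m (A i).
    have e0 i : (0 <= 1 - expR (- a i))%R by case/andP: (g0 _ (a0 i)).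
    transitivity (\int[m]_x (\sum_(i < l) ((1 - expR (- a i))%:E * (\1_(A i) x)%:E))).
      apply: eq_integral => x _; rewrite sumEFin; congr EFin.
      have [[i Aix]|noA] := pselect (exists i, A i x).
        rewrite (Ax _ _ Aix).2 (bigD1 i)//= indicE mem_set// mulr1 big1 ?addr0// => j ji.
        rewrite indicE memNset ?mulr0// => Ajx; move/eqP: ji; apply.
        by apply: tA => //; exists x.
      rewrite gE [in LHS]big1 ?[in RHS]big1 ?oppr0 ?expR0 ?subrr// => i _;
        by rewrite indicE memNset ?mulr0// => Aix; apply: noA; exists i.
    rewrite ge0_integral_sum//.
    - apply: eq_bigr => i _; rewrite ge0_integralZl ?lee_fin//; first by rewrite integral_indic//
        setIT.
      exact/measurable_EFinP.
    - by move=> i; apply: measurable_funeM; exact/measurable_EFinP.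
    - by move=> i x _; rewrite mule_ge0 ?lee_fin.
  transitivity (\int[P]_w (exp_neg (\sum_(i < l) (a i)%:E * npoints R N (A i) w))%:E).
    apply: eq_integral => w _; congr ((exp_neg _)%:E); rewrite /npoints -esum_simple//.
    by apply: eq_esum => x _; rewrite gE.
  rewrite (poisson_laplace_simple N_poisson)//; congr ((expR (- _)) %:E).
  rewrite -[LHS]/(fine _%:E) -sumEFin; congr fine; apply: eq_bigr => i _.
  by rewrite EFinM fineK// ge0_fin_numE.
have cv1 : \int[P]_w (exp_neg (Z (f_ n) w))%:E @[n --> \oo] --> \int[P]_w (exp_neg (Z f w))%:E.
  have mZ (g : T -> R) : measurable_fun setT g -> (forall x, 0 <= g x)%R ->
      measurable_fun setT (fun w => (exp_neg (Z g w))%:E).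
    move=> mg g0'; apply/measurable_EFinP; apply: measurableT_comp; first exact: measurable_exp_neg.
    exact: measurable_esum_poisson.
  have [|||||_ _ //] := @dominated_convergence _ _ _ P setT measurableT
    (fun n w => (exp_neg (Z (f_ n) w))%:E) (fun w => (exp_neg (Z f w))%:E) (cst 1).
  - by move=> n; exact: mZ.
  - exact: mZ.
  - apply: aeW => w _; apply: cvg_EFin; first exact: nearW.
    apply: cvg_exp_neg; first by move=> n; apply: esum_ge0 => x _; rewrite lee_fin.
    exact: esum_lim_nd.
  - exact: finite_measure_integrable_cst.
  - by apply: aeW => w n _; rewrite abse_EFin lee_fin ger0_norm;
      case/andP: (exp_neg01 (Z (f_ n) w)).
have cv2 : \int[P]_w (exp_neg (Z (f_ n) w))%:E @[n --> \oo] -->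
    (expR (- fine (\int[m]_x (1 - expR (- f x))%:E)))%:E.
  under eq_fun do rewrite simpleE.
  apply: cvg_EFin; first exact: nearW.
  apply: (cvg_comp _ _ (cvgN (fine_cvg _))); last exact: continuous_expR.
  by rewrite fineK//; apply: Lfin => // x; rewrite f0 lexx.
exact: (cvg_unique _ cv1 cv2).
Qed.

End poisson.

Section poisson_finite.
Local Open Scope ereal_scope.
Context d (Omega : measurableType d) (R : realType) (P : probability Omega R).
Context d' (T : measurableType d') (m : {measure set T -> \bar R}).
Context (N : Omega -> set T) (N_poisson : poisson_process P m N).

(** Where the sum of [f] is infinite, so is that of [eps * f] for every [eps > 0],
    and there the Laplace functional vanishes.  The probability of this event is thus
    at most [1 - exp (- eps I)], with [I] the integral of [f]. *)
Lemma poisson_esum_finite (f : T -> R) : measurable_fun setT f ->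
  (forall x, 0 <= f x)%R -> \int[m]_x (f x)%:E < +oo ->
  P [set w | \esum_(x in N w) (f x)%:E = +oo] = 0.
Proof.
move=> mf f0 foo.
pose Z (g : T -> R) w : \bar R := \esum_(x in N w) (g x)%:E.
have mZ (g : T -> R) : measurable_fun setT g -> (forall x, 0 <= g x)%R -> measurable_fun setT (Z g).
  exact: (measurable_esum_poisson N_poisson).
have mE : measurable [set w | Z f w = +oo].
  by have := mZ f mf f0 measurableT _ (emeasurable_set1 +oo); rewrite setTI.
have Ifin : \int[m]_x (f x)%:E \is a fin_num.
  by rewrite ge0_fin_numE//; apply: integral_ge0 => x _; rewrite lee_fin.
set I := fine (\int[m]_x (f x)%:E).
have bound k : P [set w | Z f w = +oo] <= (k.+1%:R^-1 * I)%:E.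
  pose fk x := (k.+1%:R^-1 * f x)%R.
  have fk0 x : (0 <= fk x)%R by rewrite mulr_ge0.
  have mfk : measurable_fun setT fk by exact: measurable_funM.
  have fkI : \int[m]_x (fk x)%:E = (k.+1%:R^-1 * I)%:E.
    under eq_integral do rewrite EFinM.
    rewrite ge0_integralZl//; first by rewrite EFinM fineK.
    - exact/measurable_EFinP.
    - by move=> x _; rewrite lee_fin.
  have Zk w : Z f w = +oo -> Z fk w = +oo.
    move=> Zoo; apply/eqP; rewrite eq_le leey leNgt/=; apply/negP => Zk.
    have : Z f w = \sum_(i < k.+1) Z fk w.
      rewrite /Z -esum_sum; last by move=> *; rewrite lee_fin.
      apply: eq_esum => x _; rewrite sumEFin; congr EFin.
      by rewrite sumr_const card_ord -mulr_natl mulrA divff ?mul1r// pnatr_eq0.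
    rewrite Zoo => /esym/eqP; apply/negP; rewrite lt_eqF//.
    by apply: lte_sum_pinfty.
  have := poisson_laplace N_poisson mfk fk0; rewrite fkI ltry => /(_ isT).
  rewrite -/(Z fk); set J := fine _ => lap.
  have J0 : (J <= k.+1%:R^-1 * I)%R.
    have le1 : \int[m]_x (1 - expR (- fk x))%:E <= (k.+1%:R^-1 * I)%:E.
      rewrite -fkI; apply: ge0_le_integral => //.
      - by move=> x _; rewrite lee_fin subr_ge0 -expR0 ler_expR oppr_le0.
      - apply/measurable_EFinP; apply: measurable_funB => //.
        by do 2 apply: measurableT_comp => //.
      - exact/measurable_EFinP.
      - by move=> x _; rewrite lee_fin; have := expR_ge1Dx (- fk x)%R; lra.
    rewrite -lee_fin fineK// ge0_fin_numE ?(le_lt_trans le1) ?ltry//.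
    by apply: integral_ge0 => x _; rewrite lee_fin subr_ge0 -expR0 ler_expR oppr_le0.
  have : (expR (- J))%:E <= P (~` [set w | Z f w = +oo]).
    rewrite -lap -[X in _ <= P X]setIT -integral_indic//; last exact: measurableC.
    apply: ge0_le_integral => //.
    - by move=> w _; rewrite lee_fin; case/andP: (exp_neg01 (Z fk w)).
    - apply/measurable_EFinP; apply: measurableT_comp; first exact: measurable_exp_neg.
      exact: mZ.
    - by apply/measurable_EFinP; apply: measurable_indic; exact: measurableC.
    - move=> w _; rewrite lee_fin indicE.
      case: (boolP (w \in _)) => [_|]; first by case/andP: (exp_neg01 (Z fk w)).
      by rewrite notin_setE/= => /contrapT/Zk; rewrite /Z => ->.
  rewrite [X in _ <= X -> _](probability_setC P mE) => h.
  have : P [set w | Z f w = +oo] \is a fin_num by exact: fin_num_measure.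
  move: h; case: (P _) => // p; rewrite -EFinB !lee_fin => h _.
  by move: J0 (expR_ge1Dx (- J)%R) h; move: (_ * I)%R (expR _) => X Y; lra.
apply/eqP; rewrite eq_le measure_ge0 andbT.
have : (k.+1%:R^-1 * I)%:E @[k --> \oo] --> 0%:E.
  apply: cvg_EFin; first exact: nearW.
  rewrite -(mul0r I); apply: cvgM; last exact: cvg_cst.
  exact: cvg_harmonic.
by move=> c; apply: cvge_to_ge c _; exact: nearW.
Qed.

End poisson_finite.

(** * Local bounds for concave functions on the simplex *)
Section concave_geometry.
Context (R : realType) (n : nat) (n_ge2 : (2 <= n)%N).
Local Notation S := (set_type (simplex R n)).
Implicit Types (f g : S -> R) (x y z d : 'rV[R]_n).

(** Extension by zero to the whole space, so that convex combinations can be written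
    before they are known to lie in the simplex. *)
Definition extend f x : R := if insub x is Some p then f p else 0.

Lemma extend_val f (p : S) : extend f (val p) = f p.
Proof. by rewrite /extend valK. Qed.

Lemma extendE f x (hx : simplex R n x) : extend f x = f (exist _ x (mem_set hx)).
Proof. by rewrite -extend_val. Qed.

Lemma simplex_val (p : S) : simplex R n (val p).
Proof. by case: p => x /= /set_mem. Qed.

Lemma simplex_pos x : (forall i, 0 < x 0 i) -> \sum_i x 0 i = 1 -> simplex R n x.
Proof.
move=> x0 x1; split=> // i; rewrite x0/= -x1 (bigD1 i)//= ltrDl.
have [j ji] : exists j : 'I_n, j != i.
  have h0 : (0 < n)%N by exact: leq_trans n_ge2.
  have [->|i0] := eqVneq i (Ordinal h0); last by exists (Ordinal h0); rewrite eq_sym.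
  by exists (Ordinal n_ge2).
rewrite (bigD1 j)//= ltr_pwDl// sumr_ge0// => k _; exact: ltW.
Qed.

Lemma simplex_conv x y t : 0 <= t <= 1 -> simplex R n x -> simplex R n y ->
  simplex R n (t *: x + (1 - t) *: y).
Proof.
move=> /andP[t0 t1] [x01 x1] [y01 y1]; apply: simplex_pos.
  move=> i; rewrite !mxE; have /andP[xi _] := x01 i; have /andP[yi _] := y01 i.
  by have [->|tN0] := eqVneq t 0; [lra|]; have : 0 < t by [rewrite lt_neqAle eq_sym tN0]; nra.
transitivity (t * \sum_i x 0 i + (1 - t) * \sum_i y 0 i).
  by rewrite !mulr_sumr -big_split/=; apply: eq_bigr => i _; rewrite !mxE.
by rewrite x1 y1; ring.
Qed.

Lemma concave_extend f t x y : concave f -> 0 <= t <= 1 ->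
  simplex R n x -> simplex R n y ->
  t * extend f x + (1 - t) * extend f y <= extend f (t *: x + (1 - t) *: y).
Proof.
move=> cf t01 hx hy; rewrite !extendE; first exact: simplex_conv.
by move=> h; apply: cf.
Qed.

(** The vertices of the copy of the simplex shrunk towards [d] by the ratio [s]. *)
Definition vertex d (s : R) (i : 'I_n) : 'rV[R]_n := (1 - s) *: d + s *: delta_mx 0 i.

Lemma simplex_shrink d s (mu : 'rV[R]_n) : 0 < s < 1 -> simplex R n d ->
  (forall i, 0 <= mu 0 i) -> \sum_i mu 0 i = 1 ->
  simplex R n ((1 - s) *: d + s *: mu).
Proof.
move=> /andP[s0 s1] [d01 d1] mu0 mu1; apply: simplex_pos.
  by move=> i; rewrite !mxE; have /andP[di _] := d01 i; have := mu0 i; nra.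
transitivity ((1 - s) * \sum_i d 0 i + s * \sum_i mu 0 i).
  by rewrite !mulr_sumr -big_split/=; apply: eq_bigr => i _; rewrite !mxE.
by rewrite d1 mu1; ring.
Qed.

Lemma sum_delta (i : 'I_n) : \sum_j (delta_mx 0 i : 'rV[R]_n) 0 j = 1.
Proof.
rewrite (bigD1 i)//= mxE !eqxx big1 ?addr0// => j /negbTE ji.
by rewrite mxE ji.
Qed.

Lemma simplex_vertex d s i : 0 < s < 1 -> simplex R n d -> simplex R n (vertex d s i).
Proof.
move=> s01 hd; apply: simplex_shrink => //; last exact: sum_delta.
by move=> j; rewrite mxE; case: (_ && _).
Qed.

(** On a simplex a concave function is at least its least value at the vertices:
    induction on the number of nonzero barycentric coordinates [mu]. *)
Lemma concave_ge_shrink f d s b (mu : 'rV[R]_n) : concave f -> simplex R n d -> 0 < s < 1 ->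
  (forall i, b <= extend f (vertex d s i)) ->
  (forall i, 0 <= mu 0 i) -> \sum_i mu 0 i = 1 ->
  b <= extend f ((1 - s) *: d + s *: mu).
Proof.
move=> cf hd s01 hb.
have [k] := ubnP #|[set i | mu 0 i != 0]|%SET; elim: k mu => // k ih mu + mu0 mu1.
have [i mui|mu00] := pickP [pred i | mu 0 i != 0]; last first.
  by exfalso; move: mu1; rewrite big1 => [/eqP|i _];
    [rewrite eq_sym oner_eq0|apply/eqP/negbFE/mu00].
rewrite /= in mui; rewrite ltnS => lek.
have sumD : mu 0 i + \sum_(j | j != i) mu 0 j = 1 by rewrite -mu1 [RHS](bigD1 i).
have sge0 : 0 <= \sum_(j | j != i) mu 0 j by exact: sumr_ge0.
have [mui1|mui1] := eqVneq (mu 0 i) 1.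
  have -> : mu = delta_mx 0 i; last exact: hb.
  apply/rowP => j; rewrite mxE eqxx/=; have [->//|ji] := eqVneq j i.
  apply/eqP; have : \sum_(j | j != i) mu 0 j = 0 by lra.
  by move/eqP; rewrite psumr_eq0// => /allP/(_ j); rewrite mem_index_enum ji => /(_ isT).
have mi0 : 0 < mu 0 i by rewrite lt_neqAle eq_sym mui mu0.
have mi1 : mu 0 i < 1 by rewrite lt_neqAle mui1; lra.
pose mu' := (1 - mu 0 i)^-1 *: (mu - mu 0 i *: delta_mx 0 i).
have mu'i : mu' 0 i = 0 by rewrite !mxE !eqxx mulr1 subrr mulr0.
have mu'j j : j != i -> mu' 0 j = (1 - mu 0 i)^-1 * mu 0 j.
  by move=> ji; rewrite !mxE (negbTE ji) andbF mulr0 subr0.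
have mu'0 j : 0 <= mu' 0 j.
  have [->|ji] := eqVneq j i; first by rewrite mu'i.
  by rewrite mu'j// mulr_ge0// invr_ge0; lra.
have mu'1 : \sum_j mu' 0 j = 1.
  rewrite (bigD1 i)//= mu'i add0r (eq_bigr _ mu'j) -mulr_sumr.
  by rewrite (_ : \sum_(_ | _) _ = 1 - mu 0 i) ?mulVf//; lra.
have hb' : b <= extend f ((1 - s) *: d + s *: mu').
  apply: ih => //; apply: leq_trans lek; apply: proper_card; apply/properP; split.
    apply/fintype.subsetP => j; rewrite !inE; apply: contra => /eqP muj.
    have [->|ji] := eqVneq j i; first by rewrite mu'i.
    by rewrite mu'j// muj mulr0.
  by exists i; rewrite !inE ?mu'i ?eqxx.
have -> : (1 - s) *: d + s *: mu =
    mu 0 i *: vertex d s i + (1 - mu 0 i) *: ((1 - s) *: d + s *: mu').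
  apply/rowP => j; rewrite /vertex /mu' !mxE.
  by field; lra.
apply: le_trans (concave_extend cf _ _ _).
- by have := hb i; nra.
- by rewrite !ltW.
- exact: simplex_vertex.
- exact: simplex_shrink.
Qed.

(** The lower bound is [concave_ge_shrink].  The upper bound follows from it by
    reflection in the centre [d]: [f y <= 2 f d - f (2 d - y)]. *)
Lemma concave_osc f d s b y : concave f -> simplex R n d -> 0 < s < 1 ->
  (forall i, b <= extend f (vertex d s i)) ->
  simplex R n y -> (forall i, `|y 0 i - d 0 i| <= s * d 0 i) ->
  b <= extend f y <= 2 * extend f d - b.
Proof.
move=> cf hd s01 hb; have [d01 d1] := hd.
have ge z : simplex R n z -> (forall i, (1 - s) * d 0 i <= z 0 i) -> b <= extend f z.
  move=> [_ z1] hz; have sN0 : s != 0 by case/andP: s01 => s0 _; rewrite gt_eqF.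
  have -> : z = (1 - s) *: d + s *: (s^-1 *: (z - (1 - s) *: d)).
    by rewrite scalerA divff// scale1r addrC subrK.
  apply: concave_ge_shrink => //.
    move=> i; rewrite !mxE mulr_ge0 ?subr_ge0 ?hz// invr_ge0 ltW//; by case/andP: s01.
  rewrite (eq_bigr (fun i => s^-1 * (z 0 i - (1 - s) * d 0 i))); last by move=> i _; rewrite !mxE.
  rewrite -mulr_sumr big_split/= sumrN -mulr_sumr z1 d1.
  by field.
move=> hy yd; have [_ y1] := hy; apply/andP; split.
  by apply: ge => // i; have := yd i; rewrite ler_norml => /andP[+ _]; lra.
pose z := 2 *: d - y.
have hz0 i : (1 - s) * d 0 i <= z 0 i.
  by rewrite !mxE; have := yd i; rewrite ler_norml => /andP[_ +]; lra.
have hz : simplex R n z.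
  apply: simplex_pos.
    move=> i; apply: lt_le_trans (hz0 i); have /andP[di _] := d01 i.
    by rewrite mulr_gt0//; move: s01 => /andP[]; lra.
  rewrite (eq_bigr (fun i => 2 * d 0 i - y 0 i)); last by move=> i _; rewrite !mxE.
  by rewrite big_split/= sumrN -mulr_sumr d1 y1; ring.
have := ge z hz hz0.
have h01 : 0 <= (2^-1 : R) <= 1 by lra.
have := concave_extend cf h01 hy hz.
have -> : 2^-1 *: y + (1 - 2^-1) *: z = d by apply/rowP => i; rewrite !mxE; field.
by lra.
Qed.

(** Concavity on the segments from [x] to the vertices of a fixed simplex makes the
    drop at the vertices of the simplex of ratio [s] linear in [s]. *)
Lemma concave_continuous_at f x e : concave f -> simplex R n x -> 0 < e ->
  exists2 s, 0 < s < 1 & forall y, simplex R n y ->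
    (forall i, `|y 0 i - x 0 i| <= s * x 0 i) -> `|extend f y - extend f x| <= e.
Proof.
move=> cf hx e0.
pose B := 1 + \sum_i `|extend f x - extend f (vertex x 2^-1 i)|.
have B1 : 1 <= B by rewrite lerDl sumr_ge0.
have hB i : extend f x - B <= extend f (vertex x 2^-1 i).
  have : `|extend f x - extend f (vertex x 2^-1 i)| <= B.
    by rewrite /B (bigD1 i)//= addrCA lerDl addr_ge0// sumr_ge0.
  by rewrite ler_norml; lra.
pose s := Num.min 2^-1 (e / (2 * B)).
have s0 : 0 < s by rewrite lt_min invr_gt0 ltr0n divr_gt0//; lra.
have s2 : s <= 2^-1 by rewrite ge_min lexx.
have se : 2 * s * B <= e.
  have : s <= e / (2 * B) by rewrite ge_min lexx orbT.
  by rewrite ler_pdivlMr; lra.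
have s01 : 0 < s < 1 by lra.
exists s => // y hy yx.
have hb i : extend f x - 2 * s * B <= extend f (vertex x s i).
  have h01 : 0 <= 2 * s <= 1 by lra.
  have h2 : 0 < (2^-1 : R) < 1 by lra.
  have := concave_extend cf h01 (simplex_vertex i h2 hx) hx.
  have -> : 2 * s *: vertex x 2^-1 i + (1 - 2 * s) *: x = vertex x s i.
    by apply/rowP => j; rewrite /vertex !mxE; field.
  apply: le_trans; have := hB i; nra.
have := concave_osc cf hx s01 hb hy yx.
by rewrite ler_norml; lra.
Qed.

End concave_geometry.

Section separability.
Context (R : realType) (n : nat) (n_ge2 : (2 <= n)%N).
Local Notation S := (set_type (simplex R n)).
Implicit Types (f g : S -> R) (x y z d : 'rV[R]_n).

Let n0 : n%:R != 0 :> R. Proof. by rewrite pnatr_eq0 -lt0n (leq_trans _ n_ge2). Qed.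

Lemma simplex_barycenter : simplex R n (const_mx n%:R^-1).
Proof.
apply: simplex_pos => //.
  by move=> i; rewrite mxE invr_gt0 lt_neqAle eq_sym n0 ler0n.
under eq_bigr do rewrite mxE; by rewrite sumr_const card_ord -[LHS]mulr_natl divff.
Qed.

Definition barycenter : S := exist _ (const_mx n%:R^-1) (mem_set simplex_barycenter).

(** Indices that do not code a rational point of the simplex give the barycenter. *)
Definition rat_point (k : nat) : S :=
  if (choice.unpickle k : option 'rV[rat]_n) is Some q then
    insubd barycenter (map_mx ratr q) else barycenter.

Lemma rat_pointE (q : 'rV[rat]_n) : simplex R n (map_mx ratr q) ->
  val (rat_point (choice.pickle q)) = map_mx ratr q.
Proof. by move=> hq; rewrite /rat_point choice.pickleK val_insubd mem_set. Qed.

(** All coordinates but one are rounded downwards; the remaining one absorbs the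
    difference, and stays positive because it increases. *)
Lemma rat_dense x e : simplex R n x -> 0 < e ->
  exists2 q : 'rV[rat]_n, simplex R n (map_mx ratr q) &
    forall i, `|ratr (q 0 i) - x 0 i| <= e.
Proof.
move=> [x01 x1] e0; pose i0 : 'I_n := Ordinal (leq_trans (leqnSn 1) n_ge2).
have n_gt0 : 0 < n%:R :> R by rewrite lt_neqAle eq_sym n0 ler0n.
have en0 : 0 < e / n%:R by rewrite divr_gt0.
have ex i : exists r : rat, Num.max 0 (x 0 i - e / n%:R) < ratr r < x 0 i.
  have lt : Num.max 0 (x 0 i - e / n%:R) < x 0 i.
    by have /andP[xi _] := x01 i; rewrite gt_max xi/=; lra.
  by have [r] := rat_in_itvoo lt; exists r.
have [r hr] := choice ex.
pose q : 'rV[rat]_n := \row_i (if i == i0 then 1 - \sum_(j | j != i0) r j else r i).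
have qi i : i != i0 -> q 0 i = r i by move=> /negbTE h; rewrite mxE h.
have q0 : ratr (q 0 i0) = 1 - \sum_(j | j != i0) ratr (r j) :> R.
  by rewrite mxE eqxx rmorphB rmorph1 rmorph_sum.
have x0E : x 0 i0 = 1 - \sum_(j | j != i0) x 0 j.
  by rewrite -x1 [in RHS](bigD1 i0)//= addrK.
have r1 i : 0 < ratr (r i) :> R by have := hr i; rewrite gt_max => /andP[/andP[]].
have r2 i : x 0 i - e / n%:R < ratr (r i) by have := hr i; rewrite gt_max => /andP[/andP[]].
have r3 i : ratr (r i) < x 0 i by have /andP[] := hr i.
have dif : 0 <= \sum_(j | j != i0) (x 0 j - ratr (r j)) <= e.
  apply/andP; split; first by apply: sumr_ge0 => j _; rewrite subr_ge0 ltW.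
  apply: (@le_trans _ _ (\sum_(j < n) e / n%:R)); last first.
    by rewrite sumr_const card_ord -[leLHS]mulr_natr divfK.
  rewrite [leRHS](bigD1 i0)//= -[leLHS]add0r lerD //; first exact: ltW.
  by apply: ler_sum => j _; have := r2 j; lra.
have q0x : ratr (q 0 i0) - x 0 i0 = \sum_(j | j != i0) (x 0 j - ratr (r j)).
  by rewrite q0 x0E sumrB; ring.
exists q.
  apply: simplex_pos => //.
    move=> i; rewrite mxE; have [->|ii0] := eqVneq i i0; last by rewrite qi.
    by have /andP[xi _] := x01 i0; lra.
  under eq_bigr do rewrite mxE; rewrite (bigD1 i0)//= q0.
  by under [X in _ + X]eq_bigr => i ii0 do rewrite qi//; ring.
move=> i; have [->|ii0] := eqVneq i i0.
  by rewrite q0x ger0_norm; case/andP: dif.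
rewrite qi// ler0_norm; last by have := r3 i; lra.
have ne : e / n%:R <= e by rewrite ler_pdivrMr// ler_peMr ?(ltW e0)// ler1n (leq_trans _ n_ge2).
by have := r2 i; lra.
Qed.

Definition close_at m f g :=
  forall k, (k < m)%N -> `|g (rat_point k) - f (rat_point k)| < m.+1%:R^-1.

Lemma close_at_rat m f g (q : 'rV[rat]_n) : close_at m f g ->
  simplex R n (map_mx ratr q) -> (choice.pickle q < m)%N ->
  `|extend g (map_mx ratr q) - extend f (map_mx ratr q)| < m.+1%:R^-1.
Proof. by move=> fg hq /fg; rewrite -!(extend_val _ (rat_point _)) rat_pointE. Qed.

(** By [concave_osc], a lower bound for [g] at the vertices of a small simplex with
    rational vertices and rational centre near [x], together with the value of [g] at
    the centre, brackets [g] around [x].  For [m] large all these points are among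
    those at which [g] and [f] are compared. *)
Lemma close_at_local f x e : concave f -> simplex R n x -> 0 < e ->
  exists (m0 : nat) (r : R), 0 < r /\ forall m g y, (m0 <= m)%N -> concave g -> close_at m f g ->
    simplex R n y -> (forall i, `|y 0 i - x 0 i| <= r) ->
    `|extend g y - extend f y| <= e.
Proof.
move=> cf hx e0; have e8 : 0 < e / 8 by lra.
have [s s01 hs] := concave_continuous_at n_ge2 cf hx e8.
have [s0 s1] := andP s01.
have [xm xm0 hxm] : exists2 xm, 0 < xm & forall i, xm <= x 0 i.
  exists (\big[Num.min/1]_(i < n) x 0 i).
    by apply: lt_bigmin => // i _; case/andP: (hx.1 i).
  by move=> i; exact: bigmin_le_cond.
have xm1 : xm < 1.
  apply: le_lt_trans (hxm (Ordinal (leq_trans (leqnSn 1) n_ge2))) _.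
  by case/andP: (hx.1 (Ordinal (leq_trans (leqnSn 1) n_ge2))).
(* a rational ratio, so that the vertices are rational points *)
have [sq hsq] : exists sq : rat, 0 < (ratr sq : R) < s * xm / 2.
  have lt : 0 < s * xm / 2 by rewrite divr_gt0// mulr_gt0.
  by have [r] := rat_in_itvoo lt; exists r.
set s' : R := ratr sq in hsq; have [s'0 s'x] := andP hsq.
have sxm : s * xm < 1 by nra.
have s'01 : 0 < s' < 1 by lra.
pose r := s' * xm / 4; have r0 : 0 < r by rewrite divr_gt0// mulr_gt0.
have [q hq qx] := rat_dense hx r0.
pose d : 'rV[R]_n := map_mx ratr q.
have dx i : `|d 0 i - x 0 i| <= r by rewrite mxE.
pose vq i : 'rV[rat]_n := (1 - sq) *: q + sq *: delta_mx 0 i.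
have vqE i : map_mx ratr (vq i) = vertex d s' i.
  rewrite /vertex /d /vq; apply/rowP => j; rewrite !mxE rmorphD !rmorphM rmorphB rmorph1.
  by congr (_ + _ * _); case: (_ && _); rewrite ?rmorph1 ?rmorph0.
have hv i : simplex R n (vertex d s' i) by exact: simplex_vertex.
pose m0 := maxn (Num.truncn (8 / e)).+1
  (maxn (choice.pickle q).+1 (\max_i (choice.pickle (vq i)).+1)).
exists m0, r; split => // m g y m0m cg fg hy yx.
have me : m.+1%:R^-1 <= e / 8.
  rewrite -[e / 8]invrK lef_pV2 ?posrE ?invr_gt0// invf_div.
  apply: ltW; apply: lt_le_trans (truncnS_gt _) _; rewrite ler_nat ltnW// ltnS.
  by apply: leq_trans m0m; exact: leq_maxl.
have rs i : r <= s * x 0 i.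
  have := hxm i; rewrite /r; nra.
have near_x z : simplex R n z -> (forall i, `|z 0 i - x 0 i| <= s * xm) ->
    `|extend f z - extend f x| <= e / 8.
  move=> hz zx; apply: hs => // i; apply: le_trans (zx i) _.
  by rewrite ler_pM2l.
have fd : `|extend f d - extend f x| <= e / 8.
  by apply: near_x => // i; apply: le_trans (dx i) _; rewrite /r; nra.
have fv i : `|extend f (vertex d s' i) - extend f x| <= e / 8.
  apply: near_x => // j; rewrite /vertex !mxE.
  have := dx j; have /andP[dj0 dj1] := hq.1 j.
  rewrite -/d in dj0 dj1; rewrite !mxE in dj0 dj1 *.
  case: (_ && _); rewrite ?mulr1 ?mulr0 !ler_norml /r => /andP[? ?]; apply/andP; split; nra.
have fy : `|extend f y - extend f x| <= e / 8.
  by apply: near_x => // i; apply: le_trans (yx i) _; rewrite /r; nra.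
have gd : `|extend g d - extend f d| < e / 8.
  apply: lt_le_trans me; apply: close_at_rat => //.
  by apply: leq_trans m0m; rewrite /m0 !leq_max leqnn orbT.
have gv i : `|extend g (vertex d s' i) - extend f (vertex d s' i)| < e / 8.
  apply: lt_le_trans me; rewrite -vqE; apply: close_at_rat => //; first by rewrite vqE.
  apply: leq_trans m0m; rewrite /m0 !leq_max; apply/orP; right; apply/orP; right.
  exact: (leq_bigmax (F := fun i => (choice.pickle (vq i)).+1)).
pose b := extend f x - e / 4.
have hb i : b <= extend g (vertex d s' i).
  by have := fv i; have := gv i; rewrite ler_norml ltr_norml /b; lra.
have yd i : `|y 0 i - d 0 i| <= s' * d 0 i.
  have := yx i; have := dx i; have := hxm i; rewrite !ler_norml /r.
  by move=> ? /andP[? ?] /andP[? ?]; apply/andP; split; nra.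
have := concave_osc n_ge2 cg hq s'01 hb hy yd.
by move: fd fy gd; rewrite !ler_norml ltr_norml -/d /b; lra.
Qed.

End separability.

(** * The topology and the Borel sets of the space of concave functions *)
Section topology.
Context (R : realType) (n : nat) (n_ge2 : (2 <= n)%N).
Local Notation S := (set_type (simplex R n)).

Lemma concave_concave_fun (f : concave_fun R n) : concave f.
Proof. by case: f => f hf; exact: (set_mem hf). Qed.

(** [close_at_local] is uniform over a compact set by a finite covering, so the sets
    [close_at m f] form a filter that converges to [f]. *)
Lemma concave_nbhs (f : concave_fun R n) (U : set (concave_fun R n)) :
  nbhs f U -> exists m, forall g : concave_fun R n, close_at n_ge2 m f g -> U g.
Proof.
pose F : set_system (concave_fun R n) :=
  filter_from setT (fun m => [set g : concave_fun R n | close_at n_ge2 m f g]).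
have FF : Filter F.
  apply: filter_from_filter; first by exists 0%N.
  move=> i j _ _; exists (maxn i j) => // g /= fg; split => k ki.
    apply: lt_le_trans (fg k _) _; first by rewrite leq_max ki.
    by rewrite lef_pV2 ?posrE// ler_nat ltnS leq_maxl.
  apply: lt_le_trans (fg k _) _; first by rewrite leq_max ki orbT.
  by rewrite lef_pV2 ?posrE// ler_nat ltnS leq_maxr.
have Ff : {family compact, (fun g : concave_fun R n => val g : S -> R) @ F --> (val f : S -> R)}.
  apply/fam_cvgP => K cK W /uniform_nbhs [E [entE sub]].
  move: entE; rewrite -entourage_ballE => -[e /= e0 eE].
  have /compact_near_coveringP := cK.
  move=> /(_ nat \oo (fun m x => forall g : concave_fun R n,
     close_at n_ge2 m f g -> `|g x - f x| <= e / 2) _).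
  case=> [|m0 _ hm].
    move=> x Kx; have e20 : 0 < e / 2 by rewrite divr_gt0.
    have [m0 [r [r0 hr]]] :=
      close_at_local n_ge2 (@concave_concave_fun f) (simplex_val x) e20.
    exists ([set y : S | forall i, `|val y 0 i - val x 0 i| <= r], [set m | (m0 <= m)%N]).
      split=> /=; last by exists m0.
      have vx : nbhs (val x) [set y : 'rV[R]_n | forall i, `|y 0 i - val x 0 i| <= r].
        apply/nbhs_ballP; exists r => //= y [_ xy] i.
        by have := xy 0 i; rewrite /ball/= distrC => /ltW.
      by have := @initial_continuous S _ val x _ vx.
    move=> [y m]/= [yx m0m] g fg; have := hr m g (val y) m0m _ fg (simplex_val y) yx.
    by rewrite !extend_val; apply; exact: concave_concave_fun.
  exists m0 => // g /= fg; apply: sub => y Ky; apply: eE => /=.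
  rewrite /ball/= distrC; apply: (@le_lt_trans _ _ (e / 2)); last by lra.
  exact: (hm m0 (leqnn _) _ Ky).
move=> [_ /= [[B oB <-] Bf sB]].
have /Ff [m _ mB] : nbhs (val f : simplex_arrow R n) B by exact: open_nbhs_nbhs.
by exists m => g fg; apply: sB; exact: mB.
Qed.
End topology.

Section measurability.
Context (R : realType) (n : nat) (n_ge2 : (2 <= n)%N).
Context d (Omega : measurableType d).

(** A set that is open in its first [m] coordinates is a countable union of rational
    boxes. *)
Lemma measurable_open_cylinder (m : nat) (y : nat -> Omega -> R) (W : set (nat -> R)) :
  (forall k, measurable_fun setT (y k)) ->
  (forall u, W u -> exists j : nat, forall v,
    (forall k, (k < m)%N -> `|v k - u k| < j.+1%:R^-1) -> W v) ->
  measurable [set w | W (y^~ w)].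
Proof.
move=> my oW.
pose box (qj : {ffun 'I_m -> rat} * nat) : set (nat -> R) :=
  [set v | forall k : 'I_m, `|v k - ratr (qj.1 k)| < qj.2.+1%:R^-1].
have -> : [set w | W (y^~ w)] =
    \bigcup_(qj in [set qj | box qj `<=` W]) [set w | box qj (y^~ w)].
  apply/seteqP; split => [w /= Ww|w [qj /= qjW wqj]]; last exact: qjW.
  have [j hj] := oW _ Ww.
  pose i := (j.+1 * 2)%N.-1.
  have iE : i.+1%:R^-1 = j.+1%:R^-1 / 2 :> R by rewrite /i prednK ?muln_gt0// natrM invfM.
  have ex (k : 'I_m) : exists r : rat, `|y k w - ratr r| < i.+1%:R^-1.
    have i0 : 0 < i.+1%:R^-1 :> R by rewrite invr_gt0.
    move: (i.+1%:R^-1) i0 => a a0.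
    have lt : y k w - a < y k w + a by lra.
    by have [r] := rat_in_itvoo lt; rewrite in_itv/= => /andP[? ?]; exists r; rewrite ltr_norml;
      apply/andP; split; lra.
  have [q hq] := choice ex.
  exists ([ffun k => q k], i); last by move=> k /=; rewrite ffunE.
  move=> v /= hv; apply: hj => k km.
  have := hv (Ordinal km); have := hq (Ordinal km); rewrite ffunE/= iE !ltr_norml.
  move: (j.+1%:R^-1) => a.
  by move=> /andP[? ?] /andP[? ?]; apply/andP; split; lra.
rewrite bigcup_mkcond; apply: countable_bigcupT_measurable => // qj; case: ifPn => // _.
rewrite (_ : mkset _ = \bigcap_(k in [set: 'I_m])
    [set w | `|y k w - ratr (qj.1 k)| < qj.2.+1%:R^-1]); last first.
  by apply/seteqP; split=> w h k; [move=> _|]; exact: h.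
apply: fin_bigcap_measurable => // k _.
have mk : measurable_fun setT (fun w => `|y k w - ratr (qj.1 k)|).
  by apply: measurableT_comp => //; apply: measurable_funB.
have := mk measurableT `]-oo, qj.2.+1%:R^-1[%classic (measurable_itv _).
by rewrite setTI; congr measurable; apply/seteqP; split => w /=; rewrite in_itv.
Qed.

(** By [concave_nbhs], [f] lies in the open set [U] if and only if, for some [m], no
    function outside [U] is close to [f] at the first [m] rational points; the
    negation is an open condition on these evaluations. *)
Lemma measurable_concave_fun (Y : Omega -> concave_fun R n) :
  (forall k, measurable_fun setT (fun w => Y w (rat_point R n_ge2 k))) ->
  measurable_fun setT (Y : Omega -> borel (concave_fun R n)).
Proof.
move=> mY; apply: (@measurability _ _ Omega (borel (concave_fun R n))
  setT Y (@open (concave_fun R n))) => //.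
move=> _ [U oU <-]; rewrite setTI.
pose W m : set (nat -> R) := [set u | exists g : concave_fun R n, ~ U g /\
  forall k, (k < m)%N -> `|g (rat_point R n_ge2 k) - u k| < m.+1%:R^-1].
have -> : Y @^-1` U = \bigcup_m ~` [set w | W m (fun k => Y w (rat_point R n_ge2 k))].
  apply/seteqP; split => [w /= Uw|w [m _ /= hw]].
    have [m hm] := concave_nbhs n_ge2 (open_nbhs_nbhs (conj oU Uw)).
    by exists m => // -[g [Ug hg]]; apply: Ug; exact: hm.
  apply: contrapT => Uw; apply: hw; exists (Y w); split => // k _.
  by rewrite subrr normr0 invr_gt0.
apply: bigcup_measurable => m _; apply: measurableC.
apply: (@measurable_open_cylinder m) => // u [g [Ug hg]].
have [j hj] : exists j : nat, forall k, (k < m)%N ->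
    `|g (rat_point R n_ge2 k) - u k| < m.+1%:R^-1 - j.+1%:R^-1.
  pose e := \big[Num.min/1]_(k < m) (m.+1%:R^-1 - `|g (rat_point R n_ge2 k) - u k|).
  have e0 : 0 < e by apply: lt_bigmin => // k _; rewrite subr_gt0 hg.
  exists (Num.truncn e^-1) => k km.
  have le : e <= m.+1%:R^-1 - `|g (rat_point R n_ge2 k) - u k|.
    exact: (bigmin_le_cond 1 (fun k : 'I_m => m.+1%:R^-1 - `|g (rat_point R n_ge2 k) - u k|)
      (j := Ordinal km) (P := xpredT) isT).
  have : (Num.truncn e^-1).+1%:R^-1 < e.
    by rewrite -[ltRHS]invrK ltf_pV2 ?posrE ?invr_gt0// truncnS_gt.
  by move: le; move: (_.+1%:R^-1) (_.+1%:R^-1) => a b; lra.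
exists j => v hv; exists g; split => // k km.
have := hj k km; have := hv k km; move: (_.+1%:R^-1) (_.+1%:R^-1) => a b.
by rewrite !ltr_norml => /andP[? ?] /andP[? ?]; apply/andP; split; lra.
Qed.
End measurability.

Lemma continuous_concave_eval (R : realType) (n : nat) (p : set_type (simplex R n)) :
  continuous (fun f : concave_fun R n => f p : R).
Proof.
move=> f.
have Ff : {family compact, (fun g : concave_fun R n => val g : _ -> R) @ nbhs f -->
  (val f : set_type (simplex R n) -> R)}.
  exact: (@initial_continuous _ (simplex_arrow R n) val f).
move/fam_cvgP : Ff => /(_ [set p] (@compact_set1 _ p)).
rewrite uniform_set1; exact.
Qed.

(** * Weak convergence from finitely many evaluations *)
Section bounded_expectation.
Context d (Omega : measurableType d) (R : realType) (P : probability Omega R).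
Implicit Types X Y : Omega -> R.

Lemma bounded_integrable M X : measurable_fun setT X -> (forall w, `|X w| <= M) ->
  P.-integrable setT (EFin \o X).
Proof.
move=> mX XM; apply: (le_integrable measurableT (g := cst M%:E)).
- exact/measurable_EFinP.
- by move=> w _ /=; rewrite lee_fin (le_trans (XM w))// ler_norm.
- exact: finite_measure_integrable_cst.
Qed.

Lemma Rintegral_dist e X Y : P.-integrable setT (EFin \o X) ->
  P.-integrable setT (EFin \o Y) -> (forall w, `|X w - Y w| <= e) ->
  `|(\int[P]_w X w) - \int[P]_w Y w| <= e.
Proof.
move=> iX iY XY; rewrite -RintegralB//.
have iXY : P.-integrable setT (EFin \o (fun w => X w - Y w)).
  by apply: (integrableB measurableT iX iY).
apply: le_trans (le_normr_Rintegral measurableT iXY) _.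
apply: (@le_trans _ _ (\int[P]_w cst e w)).
  apply: le_Rintegral => //.
  - by apply/(integrable_norm iXY).
  - exact: finite_measure_integrable_cst.
by rewrite Rintegral_cst// [X in _ * X](congr1 fine (probability_setT P)) mulr1.
Qed.

Lemma cvg_Rintegral_bounded M (X_ : nat -> Omega -> R) X :
  (forall k, measurable_fun setT (X_ k)) -> measurable_fun setT X ->
  (forall k w, `|X_ k w| <= M) ->
  (forall w, X_ k w @[k --> \oo] --> X w) ->
  \int[P]_w X_ k w @[k --> \oo] --> \int[P]_w X w.
Proof.
move=> mX_ mX XM cX.
have [|||||_ _ h] := @dominated_convergence _ _ _ P setT measurableT
    (fun k w => (X_ k w)%:E) (fun w => (X w)%:E) (cst M%:E).
- by move=> n; exact/measurable_EFinP.
- exact/measurable_EFinP.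
- by apply: aeW => w _; apply: cvg_EFin; [exact: nearW|exact: cX].
- exact: finite_measure_integrable_cst.
- by apply: aeW => w k _; rewrite abse_EFin lee_fin.
apply: fine_cvg; rewrite fineK//.
apply: (integrable_fin_num measurableT (f := EFin \o X)).
apply: (bounded_integrable _ (M := M)) => // w.
apply: cvgr_to_le (cvg_norm (cX w)) _; apply: nearW => k; exact: XM.
Qed.

End bounded_expectation.

Section lipschitz_cylinder.
Context {R : realType}.

Definition lipschitz_cyl (m : nat) (H : (nat -> R) -> R) :=
  exists2 L, 0 <= L & forall u v, `|H u - H v| <= L * \sum_(k < m) `|u k - v k|.

End lipschitz_cylinder.

Section criterion.
Context (R : realType) (n : nat) (n_ge2 : (2 <= n)%N).
Local Notation E := (concave_fun R n).
Context (u : R -> R) (cu : continuous u)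
  (u_mono : {mono u : x y / x < y}).
Local Notation U := (fun (f : E) (k : nat) => u (f (rat_point R n_ge2 k))).

Lemma measurable_continuous_borel d (Omega : measurableType d) (Y : Omega -> E) (F : E -> R) :
  measurable_fun setT (Y : Omega -> borel E) -> continuous F ->
  measurable_fun setT (F \o Y).
Proof.
move=> mY cF; apply: (measurability _ (RGenOInfty.measurableE R)) => //.
move=> _ [_ [a ->] <-]; rewrite setTI comp_preimage.
rewrite -[_ @^-1` _]setTI; apply: mY => //.
apply: sub_sigma_algebra; apply: open_comp; first by move=> f _; exact: cF.
exact: interval_open.
Qed.

Lemma continuous_lipschitz_cyl m H : lipschitz_cyl m H -> continuous (fun f : E => H (U f)).
Proof.
move=> [L L0 HL] f; have FF : ProperFilter (nbhs f) := nbhs_pfilter f.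
apply/cvgrPdist_le => e e0.
have : (L * \sum_(k < m) `|U f k - U g k|) @[g --> f] --> (L * \sum_(k < m) `|U f k - U f k|).
  apply: cvgM; first exact: cvg_cst.
  apply: cvg_big => [|k _]; first exact: add_continuous.
  apply: cvg_norm; apply: cvgB; first exact: cvg_cst.
  apply: (@cvg_comp _ _ _ (fun g : E => g (rat_point R n_ge2 k)) u); last exact: cu.
  exact: continuous_concave_eval.
rewrite (_ : L * _ = 0); last by rewrite big1 ?mulr0// => k _; rewrite subrr normr0.
move/cvgr_lt => /(_ e e0); apply: filterS => g /ltW; exact: le_trans.
Qed.

Section regularization.
Context (F : E -> R) (M : R) (cF : continuous F) (FM : forall f, `|F f| <= M).

Let S m (v : nat -> R) : set R :=
  [set F g + m%:R * \sum_(k < m) `|v k - U g k| | g in setT].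

(** The infimal convolution of [F] with [m] times the distance of the first [m]
    transformed evaluations. *)
Definition lip_regularization m v := inf (S m v).
Local Notation reg := lip_regularization.

Let f0 : E := point.

Let S_inf m v : has_inf (S m v).
Proof.
split; first by exists (F f0 + m%:R * \sum_(k < m) `|v k - U f0 k|); exists f0.
exists (- M) => _ [g _ <-]; rewrite -[leLHS]addr0 lerD//.
  by have := FM g; rewrite ler_norml => /andP[].
by rewrite mulr_ge0// sumr_ge0.
Qed.

Lemma lip_regularization_lipschitz m : lipschitz_cyl m (reg m).
Proof.
exists m%:R => // v w.
suff le (v' w' : nat -> R) : reg m v' <= reg m w' + m%:R * \sum_(k < m) `|v' k - w' k|.
  rewrite ler_norml; apply/andP; split.
    have := le w v; under eq_bigr do rewrite distrC; lra.
  by have := le v w; lra.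
rewrite -lerBlDr; apply: lb_le_inf; first exact: (S_inf m w').1.
move=> _ [g _ <-]; rewrite lerBlDr.
apply: (@le_trans _ _ (F g + m%:R * \sum_(k < m) `|v' k - U g k|)).
  by apply: ge_inf; [exact: (S_inf m v').2|exists g].
rewrite -addrA lerD2l -mulrDr ler_wpM2l// -big_split/= ler_sum// => k _.
by rewrite addrC; exact: ler_distD.
Qed.

Lemma lip_regularization_le m f : reg m (U f) <= F f.
Proof.
apply: (@le_trans _ _ (F f + m%:R * \sum_(k < m) `|U f k - U f k|)).
  by apply: ge_inf; [exact: (S_inf m _).2|exists f].
by rewrite big1 ?mulr0 ?addr0// => k _; rewrite subrr normr0.
Qed.

Lemma lip_regularization_ge m v : - M <= reg m v.
Proof.
apply: lb_le_inf; first exact: (S_inf m v).1.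
move=> _ [g _ <-]; rewrite -[leLHS]addr0 lerD//.
  by have := FM g; rewrite ler_norml => /andP[].
by rewrite mulr_ge0// sumr_ge0.
Qed.

Lemma lip_regularization_norm m f : `|reg m (U f)| <= M.
Proof.
rewrite ler_norml lip_regularization_ge (le_trans (lip_regularization_le m f))//.
by have := FM f; rewrite ler_norml => /andP[].
Qed.

(** A competitor [g] in the infimum either agrees with [f] at the first [m0] points
    well enough for [F g] to be close to [F f], by [concave_nbhs], or pays a penalty
    of at least [m * del], which exceeds the oscillation [2 * M]. *)
Lemma lip_regularization_cvg f : reg m (U f) @[m --> \oo] --> F f.
Proof.
apply/cvgrPdist_le => e e0.
have : nbhs f [set g | `|F f - F g| <= e].
  have FF : ProperFilter (nbhs f) := nbhs_pfilter f.
  by have /cvgrPdist_le := @cF f; apply.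
move/(concave_nbhs n_ge2) => [m0 hm0].
pose a : R := m0.+1%:R^-1; have a0 : 0 < a by rewrite invr_gt0.
pose del := \big[Num.min/1]_(k < m0)
  Num.min (u (f (rat_point R n_ge2 k) + a) - U f k) (U f k - u (f (rat_point R n_ge2 k) - a)).
have del0 : 0 < del.
  apply: lt_bigmin => // k _; rewrite lt_min !subr_gt0 !u_mono.
  by rewrite ltrDl gtrBl a0.
have hdel g : (forall k, (k < m0)%N -> `|U f k - U g k| < del) -> close_at n_ge2 m0 f g.
  move=> fg k km; have := fg k km.
  have : del <= Num.min (u (f (rat_point R n_ge2 k) + a) - U f k)
    (U f k - u (f (rat_point R n_ge2 k) - a)).
    exact: (bigmin_le_cond 1 (fun k : 'I_m0 => Num.min (u (f (rat_point R n_ge2 k) + a) - U f k)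
     (U f k - u (f (rat_point R n_ge2 k) - a))) (j := Ordinal km) (P := xpredT) isT).
  rewrite le_min !ltr_norml => /andP[d1 d2] /andP[d3 d4].
  have l1 : u (g (rat_point R n_ge2 k)) < u (f (rat_point R n_ge2 k) + a) by lra.
  have l2 : u (f (rat_point R n_ge2 k) - a) < u (g (rat_point R n_ge2 k)) by lra.
  by rewrite !u_mono in l1 l2; rewrite -/a; apply/andP; split; lra.
near=> m.
have m0m : (m0 <= m)%N by near: m; exists m0.
have mdel : 2 * M <= m%:R * del.
  rewrite -ler_pdivrMr//; near: m; exists (Num.truncn (2 * M / del)).+1 => // k /= hk.
  by apply: ltW; apply: lt_le_trans (truncnS_gt _) _; rewrite ler_nat.
rewrite ger0_norm ?subr_ge0 ?lip_regularization_le// lerBlDr -lerBlDl.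
apply: lb_le_inf; first exact: (S_inf m _).1.
move=> _ [g _ <-].
have [fg|] := pselect (forall k, (k < m0)%N -> `|U f k - U g k| < del).
  have := hm0 g (hdel g fg); rewrite /= ler_norml => /andP[_ h].
  rewrite -[leLHS]addr0 lerD//; last by rewrite mulr_ge0// sumr_ge0.
  by rewrite lerBlDl -lerBlDr.
move=> /existsNP[k /not_implyP[km /negP]]; rewrite -leNgt => dk.
have sumk : del <= \sum_(k < m) `|U f k - U g k|.
  have km' : (k < m)%N by exact: leq_trans m0m.
  by rewrite (bigD1 (Ordinal km'))//= (le_trans dk)// lerDl sumr_ge0.
have := FM f; have := FM g; rewrite !ler_norml => /andP[? _] /andP[_ ?].
have : m%:R * del <= m%:R * \sum_(k < m) `|U f k - U g k| by rewrite ler_wpM2l.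
by lra.
Unshelve. all: by end_near. Qed.

End regularization.

Context d (Omega : measurableType d) (P : probability Omega R)
  d' (Omega' : measurableType d') (P' : probability Omega' R).
Context (Y : nat -> Omega -> E) (Z : Omega' -> E).
Hypotheses (mY : forall K, measurable_fun setT (Y K : Omega -> borel E))
  (mZ : measurable_fun setT (Z : Omega' -> borel E)).

(** The regularizations of [F] lie below [F] and converge to it pointwise; this bounds
    the limit inferior of the expectations from below by the expectation at [Z].
    The bound for [- F] is the matching one from above. *)
Lemma weak_convergence_criterion :
  (forall m H, lipschitz_cyl m H ->
    \int[P]_w H (U (Y K w)) @[K --> \oo] --> \int[P']_w H (U (Z w))) ->
  forall F : E -> R, continuous F -> (exists M, forall f, `|F f| <= M) ->
  \int[P]_w F (Y K w) @[K --> \oo] --> \int[P']_w F (Z w).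
Proof.
move=> hyp.
suff lower F M : continuous F -> (forall f, `|F f| <= M) -> forall e, 0 < e ->
    \forall K \near \oo, \int[P']_w F (Z w) - e <= \int[P]_w F (Y K w).
  move=> F cF [M FM]; apply/cvgrPdist_le => e e0.
  have FM' f : `|- F f| <= M by rewrite normrN.
  have cNF : continuous (fun f => - F f).
    move=> f; have FF : ProperFilter (nbhs f) := nbhs_pfilter f.
    by apply: cvgN; exact: cF.
  have l1 := lower F M cF FM e e0; have l2 := lower _ M cNF FM' e e0.
  apply: filterS2 l1 l2 => K l1.
  have oppE d0 (T : measurableType d0) (Q : probability T R) (X : T -> E) :
      measurable_fun setT (X : T -> borel E) ->
      \int[Q]_w (- F (X w)) = - \int[Q]_w F (X w).
    move=> mX; under eq_Rintegral do rewrite -mulN1r.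
    rewrite RintegralZl ?mulN1r//.
    apply: (bounded_integrable _ (M := M)); last by move=> w; exact: FM.
    exact: measurable_continuous_borel mX cF.
  by rewrite !oppE// ler_norml => l2; apply/andP; split; lra.
move=> cF FM e e0.
have mF d0 (T : measurableType d0) (X : T -> E) :
  measurable_fun setT (X : T -> borel E) -> measurable_fun setT (F \o X).
  by move=> mX; exact: measurable_continuous_borel mX cF.
have creg m : continuous (fun f => lip_regularization F m (U f)).
  by apply: continuous_lipschitz_cyl; exact: lip_regularization_lipschitz FM m.
have mreg d0 (T : measurableType d0) (X : T -> E) m :
  measurable_fun setT (X : T -> borel E) ->
  measurable_fun setT (fun w => lip_regularization F m (U (X w))).
  by move=> mX; exact: measurable_continuous_borel mX (creg m).
have e20 : 0 < e / 2 by rewrite divr_gt0.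
have /cvgrPdist_le/(_ _ e20)[m _ /(_ m (leqnn m))/= hm] :
    \int[P']_w lip_regularization F m (U (Z w)) @[m --> \oo] --> \int[P']_w F (Z w).
  apply: (cvg_Rintegral_bounded _ (M := M)).
  - by move=> k; exact: mreg.
  - exact: mF.
  - by move=> k w; exact: lip_regularization_norm.
  - by move=> w; exact: lip_regularization_cvg.
have /cvgrPdist_le/(_ _ e20) := hyp _ _ (lip_regularization_lipschitz FM m).
apply: filterS => K; rewrite !ler_norml in hm *.
have : \int[P]_w lip_regularization F m (U (Y K w)) <= \int[P]_w F (Y K w).
  apply: le_Rintegral => //.
  - by apply: (bounded_integrable _ (M := M));
      [exact: mreg|move=> w; exact: lip_regularization_norm].
  - by apply: (bounded_integrable _ (M := M)); [exact: (mF _ _ (Y K))|move=> w; exact: FM].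
  - by move=> w _; exact: lip_regularization_le FM _ _.
by move: hm => /andP[? ?] ? /andP[? ?]; lra.
Qed.

End criterion.

(** * Convergence of mixed moments *)
Section bernstein.
Context {R : realType}.
Implicit Types (p : R) (f g : nat -> R).

(** The Bernstein polynomial: the expectation of [f] at the number of successes in
    [N] trials of probability [p], conditioned on the first trial.  This form needs
    no binomial coefficients. *)
Fixpoint bernstein N p f : R :=
  if N is N'.+1 then (1 - p) * bernstein N' p f + p * bernstein N' p (fun k => f k.+1)
  else f 0%N.

Lemma bernstein_le N p f g : 0 <= p <= 1 -> (forall k, (k <= N)%N -> f k <= g k) ->
  bernstein N p f <= bernstein N p g.
Proof.
move=> /andP[p0 p1]; elim: N f g => [|N ih] f g fg /=; first exact: fg.
rewrite lerD// ler_wpM2l ?subr_ge0//; apply: ih => k kN; apply: fg => //.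
exact: leqW.
Qed.

Lemma bernstein_eq N p f g : f =1 g -> bernstein N p f = bernstein N p g.
Proof. by move=> /funext ->. Qed.

Lemma bernstein_lin N p a b f g :
  bernstein N p (fun k => a * f k + b * g k) = a * bernstein N p f + b * bernstein N p g.
Proof. by elim: N f g => [//|N ih] f g /=; rewrite !ih; ring. Qed.

Lemma bernstein_cst N p a : bernstein N p (fun=> a) = a.
Proof. by elim: N => //= N ->; ring. Qed.

(** The shift [a] is what the first trial changes in the induction. *)
Lemma bernstein_variance N p a :
  bernstein N p (fun k => (k%:R + a - N%:R * p) ^+ 2) = a ^+ 2 + N%:R * p * (1 - p).
Proof.
elim: N a => [|N ih] a /=; first by ring.
rewrite (@bernstein_eq _ _ _ (fun k => (k%:R + (a - p) - N%:R * p) ^+ 2)); last first.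
  by move=> k; congr (_ ^+ 2); rewrite -natr1; ring.
rewrite [X in p * X](@bernstein_eq _ _ _ (fun k => (k%:R + (a + 1 - p) - N%:R * p) ^+ 2));
  last first.
  by move=> k; congr (_ ^+ 2); rewrite -!natr1; ring.
by rewrite !ih -natr1; ring.
Qed.

(** Chebyshev's estimate, with [z <= 1 + z ^ 2] in the role of the Cauchy-Schwarz
    inequality.  The degree is a square so that the rate is the inverse of an
    integer. *)
Lemma bernstein_dist j p f y L : 0 <= p <= 1 -> 0 <= L ->
  (forall k, (k <= j.+1 ^ 2)%N -> `|f k - y| <= L * `|k%:R / (j.+1 ^ 2)%:R - p|) ->
  `|bernstein (j.+1 ^ 2) p f - y| <= 2 * L / j.+1%:R.
Proof.
move=> p01 L0 fy; set N := (j.+1 ^ 2)%N.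
have j0 : 0 < j.+1%:R :> R by [].
have NE : N%:R = j.+1%:R ^+ 2 :> R by rewrite /N natrX.
have N0 : 0 < N%:R :> R by rewrite NE exprn_gt0.
have [q qE] : exists q : R, q = j.+1%:R^-1 by eexists.
have q0 : 0 < q by rewrite qE invr_gt0.
pose e k : R := L * q + L * q * (q ^+ 2 * (k%:R + 0 - N%:R * p) ^+ 2).
have le k : (k <= N)%N -> `|f k - y| <= e k.
  move=> kN; apply: le_trans (fy k kN) _; rewrite /e -mulrA -mulrDr ler_wpM2l//.
  have -> : k%:R / N%:R - p = q ^+ 2 * (k%:R + 0 - N%:R * p).
    rewrite qE NE; field; lra.
  set x := _ - N%:R * p.
  have -> : q + q * (q ^+ 2 * x ^+ 2) = q * (1 + (q * `|x|) ^+ 2).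
    by rewrite exprMn real_normK ?num_real//; ring.
  rewrite normrM (ger0_norm (exprn_ge0 2 (ltW q0))) expr2 -mulrA ler_pM2l//.
  by move: (q * `|x|) => z; nra.
have be : bernstein N p e <= 2 * L / j.+1%:R.
  rewrite (@bernstein_eq _ _ _ (fun k => L * q * 1 + (L * q * q ^+ 2) * (k%:R + 0 - N%:R * p)
    ^+ 2)); last first.
    by move=> k; rewrite /e mulr1 !mulrA.
  rewrite (bernstein_lin _ _ _ _ (fun=> 1)) bernstein_cst bernstein_variance -qE.
  have -> : L * q * 1 + L * q * q ^+ 2 * (0 ^+ 2 + N%:R * p * (1 - p)) = L * q * (1 + p * (1 - p)).
    rewrite qE NE; field; lra.
  have Lq : 0 <= L * q by rewrite mulr_ge0// ltW.
  have : 1 + p * (1 - p) <= 2 by nra.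
  by move=> h; have := ler_wpM2l Lq h; lra.
have lo : y - bernstein N p e <= bernstein N p f.
  have -> : y - bernstein N p e = bernstein N p (fun k => 1 * y + (-1) * e k).
    by rewrite (bernstein_lin _ _ _ _ (fun=> y)) bernstein_cst; ring.
  apply: bernstein_le => // k kN; have := le k kN; rewrite ler_norml => /andP[+ _]; lra.
have hi : bernstein N p f <= y + bernstein N p e.
  have -> : y + bernstein N p e = bernstein N p (fun k => 1 * y + 1 * e k).
    by rewrite (bernstein_lin _ _ _ _ (fun=> y)) bernstein_cst; ring.
  apply: bernstein_le => // k kN; have := le k kN; rewrite ler_norml => /andP[_ +]; lra.
move: be lo hi; move: (2 * L / _) (bernstein N p e) => A B ? ? ?.
by rewrite ler_norml; apply/andP; split; lra.
Qed.

End bernstein.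

Section moments.
Context (R : realType).
Context d (Omega : measurableType d) (P : probability Omega R)
  d' (Omega' : measurableType d') (P' : probability Omega' R).
Context (V : nat -> Omega -> nat -> R) (V' : Omega' -> nat -> R).
Hypotheses (mV : forall K i, measurable_fun setT (fun w => V K w i))
  (mV' : forall i, measurable_fun setT (fun w => V' w i))
  (V01 : forall K w i, 0 <= V K w i <= 1) (V'01 : forall w i, 0 <= V' w i <= 1).

(* the bounded functions whose expectations converge: a class that is linear, is
   closed under uniform limits and contains the monomials *)
Let convergent (F : (nat -> R) -> R) :=
  [/\ forall K, measurable_fun setT (fun w => F (V K w)),
      measurable_fun setT (fun w => F (V' w)),
      exists B, forall u, (forall i, 0 <= u i <= 1) -> `|F u| <= B &
      \int[P]_w F (V K w) @[K --> \oo] --> \int[P']_w F (V' w)].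

Let convergent_lin a b F G : convergent F -> convergent G ->
  convergent (fun u => a * F u + b * G u).
Proof.
move=> [mF mF' [B FB] cF] [mG mG' [C GC] cG]; split.
- by move=> K; apply: measurable_funD; apply: measurable_funM => //.
- by apply: measurable_funD; apply: measurable_funM => //.
- exists (`|a| * B + `|b| * C) => u u01; apply: le_trans (ler_normD _ _) _.
  by rewrite !normrM lerD// ler_wpM2l// ?FB ?GC.
- have iF K : P.-integrable setT (EFin \o (fun w => F (V K w))).
    by apply: (bounded_integrable _ (M := B)) => // w; apply: FB => i; exact: V01.
  have iG K : P.-integrable setT (EFin \o (fun w => G (V K w))).
    by apply: (bounded_integrable _ (M := C)) => // w; apply: GC => i; exact: V01.
  have iF' : P'.-integrable setT (EFin \o (fun w => F (V' w))).
    by apply: (bounded_integrable _ (M := B)) => // w; apply: FB => i; exact: V'01.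
  have iG' : P'.-integrable setT (EFin \o (fun w => G (V' w))).
    by apply: (bounded_integrable _ (M := C)) => // w; apply: GC => i; exact: V'01.
  have iZ d1 (T : measurableType d1) (m : {measure set T -> \bar R}) (X : T -> R) r :
      m.-integrable setT (EFin \o X) -> m.-integrable setT (EFin \o (fun w => r * X w)).
    by move=> iX; exact: (integrableZl measurableT r iX).
  rewrite RintegralD//; [|exact: iZ|exact: iZ]; rewrite !RintegralZl//.
  rewrite (_ : (fun K => _) = (fun K => a * \int[P]_w F (V K w) + b * \int[P]_w G (V K w))).
    by apply: cvgD; apply: cvgM => //; exact: cvg_cst.
  apply/funext => K; rewrite RintegralD//; [|exact: iZ|exact: iZ].
  by rewrite !RintegralZl.
Qed.

Let convergent_approx (F : (nat -> R) -> R) :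
  (forall K, measurable_fun setT (fun w => F (V K w))) ->
  measurable_fun setT (fun w => F (V' w)) ->
  (forall e : R, 0 < e -> exists2 G, convergent G & forall u, (forall i, 0 <= u i <= 1) ->
    `|F u - G u| <= e) ->
  convergent F.
Proof.
move=> mF mF' appr.
have [B FB] : exists B, forall u, (forall i, 0 <= u i <= 1) -> `|F u| <= B.
  have [G [_ _ [B GB] _] FG] := appr 1 ltr01.
  exists (1 + B) => u u01; rewrite -[F u](subrK (G u)).
  by apply: le_trans (ler_normD _ _) _; rewrite lerD ?FG ?GB.
split => //; first by exists B.
apply/cvgrPdist_le => e e0; have e3 : 0 < e / 3 by rewrite divr_gt0.
have [G [mG mG' [C GC] cG] FG] := appr _ e3.
move/cvgrPdist_le : cG => /(_ _ e3); apply: filterS => K.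
have h1 : `|\int[P]_w F (V K w) - \int[P]_w G (V K w)| <= e / 3.
  apply: Rintegral_dist.
  - by apply: (bounded_integrable _ (M := B)) => // w; apply: FB => i; exact: V01.
  - by apply: (bounded_integrable _ (M := C)) => // w; apply: GC => i; exact: V01.
  - by move=> w; apply: FG => i; exact: V01.
have h2 : `|\int[P']_w F (V' w) - \int[P']_w G (V' w)| <= e / 3.
  apply: Rintegral_dist.
  - by apply: (bounded_integrable _ (M := B)) => // w; apply: FB => i; exact: V'01.
  - by apply: (bounded_integrable _ (M := C)) => // w; apply: GC => i; exact: V'01.
  - by move=> w; apply: FG => i; exact: V'01.
move: h1 h2; rewrite !ler_norml => /andP[? ?] /andP[? ?] /andP[? ?].
by apply/andP; split; lra.
Qed.

Lemma measurable_lipschitz_cyl d1 (T : measurableType d1) (X : T -> nat -> R) m H :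
  (forall i, measurable_fun setT (fun w => X w i)) ->
  lipschitz_cyl m H -> measurable_fun setT (fun w => H (X w)).
Proof.
move=> mX [L L0 HL]; apply: (measurability _ (RGenOInfty.measurableE R)) => //.
move=> _ [_ [a ->] <-]; rewrite setTI.
rewrite (_ : _ @^-1` _ = [set w | [set u | a < H u] (fun i => X w i)]); last first.
  by apply/seteqP; split => w /=; rewrite in_itv/= andbT.
apply: (@measurable_open_cylinder R _ _ m (fun i w => X w i)) => // u /= au.
have q0 : 0 < (L * m%:R + 1) / (H u - a) by rewrite divr_gt0 ?subr_gt0// ltr_wpDl ?mulr_ge0.
exists (Num.truncn ((L * m%:R + 1) / (H u - a))) => v hv.
set j := Num.truncn _ in hv *.
have hj : (L * m%:R + 1) * j.+1%:R^-1 < H u - a.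
  have := truncnS_gt ((L * m%:R + 1) / (H u - a)); rewrite -/j.
  by rewrite ltr_pdivrMr ?subr_gt0// [X in _ < X]mulrC -ltr_pdivrMr.
have : `|H v - H u| <= (L * m%:R) * j.+1%:R^-1.
  apply: le_trans (HL v u) _; rewrite -mulrA ler_wpM2l//.
  apply: (@le_trans _ _ (\sum_(k < m) j.+1%:R^-1)).
    by apply: ler_sum => k _; apply/ltW/hv.
  by rewrite sumr_const card_ord mulr_natl.
have : 0 < j.+1%:R^-1 :> R by rewrite invr_gt0.
move: (j.+1%:R^-1) hj => b hj b0; rewrite ler_norml => /andP[? _]; lra.
Qed.

(** The coordinates of [H] are replaced one after the other by Bernstein polynomials,
    which approximate [H] uniformly in the other coordinates.  A monomial [Q t] is
    carried along to receive the powers of the coordinates already treated. *)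
Lemma moments_lipschitz :
  (forall m (t : nat -> nat),
    \int[P]_w (\prod_(i < m) V K w i ^+ t i) @[K --> \oo] -->
    \int[P']_w (\prod_(i < m) V' w i ^+ t i)) ->
  forall m H, lipschitz_cyl m H ->
    \int[P]_w H (V K w) @[K --> \oo] --> \int[P']_w H (V' w).
Proof.
move=> mom M.
pose Q (t : nat -> nat) (u : nat -> R) := \prod_(i < M) u i ^+ t i.
have Q01 t u : (forall i, 0 <= u i <= 1) -> 0 <= Q t u <= 1.
  move=> u01; apply/andP; split.
    by apply: prodr_ge0 => i _; rewrite exprn_ge0//; case/andP: (u01 i).
  apply: prodr_ile1 => i; have /andP[? ?] := u01 i.
  by rewrite exprn_ge0// exprn_ile1.
have mQ d1 (T : measurableType d1) (X : T -> nat -> R) t :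
    (forall i, measurable_fun setT (fun w => X w i)) -> measurable_fun setT (fun w => Q t (X w)).
  by move=> mX; apply: measurable_prod => i _; exact: measurable_funX.
have convergentQ t : convergent (Q t).
  split; [by move=> K; apply: mQ|exact: mQ| |exact: mom].
  by exists 1 => u /(Q01 t) /andP[? ?]; rewrite ger0_norm.
suff main m : (m <= M)%N -> forall H t, lipschitz_cyl m H -> convergent (fun u => H u * Q t u).
  move=> H HM; have [_ _ _] := main M (leqnn M) H (fun=> 0%N) HM.
  have Q1 u : Q (fun=> 0%N) u = 1 by rewrite /Q big1.
  under eq_fun do under eq_Rintegral do rewrite Q1 mulr1.
  by under eq_Rintegral do rewrite Q1 mulr1.
elim: m => [|m ih] mM H t.
  move=> [L L0 HL].
  have HE u : H u = H (fun=> 0) by apply/eqP; rewrite -subr_eq0 -normr_le0 (le_trans (HL _ _))//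
    big_ord0 mulr0.
  have := convergent_lin (H (fun=> 0)) 0 (convergentQ t) (convergentQ t).
  by congr convergent; apply/funext => u; rewrite HE mul0r addr0.
have inner N : forall (f : nat -> (nat -> R) -> R) t, (forall k, lipschitz_cyl m (f k)) ->
    convergent (fun u => bernstein N (u m) (f^~ u) * Q t u).
  elim: N => [|N ihN] f t' hf; first by apply: (ih (ltnW mM)); exact: hf.
  pose t1 i := if i == m then (t' m).+1 else t' i.
  have Qt1 u : u m * Q t' u = Q t1 u.
    rewrite /Q (bigD1 (Ordinal mM))// [RHS](bigD1 (Ordinal mM))//= mulrA -exprS /t1 eqxx.
    by congr (_ * _); apply: eq_bigr => i; rewrite -val_eqE/= => /negbTE ->.
  have n1 := ihN f t' hf; have n2 := ihN f t1 hf.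
  have n3 := ihN (fun k => f k.+1) t1 (fun k => hf k.+1).
  have := convergent_lin 1 1 (convergent_lin 1 (-1) n1 n2) n3.
  by congr convergent; apply/funext => u /=; rewrite -Qt1; ring.
move=> hH; have [L L0 HL] := hH.
have mHQ d1 (T : measurableType d1) (X : T -> nat -> R) :
    (forall i, measurable_fun setT (fun w => X w i)) ->
      measurable_fun setT (fun w => H (X w) * Q t (X w)).
  by move=> mX; apply: measurable_funM; [exact: measurable_lipschitz_cyl hH|exact: mQ].
apply: convergent_approx; [by move=> K; exact: mHQ|exact: mHQ|].
move=> e e0.
pose j := Num.truncn (2 * L / e).
pose sub (u : nat -> R) x i := if i == m then x else u i.
pose f k u := H (sub u (k%:R / (j.+1 ^ 2)%:R)).
have hf k : lipschitz_cyl m (f k).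
  exists L => // u v; apply: le_trans (HL _ _) _;
    rewrite big_ord_recr/= /sub eqxx subrr normr0 addr0.
  by rewrite ler_wpM2l// ler_sum// => i _; rewrite ltn_eqF.
exists (fun u => bernstein (j.+1 ^ 2) (u m) (f^~ u) * Q t u); first exact: inner.
move=> u u01; rewrite -mulrBl normrM; have /andP[Q0 Q1] := Q01 t u u01.
rewrite (ger0_norm Q0) -[leRHS]mulr1 ler_pM//.
apply: (@le_trans _ _ (2 * L / j.+1%:R)); last first.
  rewrite ler_pdivrMr// [leRHS]mulrC -ler_pdivrMr//; apply: ltW; exact: truncnS_gt.
rewrite distrC; apply: bernstein_dist => // k kN.
apply: le_trans (HL _ _) _; rewrite big_ord_recr/= /sub eqxx big1 ?add0r// => i _.
by rewrite ltn_eqF// subrr normr0.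
Qed.

End moments.

(** * Homogeneous densities *)
Lemma powR_expR_cvg0 (R : realType) (b a : R) (kappa : nat -> R) : 0 < b -> 0 < a ->
  (forall K, 0 < kappa K) -> kappa K @[K --> \oo] --> 0 ->
  expR (- (a / kappa K)) * kappa K `^ (- b) @[K --> \oo] --> 0.
Proof.
move=> b0 a0 k0 kc.
pose q := (Num.truncn b).+2.
have hq : b + 1 <= q%:R.
  by rewrite /q -natr1 lerD2r ltW// truncnS_gt.
pose C := q`!%:R / a ^+ q.
have C0 : 0 < C by rewrite divr_gt0 ?exprn_gt0// ltr0n fact_gt0.
apply: (@squeeze_cvgr _ _ _ _ (fun=> 0) (fun K => C * kappa K)).
- have /cvgrPdist_lt/(_ 1 ltr01) := kc; apply: filterS => K; rewrite sub0r normrN gtr0_norm// => k1.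
  rewrite mulr_ge0 ?expR_ge0 ?powR_ge0//=.
  set k := kappa K in k1 *; have kp : 0 < k by exact: k0.
  have h1 : expR (- (a / k)) <= C * k ^+ q.
    have ak : 0 <= a / k by rewrite divr_ge0// ltW.
    have := expR_ge1Dxn (Num.truncn b).+1 ak; rewrite -/q expRN expr_div_n => h1.
    have h : a ^+ q / k ^+ q / q`!%:R <= expR (a / k).
      by apply: le_trans h1; rewrite lerDr.
    have p0 : 0 < a ^+ q / k ^+ q / q`!%:R :> R.
      by rewrite !divr_gt0 ?exprn_gt0// ltr0n fact_gt0.
    have -> : C * k ^+ q = (a ^+ q / k ^+ q / q`!%:R)^-1.
      have : a ^+ q != 0 by rewrite expf_neq0// gt_eqF.
      have : k ^+ q != 0 by rewrite expf_neq0// gt_eqF.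
      have : q`!%:R != 0 :> R by rewrite pnatr_eq0 -lt0n fact_gt0.
      rewrite /C; move: (a ^+ q) (k ^+ q) (q`!%:R) => x y z z0 y0 x0; field.
      by rewrite x0 y0 z0.
    by rewrite lef_pV2 ?posrE ?expR_gt0.
  apply: (@le_trans _ _ (C * k ^+ q * k `^ (- b))); first by rewrite ler_wpM2r ?powR_ge0.
  rewrite -mulrA ler_pM2l// -powR_mulrn ?(ltW kp)// -powRD ?(gt_eqF kp) ?implybT//.
  have -> : k = k `^ 1 by rewrite powRr1// ltW.
  rewrite -powRrM mul1r.
  have : (k^-1) `^ 1 <= (k^-1) `^ (q%:R - b).
    by rewrite ler_powR// ?invf_ge1 ?(ltW k1)//; lra.
  rewrite -(powR_inv1 (ltW kp)) -!powRrM !mulN1r !powRN lef_pV2 ?posrE ?powR_gt0//.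
- exact: cvg_cst.
- by rewrite -(mulr0 C); apply: cvgM => //; exact: cvg_cst.
Qed.

Section density_measure.
Local Open Scope ereal_scope.
Context d (T : measurableType d) (R : realType) (mu : {measure set T -> \bar R}).
Context (w : T -> R) (mw : measurable_fun setT w) (w0 : forall x, (0 <= w x)%R).

(** The proofs are arguments so that the measure structure can be inferred. *)
Definition density_measure (mw : measurable_fun setT w) (w0 : forall x, (0 <= w x)%R)
  (A : set T) : \bar R := \int[mu]_(x in A) (w x)%:E.

Local Notation nu := (density_measure mw w0).

Let nu0 : nu set0 = 0. Proof. by rewrite /density_measure integral_set0. Qed.

Let nu_ge0 A : 0 <= nu A.
Proof. by apply: integral_ge0 => x _; rewrite lee_fin. Qed.

Let nu_sigma_additive : semi_sigma_additive nu.
Proof.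
apply: semi_sigma_additive_nng_induced; first exact/measurable_EFinP.
by move=> x; rewrite lee_fin.
Qed.

HB.instance Definition _ := isMeasure.Build _ _ _ nu nu0 nu_ge0 nu_sigma_additive.

Lemma integral_density_measure (g : T -> \bar R) : measurable_fun setT g ->
  (forall x, 0 <= g x) -> \int[nu]_x g x = \int[mu]_x ((w x)%:E * g x).
Proof.
apply: (@integral_density _ _ T T R mu nu idfun w) => //; first exact: measurable_id.
Qed.

End density_measure.

Section homogeneous.
Context (R : realType) (n : nat).
Local Notation leb := (lebesgue_rV R n).

Definition l1 (x : 'rV[R]_n) : R := \sum_i x 0 i.

Lemma l1Z s x : l1 (s *: x) = s * l1 x.
Proof. by rewrite /l1 mulr_sumr; apply: eq_bigr => i _; rewrite mxE. Qed.

Lemma measurable_l1 : measurable_fun setT l1.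
Proof. by apply: measurable_sum => i; exact: measurable_rV_coord. Qed.

Lemma measurable_orthant : measurable (orthant R n).
Proof.
have := @measurable_rV_box R n (fun=> `]0, +oo[%classic) (fun=> measurable_itv _).
congr measurable; apply/seteqP; split => x h i; have := h i; rewrite /= in_itv/= andbT//.
Qed.

Definition l1_shell (a b : R) : set 'rV[R]_n := [set x | a <= l1 x < b].

Lemma measurable_l1_shell a b : measurable (l1_shell a b).
Proof.
have := measurable_l1 measurableT (measurable_itv `[a, b[).
by rewrite setTI; congr measurable; apply/seteqP; split => x /=; rewrite in_itv.
Qed.

Lemma orthantZ s x : 0 < s -> orthant R n (s *: x) <-> orthant R n x.
Proof.
move=> s0; split => h i; have := h i; rewrite mxE; first by rewrite pmulr_rgt0.
exact: mulr_gt0.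
Qed.

Variables (alpha : R) (G : 'rV[R]_n -> R).
Hypotheses (mG : measurable_fun setT G) (G0 : forall x, 0 <= G x)
  (GZ : forall s x, 0 < s -> G (s *: x) = s `^ alpha * G x)
  (GO : forall x, ~ orthant R n x -> G x = 0).
Local Notation beta := (n%:R + alpha).

Let mGE : measurable_fun setT (EFin \o G). Proof. exact/measurable_EFinP. Qed.

(** The Jacobian contributes [s ^ n] and the homogeneity of [G] contributes
    [s ^ alpha]. *)
Lemma homogeneous_integral_scale s (F : 'rV[R]_n -> R) : 0 < s ->
  measurable_fun setT F -> (forall x, 0 <= F x) ->
  (\int[leb]_x (F x * G x)%:E = (s `^ beta)%:E * \int[leb]_x (F (s *: x) * G x)%:E)%E.
Proof.
move=> s0 mF F0; rewrite (ge0_integral_lebesgue_rV_scale s0); last 2 first.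
- by apply/measurable_EFinP; exact: measurable_funM.
- by move=> x; rewrite lee_fin mulr_ge0.
rewrite powRD ?(gt_eqF s0) ?implybT// powR_mulrn ?(ltW s0)// EFinM -muleA; congr (_ * _)%E.
rewrite -ge0_integralZl//.
- by apply: eq_integral => x _; rewrite GZ// -EFinM; congr EFin; ring.
- apply/measurable_EFinP; apply: measurable_funM => //.
  by apply: measurableT_comp => //; exact: measurable_rV_scale.
- by move=> x _; rewrite lee_fin mulr_ge0.
- by rewrite lee_fin powR_ge0.
Qed.

Local Notation m := (density_measure leb mG G0).

Lemma density_indic A : measurable A -> m A = (\int[leb]_x (\1_A x * G x)%:E)%E.
Proof.
move=> mA; rewrite /density_measure integral_mkcond; apply: eq_integral => x _.
by rewrite patchE indicE; case: ifP; rewrite ?mul1r ?mul0r.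
Qed.

Lemma homogeneous_shell s a b : 0 < s ->
  m (l1_shell (s * a) (s * b)) = ((s `^ beta)%:E * m (l1_shell a b))%E.
Proof.
move=> s0; rewrite !density_indic; [|exact: measurable_l1_shell..].
rewrite (homogeneous_integral_scale s0)//; last exact: measurable_indic (measurable_l1_shell _ _).
congr (_ * _)%E; apply: eq_integral => x _; rewrite !indicE; congr ((_%:R * _)%:E).
by congr nat_of_bool; apply/idP/idP; rewrite !inE /l1_shell/= l1Z ler_pM2l// ltr_pM2l.
Qed.

Hypothesis n_gt0 : (0 < n)%N.

Lemma orthant_l1 x : orthant R n x -> 0 < l1 x.
Proof.
move=> Ox; rewrite /l1 (bigD1 (Ordinal n_gt0))//= ltr_pwDl//.
by apply: sumr_ge0 => i _; exact/ltW/Ox.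
Qed.

Lemma density_setC_orthant : m (~` orthant R n) = 0%E.
Proof.
rewrite /density_measure (eq_integral (cst 0%E)) ?integral0// => x.
by rewrite inE /= => /GO ->.
Qed.

(** Continuity from below; the density vanishes off the orthant. *)
Lemma le_measure_shells (A : set 'rV[R]_n) (B : nat -> set 'rV[R]_n) (M : \bar R) :
  measurable A -> (forall k, measurable (B k)) -> nondecreasing_seq B ->
  A `&` orthant R n `<=` \bigcup_k B k -> (forall k, m (B k) <= M)%E -> (m A <= M)%E.
Proof.
move=> mA mB ndB AB BM; have mO := measurable_orthant.
have mU : measurable (\bigcup_k B k) by exact: bigcup_measurable.
have UM : (m (\bigcup_k B k) <= M)%E.
  have := nondecreasing_cvg_mu mB mU ndB (mu := m) => /cvge_to_le; apply.
  exact: nearW.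
apply: (@le_trans _ _ (m (\bigcup_k B k `|` ~` orthant R n))).
  apply: le_measure; rewrite ?inE//; first by apply: measurableU => //; exact: measurableC.
  by move=> x Ax; have [Ox|Ox] := pselect (orthant R n x); [left; exact: AB|right].
apply: le_trans (measureU2 _ mU (measurableC mO)) _.
by rewrite [X in (_ + X)%E]density_setC_orthant adde0.
Qed.

Hypotheses (beta_gt0 : 0 < beta) (shell_fin : (m (l1_shell 2^-1 1) < +oo)%E).

Let half_lt1 : 2^-1 `^ beta < 1 :> R.
Proof.
suff : 2^-1 `^ beta < 1 `^ beta by rewrite powR1.
by rewrite gt0_ltr_powR ?nnegrE//; lra.
Qed.

(** The masses of the dyadic shells form a geometric series of ratio
    [2 ^ (- beta)]. *)
Lemma density_unit_ball_fin : (m (l1_shell 0 1) < +oo)%E.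
Proof.
have r1 := half_lt1; set r := 2^-1 `^ beta in r1.
set D := fine (m (l1_shell 2^-1 1)).
have r0 : 0 <= r by exact: powR_ge0.
have DE : m (l1_shell 2^-1 1) = D%:E by rewrite fineK// ge0_fin_numE.
have D0 : 0 <= D by rewrite fine_ge0.
apply: (@le_lt_trans _ _ (D / (1 - r))%:E); last exact: ltry.
apply: (@le_measure_shells _ (fun k => l1_shell (2^-1 ^+ k) 1)).
- exact: measurable_l1_shell.
- by move=> k; exact: measurable_l1_shell.
- move=> i j ij; apply/subsetPset => x; rewrite /l1_shell/= => /andP[+ ->].
  rewrite andbT; apply: le_trans; rewrite !exprVn lef_pV2 ?posrE ?exprn_gt0//.
  by rewrite ler_weXn2l ?ler1n.
- move=> x [/andP[_ x1] /orthant_l1 x0].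
  exists (Num.truncn (l1 x)^-1) => //; rewrite /l1_shell/= x1 andbT.
  rewrite exprVn invf_ple ?posrE ?exprn_gt0//; apply: ltW.
  apply: lt_le_trans (truncnS_gt _) _; rewrite -natrX ler_nat; exact: ltn_expl.
- elim=> [|k ih].
    rewrite expr0 (_ : l1_shell 1 1 = set0) ?measure0 ?lee_fin ?divr_ge0//; first by lra.
    by apply/seteqP; split => x //; rewrite /l1_shell/= => /andP[a b]; lra.
  apply: (@le_trans _ _ (m (l1_shell 2^-1 1 `|` l1_shell (2^-1 ^+ k.+1) 2^-1))).
    apply: le_measure; rewrite ?inE.
    - exact: measurable_l1_shell.
    - by apply: measurableU; exact: measurable_l1_shell.
    - move=> x /andP[a b]; rewrite /l1_shell/=; have [c|c] := leP 2^-1 (l1 x); [left|right].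
        by rewrite ?c.
      by rewrite a ?c.
  apply: le_trans (measureU2 _ (measurable_l1_shell _ _) (measurable_l1_shell _ _)) _.
  have -> : l1_shell (2^-1 ^+ k.+1) 2^-1 = l1_shell (2^-1 * 2^-1 ^+ k) (2^-1 * 1).
    by rewrite exprS mulr1.
  rewrite [X in (X + _)%E]DE [X in (_ + X)%E]homogeneous_shell// -/r.
  apply: (@le_trans _ _ (D%:E + r%:E * (D / (1 - r))%:E)%E).
    by rewrite leeD2l// lee_wpmul2l// lee_fin.
  rewrite -EFinM -EFinD lee_fin le_eqVlt; apply/orP; left; apply/eqP; field; lra.
Qed.

Lemma density_ball r : 0 < r ->
  m (l1_shell 0 r) = ((r `^ beta)%:E * m (l1_shell 0 1))%E.
Proof. by move=> r0; rewrite -homogeneous_shell// mulr0 mulr1. Qed.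

(** Let [J k] be the integral over the ball of radius [2 ^ k].  The substitution
    [x = 2 y] squares the exponential, which is at most [del] outside the ball of
    radius [L]; so [J (k + 1) <= 2 ^ beta (D + del J k)] with [D] the mass of that
    ball.  As [del 2 ^ beta = 1 / 2], the sequence is bounded. *)
Lemma homogeneous_exp_integrable a : 0 < a ->
  (\int[leb]_x (expR (- (a * l1 x)) * G x)%:E < +oo)%E.
Proof.
move=> a0.
pose F k (x : 'rV[R]_n) := \1_(l1_shell 0 (2 ^+ k)) x * expR (- (a * l1 x)).
have F0 k x : 0 <= F k x by rewrite mulr_ge0 ?expR_ge0// indicE.
have mexp c : measurable_fun setT (fun x : 'rV[R]_n => expR (- (c * l1 x))).
  apply: measurableT_comp => //; apply: measurableT_comp => //.
  by apply: measurable_funM => //; exact: measurable_l1.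
have mF k : measurable_fun setT (F k).
  by apply: measurable_funM => //; exact: measurable_indic (measurable_l1_shell _ _).
pose del : R := 2^-1 * 2^-1 `^ beta; have del0 : 0 < del by rewrite mulr_gt0// powR_gt0.
pose L := 1 + `|ln del / a|.
have L0 : 0 < L by rewrite ltr_pwDl.
have expL : expR (- (a * L)) <= del.
  rewrite -[leRHS]lnK ?posrE// ler_expR /L; have := ler_norm (- (ln del / a)).
  rewrite normrN => h; have : a * (- (ln del / a)) <= a * `|ln del / a| by rewrite ler_pM2l.
  by rewrite mulrN mulrCA divff ?gt_eqF// mulr1; lra.
have ballL r : 0 < r -> m (l1_shell 0 r) \is a fin_num.
  move=> r0; rewrite ge0_fin_numE// density_ball// lte_mul_pinfty ?lee_fin ?powR_ge0//.
  exact: density_unit_ball_fin.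
set D := fine (m (l1_shell 0 L)); set E := fine (m (l1_shell 0 1)).
have D0 : 0 <= D by rewrite fine_ge0.
have E0 : 0 <= E by rewrite fine_ge0.
pose q : R := 2 `^ beta; have q0 : 0 < q by rewrite powR_gt0.
have qdel : q * del = 2^-1.
  by rewrite /q /del mulrCA -powRM// divff// powR1 mulr1.
pose B := 2 * q * D + E.
have JB k : (\int[leb]_x (F k x * G x)%:E <= B%:E)%E.
  elim: k => [|k ih].
    apply: (@le_trans _ _ (m (l1_shell 0 1))).
      rewrite density_indic; last exact: measurable_l1_shell.
      apply: ge0_le_integral => //.
      - by move=> x _; rewrite lee_fin mulr_ge0.
      - by apply/measurable_EFinP; exact: measurable_funM.
      - apply/measurable_EFinP; apply: measurable_funM => //.
        exact: measurable_indic (measurable_l1_shell _ _).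
      - move=> x _; rewrite lee_fin ler_wpM2r// /F expr0 indicE.
        case: (boolP (x \in _)); rewrite ?mul0r// inE mul1r => /andP[x0 _].
        by rewrite -expR0 ler_expR oppr_le0 mulr_ge0// ltW.
    rewrite -[m _]fineK ?ballL// lee_fin /B lerDr; do 2 rewrite mulr_ge0//; exact: ltW.
  rewrite (homogeneous_integral_scale (s := 2))//.
  apply: (@le_trans _ _ (q%:E * (m (l1_shell 0 L) + del%:E * \int[leb]_x (F k x * G x)%:E))%E).
    rewrite lee_wpmul2l ?lee_fin ?powR_ge0//.
    rewrite density_indic; last exact: measurable_l1_shell.
    have mFG : measurable_fun setT (fun x => (F k x * G x)%:E).
      by apply/measurable_EFinP; exact: measurable_funM.
    have FG0 x : (0 <= (F k x * G x)%:E)%E by rewrite lee_fin mulr_ge0.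
    have mIG : measurable_fun setT (fun x => (\1_(l1_shell 0 L) x * G x)%:E).
      apply/measurable_EFinP; apply: measurable_funM => //.
      exact: measurable_indic (measurable_l1_shell _ _).
    rewrite -ge0_integralZl ?lee_fin ?(ltW del0)//.
    rewrite -ge0_integralD//; last 3 first.
    - by move=> x _; rewrite lee_fin mulr_ge0// indicE.
    - by move=> x _; rewrite mule_ge0// lee_fin ltW.
    - exact: measurable_funeM.
    apply: ge0_le_integral => //.
    - by move=> x _; rewrite lee_fin mulr_ge0.
    - apply/measurable_EFinP; apply: measurable_funM => //.
      by apply: measurableT_comp => //; exact: measurable_rV_scale.
    - by apply: emeasurable_funD => //; exact: measurable_funeM.
    - move=> x _; rewrite -EFinM -EFinD lee_fin mulrA -mulrDl ler_wpM2r//.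
      have -> : F k.+1 (2 *: x) = \1_(l1_shell 0 (2 ^+ k)) x * expR (- (a * l1 x)) ^+ 2.
        rewrite /F l1Z -expRM_natl; congr (_ * expR _); last by ring.
        rewrite !indicE; congr (_%:R); congr nat_of_bool; apply/idP/idP;
          by rewrite !inE /l1_shell/= l1Z exprS ltr_pM2l// pmulr_rge0.
      rewrite /F; set e := expR _; have e0 : 0 <= e by exact: expR_ge0.
      rewrite !indicE; case: (boolP (x \in l1_shell 0 (2 ^+ k))); last first.
        by rewrite !mul0r mulr0 addr0.
      rewrite inE !mul1r => /andP[x0 _].
      have [xL|xL] := ltP (l1 x) L.
        rewrite mem_set; last by rewrite /l1_shell/= x0.
        have e1 : e <= 1 by rewrite -expR0 ler_expR oppr_le0 mulr_ge0// ltW.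
        by rewrite -[leLHS]addr0 lerD ?exprn_ile1// mulr_ge0// ltW.
      have edel : e <= del.
        by apply: le_trans expL; rewrite ler_expR lerN2 ler_pM2l.
      by rewrite expr2; apply: (@le_trans _ _ (del * e)); [exact: ler_wpM2r|rewrite lerDr].
  apply: (@le_trans _ _ (q%:E * (D%:E + del%:E * B%:E))%E).
    rewrite lee_wpmul2l ?lee_fin ?powR_ge0//; rewrite -[m _]fineK ?ballL//.
    by rewrite leeD2l// lee_wpmul2l// lee_fin ltW.
  rewrite -(EFinM del B) -(EFinD D) -EFinM lee_fin mulrDr mulrA qdel /B.
  by have := mulr_ge0 (ltW q0) D0; lra.
have cvgJ : (\int[leb]_x (F k x * G x)%:E)%E @[k --> \oo] -->
    (\int[leb]_x (expR (- (a * l1 x)) * G x)%:E)%E.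
  rewrite (_ : (\int[leb]_x (expR (- (a * l1 x)) * G x)%:E)%E =
    (\int[leb]_x limn (fun k => (F k x * G x)%:E))%E).
    apply: cvg_monotone_convergence => //.
    - by move=> k; apply/measurable_EFinP; exact: measurable_funM.
    - by move=> k x _; rewrite lee_fin mulr_ge0.
    - move=> x _ i j ij; rewrite lee_fin ler_wpM2r// /F ler_wpM2r ?expR_ge0//.
      rewrite !indicE; case: (boolP (x \in l1_shell 0 (2 ^+ i))) => //; rewrite inE => /andP[x0 xi].
      rewrite mem_set// /l1_shell/= x0 (lt_le_trans xi)//.
      by rewrite ler_weXn2l ?ler1n.
  apply: eq_integral => x _; apply/esym/cvg_lim => //.
  have [Ox|/GO Gx] := pselect (orthant R n x); last first.
    by rewrite Gx mulr0; under eq_fun do rewrite mulr0; exact: cvg_cst.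
  apply: cvg_near_cst; exists (Num.truncn (l1 x)) => // k /= hk.
  rewrite /F indicE mem_set ?mul1r//= /l1_shell/= ltW ?orthant_l1//=.
  apply: lt_le_trans (truncnS_gt _) _; rewrite -natrX ler_nat.
  by apply: leq_ltn_trans hk _; exact: ltn_expl.
by apply: le_lt_trans (cvge_to_le cvgJ _) (ltry B); exact: nearW.
Qed.

End homogeneous.

Section on_orthant.
Context (R : realType) (n : nat).
Local Notation leb := (lebesgue_rV R n).
Local Notation O := (orthant R n).

Definition on_orthant (f : 'rV[R]_n -> R) (x : 'rV[R]_n) : R :=
  if x \in O then f x else 0.

Lemma on_orthantT f x : O x -> on_orthant f x = f x.
Proof. by move=> Ox; rewrite /on_orthant mem_set. Qed.

Lemma on_orthantN f x : ~ O x -> on_orthant f x = 0.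
Proof. by move=> Ox; rewrite /on_orthant memNset. Qed.

Lemma on_orthant_ge0 f : (forall x, O x -> 0 <= f x) -> forall x, 0 <= on_orthant f x.
Proof. by move=> f0 x; rewrite /on_orthant; case: ifPn => // /set_mem/f0. Qed.

Lemma measurable_on_orthant f : measurable_fun O f -> measurable_fun setT (on_orthant f).
Proof. by move=> mf; apply/(measurable_restrictT f (@measurable_orthant R n)). Qed.

Lemma integral_on_orthant f (A : set 'rV[R]_n) :
  (\int[leb]_(x in A `&` O) (f x)%:E = \int[leb]_(x in A) (on_orthant f x)%:E)%E.
Proof.
rewrite integral_mkcondr; apply: eq_integral => x _.
by rewrite patchE /on_orthant; case: ifP.
Qed.

Lemma intensityE h : intensity h = (fun A => \int[leb]_(x in A) (on_orthant h x)%:E)%E.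
Proof. by apply/funext => A; exact: integral_on_orthant. Qed.

End on_orthant.

(** * Consequences of asymptotic homogeneity *)
Section asymptotic_homogeneity.
Context (R : realType) (n : nat) (n_ge2 : (2 <= n)%N).
Local Notation leb := (lebesgue_rV R n).
Local Notation O := (orthant R n).
Context (alpha : R) (rho h : 'rV[R]_n -> R).
Local Notation beta := (n%:R + alpha).
Local Notation rescaled := (fun (kappa : R) (x : 'rV[R]_n) =>
   kappa `^ (- alpha) * rho (kappa *: x)).
Hypotheses (rho0 : forall x, O x -> 0 <= rho x) (mrho : measurable_fun O rho)
  (h0 : forall x, O x -> 0 <= h x) (mh : measurable_fun O h)
  (h_gt0 : (0 < \int[leb]_(x in O) (h x)%:E)%E)
  (h_cvg : forall x, O x -> rescaled kappa x @[kappa --> 0^'+] --> h x)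
  (h_unif : {uniform simplex R n, rescaled kappa @[kappa --> 0^'+] --> h}).
Context (nu : probability 'rV[R]_n R).
Hypothesis nuE : forall A, measurable A ->
  nu A = (\int[leb]_(x in A `&` O) (rho x)%:E)%E.

Let n_gt0 : (0 < n)%N. Proof. exact: leq_trans n_ge2. Qed.

Let l1_gt0 (x : 'rV[R]_n) : O x -> 0 < l1 x. Proof. exact: orthant_l1. Qed.

Lemma near_right (Q : R -> Prop) : (\forall k \near 0^'+, Q k) ->
  exists2 d : R, 0 < d & forall k, 0 < k < d -> Q k.
Proof.
move=> [d /= d0 hd]; exists d => // k /andP[k0 kd]; apply: hd => //=.
by rewrite sub0r normrN gtr0_norm.
Qed.

(** Both sides are limits of [kappa ^ (- alpha) rho (kappa s x)], up to replacing
    [kappa] by [kappa s]. *)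
Lemma h_homogeneous s x : 0 < s -> O x -> h (s *: x) = s `^ alpha * h x.
Proof.
move=> s0 Ox; have Osx : O (s *: x) by exact/orthantZ.
have c1 := h_cvg Osx.
have c2 : s `^ alpha * rescaled (kappa * s) x @[kappa --> 0^'+] --> s `^ alpha * h x.
  apply: cvgM; first exact: cvg_cst.
  apply: (@cvg_comp _ _ _ (fun k : R => k * s) (fun k => rescaled k x) _ (0^'+)); last exact: h_cvg.
  move=> Q [d /= d0 hd]; exists (d / s); first by rewrite /= divr_gt0.
  move=> k /= kd k0; apply: hd; last exact: mulr_gt0.
  by move: kd; rewrite /ball_/= !sub0r !normrN normrM (gtr0_norm s0) ltr_pdivlMr.
have e : \forall k \near 0^'+, s `^ alpha * rescaled (k * s) x = rescaled k (s *: x).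
  exists 1 => //= k _ k0; rewrite scalerA powRM ?ltW// !mulrA; congr (_ * _).
  by rewrite mulrAC -powRD ?(gt_eqF s0) ?implybT// addrN powRr0 mul1r.
have c3 : rescaled kappa (s *: x) @[kappa --> 0^'+] --> s `^ alpha * h x.
  by apply: cvg_trans c2; apply: near_eq_cvg; exact: e.
exact: (cvg_unique _ c1 c3).
Qed.

(** A point near the origin is its norm times a point of the simplex; there the
    convergence is uniform. *)
Lemma rho_near_h e : 0 < e -> exists2 k0, 0 < k0 & forall y, O y -> l1 y < k0 ->
  `|rho y - h y| <= e * l1 y `^ alpha.
Proof.
move=> e0.
have W : nbhs (h : {uniform` simplex R n -> R}) [set g | forall x, simplex R n x ->
  `|h x - g x| < e].
  apply/uniform_nbhs; exists [set xy | ball xy.1 e xy.2]; split.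
    exact: entourage_ball (PosNum e0).
  by [].
have /near_right[d d0 hd] := h_unif W.
exists d => // y Oy yd; have y0 := l1_gt0 Oy.
pose x := (l1 y)^-1 *: y.
have yE : y = l1 y *: x by rewrite scalerA divff ?scale1r ?gt_eqF.
have Ox : O x by apply/orthantZ => //; rewrite invr_gt0.
have hx : simplex R n x by apply: simplex_pos => //; rewrite -/(l1 x) l1Z mulVf ?gt_eqF.
have y0d : 0 < l1 y < d by rewrite y0.
have := hd _ y0d _ hx; rewrite -yE => /ltW hle.
have hy : h y = l1 y `^ alpha * h x by rewrite {1}yE h_homogeneous.
have ry : rho y = l1 y `^ alpha * (l1 y `^ (- alpha) * rho y).
  by rewrite mulrA -powRD ?(gt_eqF y0) ?implybT// addrN powRr0 mul1r.
rewrite hy ry -mulrBr normrM ger0_norm ?powR_ge0// mulrC ler_wpM2r ?powR_ge0//.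
by rewrite distrC.
Qed.

Local Notation H := (on_orthant h).
Local Notation pw := (on_orthant (fun x : 'rV[R]_n => l1 x `^ alpha)).

Lemma on_homogeneous f s (x : 'rV[R]_n) :
  (forall x, O x -> f (s *: x) = s `^ alpha * f x) ->
  0 < s -> on_orthant f (s *: x) = s `^ alpha * on_orthant f x.
Proof.
move=> fZ s0; have [Ox|Ox] := pselect (O x).
  by rewrite !on_orthantT ?fZ//; exact/orthantZ.
by rewrite !on_orthantN ?mulr0// => /(@orthantZ _ _ _ x s0).1.
Qed.

Lemma limit_densityZ s x : 0 < s -> H (s *: x) = s `^ alpha * H x.
Proof. by move=> s0; apply: on_homogeneous => // y; exact: h_homogeneous. Qed.

Lemma l1_powerZ s x : 0 < s -> pw (s *: x) = s `^ alpha * pw x.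
Proof.
move=> s0; apply: on_homogeneous => // y Oy.
by rewrite l1Z powRM// ltW//; exact: l1_gt0.
Qed.

Lemma limit_density_ge0 x : 0 <= H x. Proof. exact: on_orthant_ge0. Qed.
Lemma l1_power_ge0 x : 0 <= pw x.
Proof. by apply: on_orthant_ge0 => y _; exact: powR_ge0. Qed.
Lemma measurable_limit_density : measurable_fun setT H. Proof. exact: measurable_on_orthant. Qed.
Lemma measurable_l1_power : measurable_fun setT pw.
Proof.
apply: measurable_on_orthant; apply: measurable_funTS.
by apply: (measurableT_comp (measurable_powR alpha)); exact: measurable_l1.
Qed.

Local Notation S0 := (@l1_shell R n 2^-1 1).

Lemma l1_power_shell_fin : (\int[leb]_(x in S0) (pw x)%:E < +oo)%E.
Proof.
pose B := [set x : 'rV[R]_n | forall i, `[0, 1]%classic (x 0 i)].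
have mB : measurable B := @measurable_rV_box R n (fun=> `[0, 1]%classic) (fun=> measurable_itv _).
have Bfin : (leb B < +oo)%E.
  have -> := @lebesgue_rV_box R n (fun=> `[0, 1]%classic) (fun=> measurable_itv _).
  rewrite (eq_bigr (fun=> 1%E)); first by rewrite big1_eq ltry.
  by move=> i _; rewrite /= lebesgue_measure_itv/= lte_fin ltr01 oppr0 adde0.
pose D : R := 2^-1 `^ alpha + 1.
apply: (@le_lt_trans _ _ (D%:E * leb B)%E); last by rewrite lte_mul_pinfty// lee_fin addr_ge0//
  powR_ge0.
rewrite -integral_cst// [leLHS]integral_mkcond [leRHS]integral_mkcond.
apply: ge0_le_integral => //.
- by move=> x _; rewrite patchE; case: ifP => // _; rewrite lee_fin l1_power_ge0.
- apply/(measurable_restrictT _ _).1; first exact: measurable_l1_shell.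
  by apply: measurable_funTS; apply/measurable_EFinP; exact: measurable_l1_power.
- by apply/(measurable_restrictT _ _).1 => //; exact: measurable_cst.
- move=> x _; rewrite !patchE; case: ifPn => [|_]; last by case: ifPn => // _;
    rewrite lee_fin addr_ge0// powR_ge0.
  rewrite inE => /andP[x1 x2].
  have [Ox|Ox] := pselect (O x); last first.
    by rewrite on_orthantN//; case: ifPn => // _; rewrite lee_fin addr_ge0// powR_ge0.
  rewrite mem_set; last first.
    move=> i; rewrite /= in_itv/= (ltW (Ox i))/= (le_trans _ (ltW x2))// /l1 (bigD1 i)//= lerDl.
    by apply: sumr_ge0 => j _; exact/ltW/Ox.
  rewrite on_orthantT// lee_fin /D.
  have x0 := l1_gt0 Ox.
  have [a0|a0] := leP 0 alpha.
    apply: (@le_trans _ _ 1); last by rewrite lerDr powR_ge0.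
    have : l1 x `^ alpha <= 1 `^ alpha by rewrite ge0_ler_powR ?nnegrE ?(ltW x0) ?(ltW x2).
    by rewrite powR1.
  rewrite -[leLHS]addr0 lerD//.
  have : l1 x `^ alpha <= 2^-1 `^ alpha.
    rewrite -[alpha]opprK ![_ `^ (- - alpha)]powRN lef_pV2 ?posrE ?powR_gt0//.
    by rewrite ge0_ler_powR ?nnegrE ?oppr_ge0 ?(ltW a0)// ltW.
  done.
Qed.

Local Notation mH := (density_measure leb measurable_limit_density limit_density_ge0).

Lemma intensity_total_gt0 : (0 < mH setT)%E.
Proof. by move: h_gt0; rewrite -[X in integral _ X]setTI integral_on_orthant. Qed.

(** Every dyadic shell has mass proportional to that of [S0], and together they
    exhaust the orthant. *)
Lemma intensity_shell_gt0 : (0 < mH S0)%E.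
Proof.
rewrite lt0e measure_ge0 andbT; apply/negP => /eqP S00.
have scale0 s : 0 < s -> mH (l1_shell (s * 2^-1) (s * 1)) = 0%E.
  by move=> s0; rewrite (homogeneous_shell _ _ limit_densityZ)// S00 mule0.
suff : (mH setT <= 0)%E by rewrite leNgt intensity_total_gt0.
apply: (@le_measure_shells _ _ _ _ _ (@on_orthantN _ _ h)
  _ (fun k => l1_shell (2^-1 ^+ k) (2 ^+ k))).
- exact: measurableT.
- by move=> k; exact: measurable_l1_shell.
- move=> i j ij; apply/subsetPset => x; rewrite /l1_shell/= => /andP[a b].
  rewrite (le_trans _ a) ?(lt_le_trans b)//; first by rewrite ler_weXn2l ?ler1n.
  by rewrite !exprVn lef_pV2 ?posrE ?exprn_gt0// ler_weXn2l ?ler1n.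
- move=> x [_ /l1_gt0 x0].
  exists (maxn (Num.truncn (l1 x)^-1) (Num.truncn (l1 x))) => //; rewrite /l1_shell/=; apply/andP;
    split.
    rewrite exprVn invf_ple ?posrE ?exprn_gt0//; apply: ltW.
    apply: lt_le_trans (truncnS_gt _) _; rewrite -natrX ler_nat.
    by apply: leq_ltn_trans (leq_maxl _ (Num.truncn (l1 x))) _; exact: ltn_expl.
  apply: lt_le_trans (truncnS_gt _) _; rewrite -natrX ler_nat.
  by apply: leq_ltn_trans (leq_maxr (Num.truncn (l1 x)^-1) _) _; exact: ltn_expl.
- elim=> [|k ih].
    rewrite !expr0 (_ : l1_shell 1 1 = set0) ?measure0//.
    by apply/seteqP; split => x //; rewrite /l1_shell/= => /andP[a]; rewrite ltNge a.
  have p0 : 0 < 2 ^+ k :> R by rewrite exprn_gt0.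
  have mS a b := @measurable_l1_shell R n a b.
  apply: (@le_trans _ _ (mH ((l1_shell (2^-1 ^+ k * 2^-1) (2^-1 ^+ k * 1) `|`
      l1_shell (2^-1 ^+ k) (2 ^+ k)) `|` l1_shell (2 ^+ k.+1 * 2^-1) (2 ^+ k.+1 * 1)))).
    apply: le_measure; rewrite ?inE; [exact: mS|by apply: measurableU; [apply: measurableU|];
      exact: mS|].
    move=> x; rewrite /l1_shell/= => /andP[]; rewrite !mulr1 -!exprSr => a b.
    have -> : 2 ^+ k.+1 * 2^-1 = 2 ^+ k :> R by rewrite exprSr mulfK.
    have [c|c] := ltP (l1 x) (2^-1 ^+ k); first by left; left; rewrite a.
    have [c'|c'] := ltP (l1 x) (2 ^+ k); first by left; right.
    by right; rewrite b.
  apply: le_trans (measureU2 _ (measurableU _ _ (mS _ _) (mS _ _)) (mS _ _)) _.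
  rewrite [X in (_ + X)%E]scale0 ?exprn_gt0// adde0.
  apply: le_trans (measureU2 _ (mS _ _) (mS _ _)) _.
  by rewrite [X in (X + _)%E]scale0 ?exprn_gt0// add0e.
Qed.

Lemma measurable_l1_oo b : measurable [set x : 'rV[R]_n | 0 < l1 x < b].
Proof.
have := @measurable_l1 R n measurableT _ (measurable_itv `]0, b[).
by rewrite setTI; congr measurable; apply/seteqP; split => x /=; rewrite in_itv.
Qed.

Section excess.
Context (e : R) (e0 : 0 < e).

(* The excess of [h] over [e * l1 ^ alpha] is homogeneous and lies below [rho] near
   the origin, which bounds the mass of its shells by a probability; the shells of
   [h] then have finite mass too. *)
Let G := on_orthant (fun x : 'rV[R]_n => Num.max 0 (h x - e * l1 x `^ alpha)).

Let G0 x : 0 <= G x.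
Proof. by apply: on_orthant_ge0 => y _; rewrite le_max lexx. Qed.

Let mG : measurable_fun setT G.
Proof.
apply: measurable_on_orthant; apply: measurable_maxr => //.
apply: measurable_funB => //; apply: measurable_funM => //; apply: measurable_funTS.
by apply: (measurableT_comp (measurable_powR alpha)); exact: measurable_l1.
Qed.

Let GZ s x : 0 < s -> G (s *: x) = s `^ alpha * G x.
Proof.
move=> s0; apply: on_homogeneous => // y Oy.
rewrite h_homogeneous// l1Z powRM ?(ltW s0) ?ltW ?l1_gt0//.
by rewrite maxr_pMr ?powR_ge0// mulr0; congr Num.max; ring.
Qed.

Local Notation mG_ := (density_measure leb mG G0).

Let measurable_rho0 : measurable_fun setT (on_orthant rho).
Proof. exact: measurable_on_orthant. Qed.

Lemma excess_le_nu : exists j0 : nat, forall j, (j0 <= j)%N ->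
  (((2^-1 ^+ j) `^ beta)%:E * mG_ S0 <= nu [set x | 0%R < l1 x < 2^-1 ^+ j]%R)%E.
Proof.
have [k0 k00 hk0] := rho_near_h e0.
exists (Num.truncn k0^-1) => j hj.
have j0 : 0 < 2^-1 ^+ j :> R by rewrite exprn_gt0.
have jk0 : 2^-1 ^+ j < k0.
  rewrite exprVn invf_plt ?posrE ?exprn_gt0//.
  apply: lt_le_trans (truncnS_gt _) _; rewrite -natrX ler_nat.
  by apply: leq_ltn_trans hj _; exact: ltn_expl.
rewrite -(homogeneous_shell _ _ GZ)// mulr1.
have mC := measurable_l1_oo (2^-1 ^+ j).
rewrite nuE// integral_on_orthant /density_measure.
rewrite [leLHS]integral_mkcond [leRHS]integral_mkcond.
apply: ge0_le_integral => //.
- by move=> x _; rewrite patchE; case: ifP => // _; rewrite lee_fin.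
- apply/(measurable_restrictT _ _).1; first exact: measurable_l1_shell.
  by apply: measurable_funTS; exact/measurable_EFinP.
- apply/(measurable_restrictT _ _).1 => //.
  by apply: measurable_funTS; exact/measurable_EFinP.
- move=> x _; rewrite !patchE.
  have r0 : 0 <= on_orthant rho x by exact: on_orthant_ge0.
  case: ifPn => [|_]; last by case: ifPn => // _; rewrite lee_fin.
  rewrite inE => /andP[x1 x2].
  rewrite mem_set; last by rewrite /= x2 andbT (lt_le_trans _ x1)// divr_gt0.
  rewrite lee_fin /G; have [Ox|Ox] := pselect (O x); last by rewrite !on_orthantN.
  rewrite !on_orthantT// ge_max rho0//=.
  by have := hk0 x Ox (lt_trans x2 jk0); rewrite ler_norml => /andP[+ _]; lra.
Qed.

Lemma excess_fin : (mG_ S0 < +oo)%E.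
Proof.
have [j hj] := excess_le_nu; have := hj j (leqnn j) => le1.
have p0 : 0 < (2^-1 ^+ j) `^ beta by rewrite powR_gt0// exprn_gt0.
rewrite -(@lte_pmul2l _ ((2^-1 ^+ j) `^ beta)%:E)// gt0_muley ?lte_fin//.
by apply: le_lt_trans le1 _; rewrite ltey_eq fin_num_measure//; exact: measurable_l1_oo.
Qed.

Lemma intensity_shell_le_excess : (mH S0 <= mG_ S0 + e%:E * \int[leb]_(x in S0) (pw x)%:E)%E.
Proof.
have mS : measurable S0 by exact: measurable_l1_shell.
rewrite /density_measure -ge0_integralZl//; last 3 first.
- by apply: measurable_funTS; apply/measurable_EFinP; exact: measurable_l1_power.
- by move=> x _; rewrite lee_fin l1_power_ge0.
- by rewrite lee_fin ltW.
rewrite -ge0_integralD//; last 4 first.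
- by move=> x _; rewrite lee_fin.
- by apply: measurable_funTS; apply/measurable_EFinP.
- by move=> x _; rewrite mule_ge0 ?lee_fin ?l1_power_ge0// ltW.
- by apply: measurable_funeM; apply: measurable_funTS; apply/measurable_EFinP;
    exact: measurable_l1_power.
apply: ge0_le_integral => //.
- by move=> x _; rewrite lee_fin limit_density_ge0.
- by apply: measurable_funTS; apply/measurable_EFinP; exact: measurable_limit_density.
- apply: emeasurable_funD; first by apply: measurable_funTS; apply/measurable_EFinP.
  by apply: measurable_funeM; apply: measurable_funTS; apply/measurable_EFinP;
    exact: measurable_l1_power.
- move=> x _; rewrite -EFinM -EFinD lee_fin /G.
  have [Ox|Ox] := pselect (O x); last by rewrite !on_orthantN// mulr0 addr0.
  by rewrite !on_orthantT//; have : h x - e * l1 x `^ alpha <=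
    Num.max 0 (h x - e * l1 x `^ alpha); [rewrite le_max lexx orbT|lra].
Qed.

(** The probability of a punctured ball tends to zero with its radius; if [beta] were
    at most zero, [excess_le_nu] would bound it from below by the mass of [S0]. *)
Lemma excess_beta_gt0 : (0 < mG_ S0)%E -> 0 < beta.
Proof.
move=> q0; rewrite ltNge; apply/negP => b0.
have [j0 hj] := excess_le_nu.
pose C j := [set x : 'rV[R]_n | 0 < l1 x < 2^-1 ^+ j].
have mC j : measurable (C j) by exact: measurable_l1_oo.
have C0 : \bigcap_j C j = set0.
  apply/seteqP; split => // x Cx.
  have /andP[x0 _] := Cx 0%N Logic.I.
  have /andP[_] := Cx (Num.truncn (l1 x)^-1) Logic.I; apply/negP; rewrite -leNgt.
  rewrite exprVn invf_ple ?posrE ?exprn_gt0//; apply: ltW.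
  apply: lt_le_trans (truncnS_gt _) _; rewrite -natrX ler_nat; exact: ltn_expl.
have : nu (C j) @[j --> \oo] --> nu (\bigcap_j C j).
  apply: nonincreasing_cvg_mu => //.
  - by rewrite ltey_eq fin_num_measure.
  - by rewrite C0.
  - move=> i j ij; apply/subsetPset => x /andP[a b]; rewrite /C/= a (lt_le_trans b)//.
    by rewrite !exprVn lef_pV2 ?posrE ?exprn_gt0// ler_weXn2l ?ler1n.
rewrite C0 measure0 => cC.
suff near_le : \forall j \near \oo, (mG_ S0 <= nu (C j))%E.
  have le0 : (mG_ S0 <= 0)%E by exact: cvge_to_ge cC near_le.
  by have := lt_le_trans q0 le0; rewrite ltxx.
exists j0 => // j /= jj; apply: le_trans (hj j jj).
rewrite -[leLHS]mul1e lee_wpmul2r// lee_fin.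
rewrite exprVn -powR_inv1// -powRrM mulN1r -[leLHS](powRr0 (2 ^+ j)).
apply: ler_powR; last by rewrite oppr_ge0.
by rewrite exprn_ege1// ler1n.
Qed.

End excess.

Lemma intensity_shell_fin : (mH S0 < +oo)%E.
Proof.
apply: le_lt_trans (intensity_shell_le_excess ltr01) _.
rewrite lte_add_pinfty//; first exact: excess_fin.
by rewrite mul1e; exact: l1_power_shell_fin.
Qed.

(** For [e] small the excess retains a positive part of the mass of the shell. *)
Lemma beta_gt0 : 0 < beta.
Proof.
set a := fine (mH S0); set c := fine (\int[leb]_(x in S0) (pw x)%:E).
have aE : mH S0 = a%:E by rewrite fineK// ge0_fin_numE ?intensity_shell_fin.
have cE : (\int[leb]_(x in S0) (pw x)%:E = c%:E)%E.
  rewrite fineK// ge0_fin_numE ?l1_power_shell_fin//.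
  by apply: integral_ge0 => x _; rewrite lee_fin l1_power_ge0.
have a0 : 0 < a by rewrite -lte_fin -aE intensity_shell_gt0.
have c0 : 0 <= c.
  by rewrite -lee_fin -cE; apply: integral_ge0 => x _; rewrite lee_fin l1_power_ge0.
pose e := a / (2 * (c + 1)).
have e0 : 0 < e by rewrite divr_gt0// mulr_gt0//; lra.
have ec : e * c < a.
  rewrite /e mulrAC ltr_pdivrMr; last by lra.
  by rewrite ltr_pM2l//; lra.
apply: (excess_beta_gt0 e0); rewrite ltNge; apply/negP => q0.
have := intensity_shell_le_excess e0; rewrite aE cE => hle.
have : (a%:E <= 0 + (e * c)%:E)%E by apply: le_trans hle _; rewrite EFinM leeD2r.
by rewrite add0e lee_fin leNgt ec.
Qed.

Lemma intensity_total_infinite : mH setT = +oo%E.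
Proof.
apply/eqyP => A A0.
set a := fine (mH S0).
have aE : mH S0 = a%:E by rewrite fineK// ge0_fin_numE ?intensity_shell_fin.
have a0 : 0 < a by rewrite -lte_fin -aE intensity_shell_gt0.
pose r := (A / a) `^ beta^-1.
have r0 : 0 < r by rewrite powR_gt0// divr_gt0.
apply: (@le_trans _ _ (mH (l1_shell (r * 2^-1) (r * 1)))); last first.
  by apply: le_measure; rewrite ?inE//; exact: measurable_l1_shell.
rewrite (homogeneous_shell _ _ limit_densityZ)// aE -EFinM lee_fin /r -powRrM mulVf ?gt_eqF
  ?beta_gt0//.
by rewrite powRr1 ?divr_ge0 ?(ltW A0) ?(ltW a0)// divfK// gt_eqF.
Qed.

Lemma limit_density_exp_integrable a : 0 < a ->
  (\int[leb]_x (expR (- (a * l1 x)) * H x)%:E < +oo)%E.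
Proof.
exact: (homogeneous_exp_integrable limit_densityZ (@on_orthantN _ _ h)
  n_gt0 beta_gt0 intensity_shell_fin).
Qed.

Lemma l1_power_exp_integrable a : 0 < a -> (\int[leb]_x (expR (- (a * l1 x)) * pw x)%:E < +oo)%E.
Proof.
exact: (@homogeneous_exp_integrable _ _ _ _ measurable_l1_power l1_power_ge0 l1_powerZ
  (@on_orthantN _ _ _)
  n_gt0 beta_gt0 l1_power_shell_fin).
Qed.

Let mrho' : measurable_fun setT (on_orthant rho). Proof. exact: measurable_on_orthant. Qed.
Let rho'0 x : 0 <= on_orthant rho x. Proof. exact: on_orthant_ge0. Qed.

Lemma nu_density (g : 'rV[R]_n -> \bar R) : measurable_fun setT g -> (forall x, 0 <= g x)%E ->
  (\int[nu]_x g x = \int[leb]_x ((on_orthant rho x)%:E * g x))%E.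
Proof.
move=> mg g0; apply: (@integral_density _ _ _ _ R leb nu idfun (on_orthant rho)) => //.
  exact: measurable_id.
by move=> A mA; apply: etrans (nuE mA) _; rewrite integral_on_orthant.
Qed.

Let rk (kappa : R) x := kappa `^ (- alpha) * on_orthant rho (kappa *: x).

Let rk0 kappa x : 0 <= rk kappa x. Proof. by rewrite mulr_ge0 ?powR_ge0. Qed.

Let mrk kappa : measurable_fun setT (rk kappa).
Proof.
apply: measurable_funM => //; apply: (measurableT_comp mrho').
exact: measurable_rV_scale.
Qed.

Lemma rescaled_nu kappa (g : 'rV[R]_n -> R) : 0 < kappa -> measurable_fun setT g ->
  (forall x, 0 <= g x) ->
  ((kappa `^ (- beta))%:E * \int[nu]_x (g (kappa^-1 *: x))%:E =
   \int[leb]_x (g x * rk kappa x)%:E)%E.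
Proof.
move=> k0 mg g0.
have mgs : measurable_fun setT (fun x : 'rV[R]_n => g (kappa^-1 *: x)).
  by apply: (measurableT_comp mg); exact: measurable_rV_scale.
rewrite nu_density//; last by move=> x; rewrite lee_fin.
  rewrite (ge0_integral_lebesgue_rV_scale k0); last 2 first.
  - by apply: emeasurable_funM; apply/measurable_EFinP.
  - by move=> x; rewrite mule_ge0// lee_fin.
  rewrite muleA -EFinM -powR_mulrn ?(ltW k0)// -powRD ?(gt_eqF k0) ?implybT//.
  rewrite (_ : - beta + n%:R = - alpha); last by ring.
  rewrite -ge0_integralZl//.
  - apply: eq_integral => x _; rewrite scalerA mulVf ?gt_eqF// scale1r -!EFinM /rk.
    by congr EFin; ring.
  - apply: emeasurable_funM; apply/measurable_EFinP.
      by apply: (measurableT_comp mrho'); exact: measurable_rV_scale.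
    by apply: (measurableT_comp mgs); exact: measurable_rV_scale.
  - by move=> x _; rewrite mule_ge0// lee_fin.
  - by rewrite lee_fin powR_ge0.
exact/measurable_EFinP.
Qed.

Lemma rescaled_nu_total kappa : 0 < kappa ->
  (\int[leb]_x (rk kappa x)%:E = (kappa `^ (- beta))%:E)%E.
Proof.
move=> k0; have := @rescaled_nu kappa (cst 1) k0 (measurable_cst _) (fun=> ler01).
rewrite (_ : (\int[nu]_x _)%E = 1%E) ?mule1; last first.
  rewrite (eq_integral (cst 1%E))// integral_cst// mul1e; exact: probability_setT.
by move=> ->; apply: eq_integral => x _; rewrite mul1r.
Qed.

(** The rescaled density converges pointwise to [h] on the orthant.  In the ball of
    radius [d / kappa] it is at most [h + l1 ^ alpha], by [rho_near_h], and dominated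
    convergence applies.  Outside this ball the test functions are at most
    [D * exp (- a d / kappa)], whereas the total mass is only [kappa ^ (- beta)]. *)
Lemma rescaled_integral_cvg (kappa : nat -> R) (phi_ : nat -> 'rV[R]_n -> R)
    (phi : 'rV[R]_n -> R) (D a : R) :
  (forall K, 0 < kappa K) -> kappa K @[K --> \oo] --> 0 ->
  0 < a -> 0 <= D ->
  (forall K, measurable_fun setT (phi_ K)) -> measurable_fun setT phi ->
  (forall K x, 0 <= phi_ K x) ->
  (forall K x, O x -> phi_ K x <= D * expR (- (a * l1 x))) ->
  (forall x, O x -> phi_ K x @[K --> \oo] --> phi x) ->
  ((kappa K `^ (- beta))%:E * \int[nu]_x (phi_ K ((kappa K)^-1 *: x))%:E)%E @[K --> \oo]
    --> (\int[leb]_x (phi x * H x)%:E)%E.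
Proof.
move=> k0 kc a0 D0 mphi_ mphi phi0 phiD phic.
have [d d0 hd] := rho_near_h ltr01.
pose I K := [set x : 'rV[R]_n | l1 x < d / kappa K].
have mI K : measurable (I K).
  have := @measurable_l1 R n measurableT _ (measurable_itv `]-oo, (d / kappa K)[).
  by rewrite setTI; congr measurable; apply/seteqP; split => x /=; rewrite in_itv.
have m1I K : measurable_fun setT (\1_(I K) : _ -> R) by exact: measurable_indic.
have m1IC K : measurable_fun setT (\1_(~` I K) : _ -> R).
  by apply: measurable_indic; exact: measurableC.
pose f K x := \1_(I K) x * (phi_ K x * rk (kappa K) x).
pose g K x := \1_(~` I K) x * (phi_ K x * rk (kappa K) x).
have mf K : measurable_fun setT (f K) by do 2 apply: measurable_funM => //.
have mg K : measurable_fun setT (g K) by do 2 apply: measurable_funM => //.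
have f0 K x : 0 <= f K x by rewrite mulr_ge0 ?indicE// mulr_ge0.
have g0 K x : 0 <= g K x by rewrite mulr_ge0 ?indicE// mulr_ge0.
have split_fg K : ((kappa K `^ (- beta))%:E * \int[nu]_x (phi_ K ((kappa K)^-1 *: x))%:E =
    \int[leb]_x (f K x)%:E + \int[leb]_x (g K x)%:E)%E.
  rewrite rescaled_nu// -ge0_integralD//; last 4 first.
  - by move=> x _; rewrite lee_fin.
  - exact/measurable_EFinP.
  - by move=> x _; rewrite lee_fin.
  - exact/measurable_EFinP.
  apply: eq_integral => x _; rewrite -EFinD; congr EFin.
  rewrite /f /g -mulrDl !indicE in_setC.
  by case: (x \in I K); rewrite /= ?addr0 ?add0r mul1r.
have -> : (fun K => (kappa K `^ (- beta))%:E * \int[nu]_x (phi_ K ((kappa K)^-1 *: x))%:E)%E =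
    (fun K => \int[leb]_x (f K x)%:E + \int[leb]_x (g K x)%:E)%E.
  by apply/funext => K; exact: split_fg.
rewrite -[X in _ --> X]adde0; apply: cvgeD; first by rewrite fin_num_adde_defl.
- pose dom x := D * (expR (- (a * l1 x)) * H x) + D * (expR (- (a * l1 x)) * pw x).
  have mexp : measurable_fun setT (fun x : 'rV[R]_n => expR (- (a * l1 x))).
    apply: measurableT_comp => //; apply: measurableT_comp => //.
    by apply: measurable_funM => //; exact: measurable_l1.
  have mEH : measurable_fun setT (fun x => expR (- (a * l1 x)) * H x).
    by apply: measurable_funM => //; exact: measurable_limit_density.
  have mEp : measurable_fun setT (fun x => expR (- (a * l1 x)) * pw x).
    by apply: measurable_funM => //; exact: measurable_l1_power.
  have iH : leb.-integrable setT (fun x => (expR (- (a * l1 x)) * H x)%:E).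
    apply/integrableP; split; first exact/measurable_EFinP.
    under eq_integral do rewrite gee0_abs ?lee_fin ?mulr_ge0 ?expR_ge0 ?limit_density_ge0//.
    exact: limit_density_exp_integrable.
  have ip : leb.-integrable setT (fun x => (expR (- (a * l1 x)) * pw x)%:E).
    apply/integrableP; split; first exact/measurable_EFinP.
    under eq_integral do rewrite gee0_abs ?lee_fin ?mulr_ge0 ?expR_ge0 ?l1_power_ge0//.
    exact: l1_power_exp_integrable.
  have idom : leb.-integrable setT (fun x => (dom x)%:E).
    have := integrableD measurableT (integrableZl measurableT D iH) (integrableZl measurableT D ip).
    by apply: eq_integrable => // x _; rewrite /dom EFinD !EFinM.
  have fdom K x : f K x <= dom x.
    have dom0 : 0 <= dom x by rewrite addr_ge0// mulr_ge0// mulr_ge0 ?expR_ge0 ?limit_density_ge0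
      ?l1_power_ge0.
    rewrite /f indicE; case: (boolP (x \in I K)); rewrite ?mul0r// inE mul1r => Ix.
    have [Ox|Ox] := pselect (O x); last first.
      rewrite /rk on_orthantN ?mulr0//.
      by move=> /(@orthantZ _ _ _ x (k0 K)).1.
    have Okx : O (kappa K *: x) by exact/orthantZ.
    have kx : l1 (kappa K *: x) < d by rewrite l1Z mulrC -ltr_pdivlMr.
    have : rk (kappa K) x <= H x + pw x.
      have := hd _ Okx kx; rewrite mul1r ler_norml => /andP[_]; rewrite lerBlDr => le1.
      have kN := gt_eqF (k0 K).
      have -> : H x + pw x = kappa K `^ (- alpha) * (pw (kappa K *: x) + H (kappa K *: x)).
        rewrite l1_powerZ// limit_densityZ// -mulrDr mulrA -powRD ?kN ?implybT// addNr powRr0 mul1r.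
        exact: addrC.
      by rewrite /rk ler_wpM2l ?powR_ge0// !on_orthantT.
    move=> le2; apply: (@le_trans _ _ (D * expR (- (a * l1 x)) * (H x + pw x))).
      by apply: ler_pM => //; exact: phiD.
    by rewrite /dom mulrDr !mulrA.
  have fc x : f K x @[K --> \oo] --> phi x * H x.
    have [Ox|Ox] := pselect (O x); last first.
      rewrite on_orthantN// mulr0; have f00 K : f K x = 0.
        rewrite /f /rk on_orthantN ?mulr0// => /(@orthantZ _ _ _ x (k0 K)).1; exact: Ox.
      by under eq_fun do rewrite f00; exact: cvg_cst.
    rewrite -[X in _ --> X]mul1r; apply: cvgM.
      apply: cvg_near_cst.
      have dx : 0 < d / l1 x by rewrite divr_gt0// l1_gt0.
      have /cvgrPdist_lt/(_ _ dx) := kc; apply: filterS => K.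
      rewrite sub0r normrN gtr0_norm// => kd; rewrite indicE mem_set// /I/=.
      by rewrite ltr_pdivlMr// mulrC -ltr_pdivlMr ?l1_gt0.
    apply: cvgM; first exact: phic.
    rewrite on_orthantT// /rk.
    have -> : (fun K => kappa K `^ (- alpha) * on_orthant rho (kappa K *: x)) =
        (fun K => rescaled (kappa K) x).
      by apply/funext => K; rewrite on_orthantT//; exact/orthantZ.
    apply: (@cvg_comp _ _ _ kappa (fun k => rescaled k x) _ (0^'+)); last exact: h_cvg.
    move=> Q [e /= e0 he]; have /cvgrPdist_lt/(_ _ e0) := kc.
    by apply: filterS => K kK; apply: he.
  have [|||||_ _ h1] := @dominated_convergence _ _ _ leb setT measurableT
      (fun K x => (f K x)%:E) (fun x => (phi x * H x)%:E) (fun x => (dom x)%:E).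
  + by move=> K; exact/measurable_EFinP.
  + by apply/measurable_EFinP; apply: measurable_funM => //; exact: measurable_limit_density.
  + by apply: aeW => x _; apply: cvg_EFin; [exact: nearW|exact: fc].
  + exact: idom.
  + by apply: aeW => x K _; rewrite abse_EFin lee_fin ger0_norm.
  + exact: h1.
- pose M K := D * (expR (- (a * d / kappa K)) * kappa K `^ (- beta)).
  have gM K : (\int[leb]_x (g K x)%:E <= (M K)%:E)%E.
    rewrite /M mulrA EFinM -rescaled_nu_total// -ge0_integralZl//; last 3 first.
    + exact/measurable_EFinP.
    + by move=> x _; rewrite lee_fin.
    + by rewrite lee_fin mulr_ge0 ?expR_ge0.
    apply: ge0_le_integral => //.
    + by move=> x _; rewrite lee_fin.
    + exact/measurable_EFinP.
    + by apply: measurable_funeM; exact/measurable_EFinP.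
    + move=> x _; rewrite -EFinM lee_fin /g indicE.
      have c0 : 0 <= D * expR (- (a * d / kappa K)) by rewrite mulr_ge0 ?expR_ge0.
      case: (boolP (x \in _)); rewrite ?mul0r ?(mulr_ge0 c0 (rk0 _ _))// inE mul1r /I/= => /negP.
      rewrite -leNgt => dx.
      have [Ox|Ox] := pselect (O x); last first.
        rewrite /rk on_orthantN ?mulr0// => /(@orthantZ _ _ _ x (k0 K)).1; exact: Ox.
      rewrite ler_wpM2r//; apply: le_trans (phiD K x Ox) _.
      by rewrite ler_wpM2l// ler_expR lerN2 -mulrA ler_pM2l.
  have Mc : (M K)%:E @[K --> \oo] --> 0%:E.
    apply: cvg_EFin; first exact: nearW.
    rewrite -(mulr0 D); apply: cvgM; first exact: cvg_cst.
    by apply: powR_expR_cvg0 => //; [exact: beta_gt0|exact: mulr_gt0].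
  apply: (@squeeze_cvge _ _ _ _ (fun=> 0%E) _ (fun K => (M K)%:E)) => //.
  + by apply: nearW => K; rewrite gM andbT; apply: integral_ge0 => x _; rewrite lee_fin.
  + exact: cvg_cst.
Qed.

End asymptotic_homogeneity.

(** * Estimates for exponentials *)
Section real_lemmas.
Context {R : realType}.

Lemma expR_dist (x y : R) : `|expR (- x) - expR (- y)| <= `|x - y| * expR (- Num.min x y).
Proof.
wlog xy : x y / x <= y.
  by case/orP: (le_total x y) => h wl; [exact: wl|rewrite distrC (distrC x) minC wl].
rewrite min_l// ger0_norm ?subr_ge0 ?ler_expR ?lerN2// ler0_norm ?subr_le0//.
have -> : expR (- x) - expR (- y) = (1 - expR (- (y - x))) * expR (- x).
  by rewrite mulrBl mul1r -expRD; congr (_ - expR _); ring.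
rewrite ler_wpM2r ?expR_ge0//; have := expR_ge1Dx (- (y - x)); lra.
Qed.

(** The Gumbel distribution function. *)
Definition gumbel (s : R) : R := expR (- expR (- s)).

Lemma gumbel01 s : 0 <= gumbel s <= 1.
Proof. by rewrite expR_ge0/= -expR0 ler_expR oppr_le0 expR_ge0. Qed.

Lemma gumbel_mono : {mono gumbel : x y / x < y}.
Proof. by move=> x y; rewrite ltr_expR ltrN2 ltr_expR ltrN2. Qed.

Lemma continuous_gumbel : continuous gumbel.
Proof.
move=> s; apply: (@cvg_comp _ _ _ (fun s => - expR (- s)) expR); last exact: continuous_expR.
apply: cvgN; apply: (@cvg_comp _ _ _ -%R expR); last exact: continuous_expR.
by apply: cvgN; exact: cvg_id.
Qed.

(** For [s >= 0] the difference of the exponents is of order [|a - 1| s exp (- s / 2)].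
    For [s < 0] it may be as large as a power of [v = exp (- s / 2)], but both values
    are then at most [exp (- v)], and [v ^ 5 <= 5! exp v]; hence [240 = 2 * 5!]. *)
Lemma gumbel_dist (a s : R) : 2^-1 <= a <= 2 -> `|gumbel (a * s) - gumbel s| <= 240 * `|a - 1|.
Proof.
move=> /andP[a1 a2]; rewrite /gumbel.
apply: le_trans (expR_dist _ _) _.
set m := expR (- Num.min _ _).
have m1 : m <= 1 by rewrite -expR0 ler_expR oppr_le0 le_min !expR_ge0.
have d1 : `|expR (- (a * s)) - expR (- s)| <= `|a - 1| * `|s| * expR (- Num.min (a * s) s).
  by apply: le_trans (expR_dist _ _) _; rewrite -normrM mulrBl mul1r.
apply: (@le_trans _ _ (`|a - 1| * `|s| * expR (- Num.min (a * s) s) * m)).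
  by rewrite ler_wpM2r ?expR_ge0.
rewrite -!mulrA [leRHS]mulrC ler_wpM2l//.
have [s0|s0] := leP 0 s.
  rewrite ger0_norm//; apply: (@le_trans _ _ (s * expR (- (s / 2)))).
    rewrite ler_wpM2l// -[leRHS]mulr1 ler_pM ?expR_ge0// ler_expR lerN2 le_min.
    by apply/andP; split; [nra|lra].
  have s2 : 0 <= s / 2 by lra.
  have := expR_ge1Dx (s / 2); rewrite expRN => h.
  rewrite ler_pdivrMr ?expR_gt0//; lra.
rewrite ltr0_norm//.
pose v := expR (- s / 2).
have v1 : 1 <= v by rewrite -expR0 ler_expR; lra.
have e1 : - s <= 2 * v by have := expR_ge1Dx (- s / 2); rewrite -/v; lra.
have e2 : expR (- Num.min (a * s) s) <= v ^+ 4.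
  rewrite /v -expRM_natl ler_expR lerNl le_min; apply/andP; split; [nra|lra].
have e3 : m <= expR (- v).
  rewrite /m /v ler_expR lerN2 le_min !ler_expR; apply/andP; split; [nra|lra].
apply: (@le_trans _ _ (2 * v * (v ^+ 4 * expR (- v)))).
  apply: ler_pM => //; [by lra|by rewrite mulr_ge0 ?expR_ge0|].
  by apply: ler_pM => //; rewrite ?expR_ge0.
have v0 : 0 <= v by lra.
have := expR_ge1Dxn 4 v0; rewrite (_ : 5`! = 120)%N// => h.
rewrite expRN mulrA ler_pdivrMr ?expR_gt0//.
have -> : 2 * v * v ^+ 4 = 240 * (v ^+ 5 / 120%:R) by field.
by rewrite ler_pM2l//; lra.
Qed.

(** Squeezed by [exp (- x / (1 - x)) <= 1 - x <= exp (- x)]. *)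
Lemma cvg_pow_expR (x : nat -> R) (L : R) : (forall K, 0 <= x K <= 1) ->
  K%:R * x K @[K --> \oo] --> L -> (1 - x K) ^+ K @[K --> \oo] --> expR (- L).
Proof.
move=> x01 cx.
have x0 : x K @[K --> \oo] --> (0 : R).
  have h : K.+1%:R^-1 * (K.+1%:R * x K.+1) @[K --> \oo] --> (0 * L).
    apply: cvgM; first exact: cvg_harmonic.
    by have := cx; rewrite -cvg_shiftS.
  rewrite -cvg_shiftS; move: h; rewrite mul0r; apply: cvg_trans; apply: near_eq_cvg.
  by apply: nearW => K; rewrite mulKf// pnatr_eq0.
apply: (@squeeze_cvgr _ _ _ _ (fun K => expR (- (K%:R * x K / (1 - x K))))
  (fun K => expR (- (K%:R * x K)))).
- have /cvgrPdist_lt/(_ 1 ltr01) := x0; apply: filterS => K.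
  have /andP[xK0 xK1] := x01 K; rewrite sub0r normrN ger0_norm// => xK.
  have p0 : 0 < 1 - x K by lra.
  apply/andP; split.
    have -> : - (K%:R * x K / (1 - x K)) = K%:R * (- (x K / (1 - x K))) by rewrite mulrN mulrA.
    rewrite expRM_natl; apply: lerXn2r; rewrite ?nnegrE ?expR_ge0 ?(ltW p0)//.
    rewrite expRN invf_ple ?posrE ?expR_gt0//; apply: le_trans (expR_ge1Dx _).
    by rewrite le_eqVlt; apply/orP; left; apply/eqP; field; lra.
  rewrite -mulrN expRM_natl; apply: lerXn2r; rewrite ?nnegrE ?expR_ge0 ?(ltW p0)//.
  by have := expR_ge1Dx (- x K); lra.
- apply: (@cvg_comp _ _ _ (fun K => - (K%:R * x K / (1 - x K))) expR); last exact: continuous_expR.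
  apply: cvgN; rewrite -[X in _ --> X]mulr1; apply: cvgM => //.
  rewrite -[X in _ --> X]invr1; apply: cvgV; first exact: oner_neq0.
  by rewrite -[X in _ --> X]subr0; apply: cvgB => //; exact: cvg_cst.
- apply: (@cvg_comp _ _ _ (fun K => - (K%:R * x K)) expR); last exact: continuous_expR.
  exact: cvgN.
Qed.

Lemma expR_convex (t x y : R) : 0 <= t <= 1 ->
  expR (t * x + (1 - t) * y) <= t * expR x + (1 - t) * expR y.
Proof.
move=> /andP[t0 t1]; have := convex_expR (Itv01 t0 t1) x y.
by rewrite !convRE.
Qed.

(** Hoelder's inequality for exponentials, in logarithmic form. *)
Lemma sum_expR_holder (I : Type) (s : seq I) (f g : I -> R) (t A B : R) :
  0 <= t <= 1 -> 0 < A -> 0 < B ->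
  \sum_(i <- s) expR (f i) <= A -> \sum_(i <- s) expR (g i) <= B ->
  \sum_(i <- s) expR (t * f i + (1 - t) * g i) <= expR (t * ln A + (1 - t) * ln B).
Proof.
move=> t01 A0 B0 fA gB; have /andP[t0 t1] := t01; set c := t * ln A + _.
apply: (@le_trans _ _ (expR c * \sum_(i <- s) (t * (expR (f i) / A) + (1 - t) * (expR (g i) / B)))).
  rewrite mulr_sumr; apply: ler_sum => i _.
  have -> : t * f i + (1 - t) * g i = c + (t * (f i - ln A) + (1 - t) * (g i - ln B)).
    by rewrite /c; ring.
  rewrite expRD ler_wpM2l ?expR_ge0//; apply: le_trans (expR_convex _ _ t01) _.
  by rewrite !expRD !expRN !lnK ?posrE.
rewrite -[leRHS]mulr1 ler_wpM2l ?expR_ge0// big_split/= -!mulr_sumr -!mulr_suml.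
have hA : (\sum_(i <- s) expR (f i)) / A <= 1 by rewrite ler_pdivrMr// mul1r.
have hB : (\sum_(i <- s) expR (g i)) / B <= 1 by rewrite ler_pdivrMr// mul1r.
have t1' : 0 <= 1 - t by lra.
by have := ler_wpM2l t0 hA; have := ler_wpM2l t1' hB; lra.
Qed.

End real_lemmas.

(** * The random functions of the sample *)
Section empirical.
Context (R : realType) (n : nat).
Local Notation S := (set_type (simplex R n)).
Implicit Types (p q r : 'rV[R]_n).

Lemma dot_conv p q x (t : R) :
  dot (t *: p + (1 - t) *: q) x = t * dot p x + (1 - t) * dot q x.
Proof.
by rewrite /dot !mulr_sumr -big_split/=; apply: eq_bigr => i _; rewrite !mxE; ring.
Qed.

Lemma dotZr p x (s : R) : dot p (s *: x) = s * dot p x.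
Proof. by rewrite /dot mulr_sumr; apply: eq_bigr => i _; rewrite !mxE; ring. Qed.

Lemma measurable_dot p : measurable_fun setT (dot p).
Proof.
apply: measurable_sum => i; apply: measurable_funM => //; exact: measurable_rV_coord.
Qed.

Lemma measurable_exp_dot p (s : R) : measurable_fun setT (fun x => expR (- (s * dot p x))).
Proof.
apply: measurableT_comp => //; apply: measurableT_comp => //.
by apply: measurable_funM => //; exact: measurable_dot.
Qed.

Definition empirical (a b lambda : R) (K : nat) (x : nat -> 'rV[R]_n) (p : S) : R :=
  a * Phi lambda K x (val p) - b.

(** A logarithm of a sum of exponentials of linear functions is convex, by
    [sum_expR_holder]. *)
Lemma concave_empirical a b lambda K x : 0 <= a -> ((0 < K)%N -> 0 < lambda) ->
  concave (empirical a b lambda K x).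
Proof.
move=> a0 l0 p q r t t01 rpq; have /andP[t0 t1] := t01.
case: K l0 => [_|K l0]; first by rewrite /empirical /Phi !big_ord0; lra.
have {l0}lam0 := l0 isT.
rewrite /empirical /Phi rpq.
set Sp := \sum_(k < _) _; set Sq := \sum_(k < _) expR (- (lambda * dot (val q) _)).
set Sr := \sum_(k < _) expR (- (lambda * dot (_ + _) _)).
have pos (f : nat -> R) : 0 < \sum_(k < K.+1) expR (f k).
  by rewrite big_ord_recl ltr_pwDl ?expR_gt0// sumr_ge0// => i _; exact: expR_ge0.
have Sp0 : 0 < Sp by exact: (pos (fun k => - (lambda * dot (val p) (x k)))).
have Sq0 : 0 < Sq by exact: (pos (fun k => - (lambda * dot (val q) (x k)))).
have Sr0 : 0 < Sr by exact: (pos (fun k => - (lambda * dot (t *: val p + (1 - t) *: val q) (x k)))).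
have K0 : 0 < K.+1%:R^-1 :> R by rewrite invr_gt0.
have main : ln Sr <= t * ln Sp + (1 - t) * ln Sq.
  rewrite -ler_expR lnK ?posrE//.
  have := @sum_expR_holder R _ (index_enum 'I_K.+1) (fun k => - (lambda * dot (val p) (x k)))
    (fun k => - (lambda * dot (val q) (x k))) t Sp Sq t01 Sp0 Sq0 (lexx _) (lexx _).
  rewrite /Sr; congr (_ <= _); apply: eq_bigr => k _; congr expR.
  by rewrite dot_conv; ring.
rewrite !lnM ?posrE//.
have al : 0 <= a * lambda^-1 by rewrite mulr_ge0// invr_ge0 ltW.
have := ler_wpM2l al main; move: (ln _) (ln Sp) (ln Sq) (ln Sr) => k lp lq lr.
by move: (lambda^-1) => il h; lra.
Qed.

Definition mk_concave (f : S -> R) (cf : concave f) : concave_fun R n :=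
  exist _ (f : simplex_arrow R n) (mem_set cf).

(** The shift [b] is the one that cancels the factor [1 / K] under the logarithm. *)
Lemma empirical_laplace a b lambda K x (p : S) : (0 < K)%N -> 0 < a -> 0 < lambda ->
  b = a * ln K%:R / lambda ->
  gumbel (lambda / a * empirical a b lambda K x p) =
  expR (- \sum_(k < K) expR (- (lambda * dot (val p) (x k)))).
Proof.
move=> K0 a0 l0 ->; rewrite /gumbel /empirical /Phi; congr (expR (- _)).
set Sp := \sum_(k < _) _.
have Sp0 : 0 < Sp.
  case: K K0 @Sp => // K _ Sp.
  by rewrite /Sp big_ord_recl ltr_pwDl ?expR_gt0// sumr_ge0// => i _; exact: expR_ge0.
have Kp : 0 < K%:R :> R by rewrite ltr0n.
rewrite lnM ?posrE ?invr_gt0// lnV ?posrE//.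
have -> : - (lambda / a * (a * (- lambda^-1 * (- ln K%:R + ln Sp)) - a * ln K%:R / lambda)) = ln Sp.
  by field; rewrite !gt_eqF.
by rewrite lnK.
Qed.

Lemma measurable_empirical d (Omega : measurableType d) a b lambda K (p : S)
    (X : nat -> Omega -> 'rV[R]_n) : (forall k, measurable_fun setT (X k)) ->
  measurable_fun setT (fun w => empirical a b lambda K (X^~ w) p).
Proof.
move=> mX; rewrite /empirical /Phi; apply: measurable_funB => //.
do 2 apply: measurable_funM => //; apply: measurableT_comp; first exact: measurable_ln.
apply: measurable_funM => //; apply: measurable_sum => k.
exact: (measurableT_comp (measurable_exp_dot (val p) lambda) (mX k)).
Qed.

End empirical.

Section empirical_moments.
Context (R : realType) (n : nat).
Context d0 (Omega0 : measurableType d0) (P0 : probability Omega0 R) (C : {RV P0 >-> 'rV[R]_n}).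
Context d (Omega : measurableType d) (P : probability Omega R) (X : nat -> {RV P >-> 'rV[R]_n}).
Hypothesis X_iid : iid_copies C X.

Lemma iid_expectation_prod (g : 'rV[R]_n -> R) K : measurable_fun setT g ->
  (forall x, 0 <= g x <= 1) ->
  \int[P]_w (\prod_(k < K) g (X k w)) = (\int[distribution P0 C]_x g x) ^+ K.
Proof.
move=> mg g01; have [Xind Xlaw] := X_iid.
have mX k : measurable_fun setT (X k) by [].
have := expectation_prod_indep mX Xind [fset k | k in iota 0 K]%fset (fun=> mg) (fun=> g01).
have bigE (F : nat -> R) :
    \prod_(i <- [fset k | k in iota 0 K]%fset) F i = \prod_(i < K) F i.
  rewrite -(big_mkord xpredT) /index_iota subn0; apply: perm_big; apply: uniq_perm.
  - exact: fset_uniq.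
  - exact: iota_uniq.
  - by move=> i; rewrite !inE/=.
rewrite bigE; under eq_integral do rewrite bigE.
rewrite /Rintegral => -> /=.
rewrite -[in RHS](card_ord K) -prodr_const; apply: eq_bigr => k _; congr fine.
rewrite -(ge0_integral_distribution (X k) (f := EFin \o g)).
- by apply: eq_measure_integral => A mA _; exact: Xlaw.
- exact/measurable_EFinP.
- by move=> y; rewrite lee_fin; case/andP: (g01 y).
Qed.

End empirical_moments.

(** * The random function of the Poisson process *)
Section poisson_limit.
Context (R : realType) (n : nat) (n_ge2 : (2 <= n)%N).
Local Notation S := (set_type (simplex R n)).
Local Notation O := (orthant R n).
Context d (Omega : measurableType d) (P : probability Omega R).
Context (m : {measure set 'rV[R]_n -> \bar R}) (N : Omega -> set 'rV[R]_n).
Hypotheses (N_orthant : forall w, N w `<=` O) (N_poisson : poisson_process P m N).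
Hypothesis m_exp : forall a : R, 0 < a ->
  (\int[m]_x (\1_O x * expR (- (a * l1 x)))%:E < +oo)%E.
Hypothesis m_total : m setT = +oo%E.
Context (c : R) (c_gt0 : 0 < c).

Let mO : measurable O. Proof. exact: measurable_orthant. Qed.

Let mexp (a : R) : measurable_fun setT (fun x : 'rV[R]_n => \1_O x * expR (- (a * l1 x))).
Proof.
apply: measurable_funM; first exact: measurable_indic.
do 2 apply: measurableT_comp => //; apply: measurable_funM => //; exact: measurable_l1.
Qed.

Definition poisson_sum (p : 'rV[R]_n) w : \bar R :=
  (\esum_(x in N w) (expR (- (c * dot p x)))%:E)%E.

(* Every point of the simplex has its coordinates, multiplied by [c], above some
   [1 / (j + 1)], so countably many sums dominate all those that occur. *)
Let W (j : nat) w : \bar R := (\esum_(x in N w) (\1_O x * expR (- (j.+1%:R^-1 * l1 x)))%:E)%E.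

Definition regular_event : set Omega := [set w | N w !=set0 /\ forall j, W j w != +oo%E].

(** The process has infinitely many points because the total mass is infinite, and the
    sums are finite by [poisson_esum_finite]. *)
Lemma regular_event_prob : measurable regular_event /\ P (~` regular_event) = 0%E.
Proof.
have W0 j x : 0 <= \1_O x * expR (- (j.+1%:R^-1 * l1 x)) :> R by rewrite mulr_ge0 ?expR_ge0//
  indicE.
have mW j : measurable [set w | W j w = +oo%E].
  have := measurable_esum_poisson N_poisson (mexp j.+1%:R^-1) (W0 j) measurableT
    (emeasurable_set1 +oo%E).
  by rewrite setTI.
have PW j : P [set w | W j w = +oo%E] = 0%E.
  by apply: (poisson_esum_finite N_poisson (mexp _) (W0 j)); apply: m_exp; rewrite invr_gt0.
have mN : measurable_fun setT (npoints R N setT) by exact: measurable_npoints N_poisson _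
  measurableT.
have mN0 : measurable [set w | npoints R N setT w = 0%E].
  by have := mN measurableT _ (emeasurable_set1 0%E); rewrite setTI.
have mNy : measurable [set w | npoints R N setT w = +oo%E].
  by have := mN measurableT _ (emeasurable_set1 +oo%E); rewrite setTI.
have PN0 : P [set w | npoints R N setT w = 0%E] = 0%E.
  apply/eqP; rewrite eq_le measure_ge0 andbT.
  apply: (@le_trans _ _ (P (~` [set w | npoints R N setT w = +oo%E]))).
    apply: le_measure; rewrite ?inE//; first exact: measurableC.
    by move=> w /= ->.
  rewrite [leLHS](probability_setC P mNy); case: N_poisson => _ _ h _.
  by rewrite h ?subee.
have regC : ~` regular_event = [set w | npoints R N setT w = 0%E] `|`
  \bigcup_j [set w | W j w = +oo%E].
  apply/seteqP; split => [w /not_andP[Nw|/existsNP[j /negP]]|w [/= Nw [[x Nx] _]|[j _ /= Wj]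
    [_ /(_ j)]]].
  - have N0 : N w = set0 by apply/seteqP; split => // x Nx; case: Nw; exists x.
    by left => /=; rewrite /npoints setIT N0 /counting asboolT// fset_set0.
  - by rewrite negbK => /eqP h; right; exists j.
  - move: Nw; rewrite /npoints setIT /counting; case: ifPn => // /asboolP finN /eqP.
    by rewrite eqe pnatr_eq0 cardfs_eq0 => /eqP /(fset_set_set0 finN) N0; rewrite N0 in Nx.
  - by rewrite Wj eqxx.
have mregC : measurable (~` regular_event).
  by rewrite regC; apply: measurableU => //; exact: bigcup_measurable.
split; first by rewrite -[regular_event]setCK; exact: measurableC.
apply/eqP; rewrite eq_le measure_ge0 andbT regC.
apply: le_trans (measureU2 _ mN0 (bigcup_measurable (fun j _ => mW j))) _.
rewrite [X in (X + _)%E]PN0 add0e.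
apply: (@le_trans _ _ (\sum_(j <oo) P [set w | W j w = +oo])%E).
  by apply: measure_sigma_subadditive => //; exact: bigcup_measurable.
by rewrite eseries0// => j _ _; exact: PW.
Qed.

Lemma simplex_lower (p : S) : exists j : nat, forall i, j.+1%:R^-1 <= c * val p 0 i.
Proof.
pose a := \big[Num.min/1]_(i < n) (c * val p 0 i).
have a0 : 0 < a.
  by apply: lt_bigmin => // i _; rewrite mulr_gt0//; case/andP: ((simplex_val p).1 i).
exists (Num.truncn a^-1) => i; apply: (@le_trans _ _ a); last exact: bigmin_le_cond.
by rewrite invf_ple ?posrE// ltW// truncnS_gt.
Qed.

Lemma dot_ge_l1 (a : R) (p x : 'rV[R]_n) : O x -> (forall i, a <= p 0 i) -> a * l1 x <= dot p x.
Proof.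
by move=> Ox pa; rewrite /l1 /dot mulr_sumr; apply: ler_sum => i _; rewrite ler_pM2r.
Qed.

Lemma poisson_sum_fin w (p : S) : regular_event w ->
  0 < fine (poisson_sum (val p) w) /\ poisson_sum (val p) w \is a fin_num.
Proof.
move=> [[x Nx] Wfin].
have fin : poisson_sum (val p) w \is a fin_num.
  rewrite ge0_fin_numE; last by apply: esum_ge0 => y _; rewrite lee_fin expR_ge0.
  have [j hj] := simplex_lower p.
  apply: (@le_lt_trans _ _ (W j w)); last by rewrite ltey.
  apply: le_esum => y /N_orthant Oy; rewrite lee_fin indicE mem_set// mul1r ler_expR lerN2.
  have -> : c * dot (val p) y = dot (c *: val p) y.
    by rewrite /dot mulr_sumr; apply: eq_bigr => i _; rewrite mxE mulrA.
  by apply: dot_ge_l1 => // i; rewrite mxE.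
split=> //; rewrite -lte_fin fineK//.
apply: (@lt_le_trans _ _ (expR (- (c * dot (val p) x)))%:E); first by rewrite lte_fin expR_gt0.
apply: esum_ge; exists [set x]; last by rewrite fsbig_set1.
by split => //; move=> y ->.
Qed.

(** As in [concave_empirical], for all finite sets of points of the process. *)
Lemma concave_poisson w : regular_event w ->
  concave (fun p : S => - c^-1 * ln (fine (poisson_sum (val p) w))).
Proof.
move=> gw p q r t t01 rpq.
have [Zp0 Zpf] := poisson_sum_fin p gw; have [Zq0 Zqf] := poisson_sum_fin q gw.
have [Zr0 Zrf] := poisson_sum_fin r gw.
set zp := fine _ in Zp0 *; set zq := fine _ in Zq0 *; set zr := fine _ in Zr0 *.
suff main : ln zr <= t * ln zp + (1 - t) * ln zq.
  have ic : 0 <= c^-1 by rewrite invr_ge0 ltW.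
  by have := ler_wpM2l ic main; move: (c^-1) (ln zp) (ln zq) (ln zr) => *; lra.
rewrite -ler_expR lnK ?posrE// -lee_fin fineK//.
apply: ge_ereal_sup => _ [F [finF FN] <-].
have part (p' : S) : poisson_sum (val p') w \is a fin_num ->
    \sum_(x <- fset_set F) expR (- (c * dot (val p') x)) <= fine (poisson_sum (val p') w).
  move=> fp'; rewrite -lee_fin fineK// -sumEFin -fsbig_finite//.
  by apply: esum_ge; exists F.
rewrite fsbig_finite//= sumEFin lee_fin.
have := @sum_expR_holder R _ (fset_set F) (fun x => - (c * dot (val p) x))
    (fun x => - (c * dot (val q) x)) t zp zq t01 Zp0 Zq0 (part p Zpf) (part q Zqf).
congr (_ <= _); apply: eq_bigr => x _; congr expR.
by rewrite rpq dot_conv; ring.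
Qed.

(** Off the regular event, where the sums may be zero or infinite, the value is the
    zero function. *)
Definition poisson_limit (w : Omega) : concave_fun R n :=
  if pselect (regular_event w) is left gw then mk_concave (concave_poisson gw) else point.

Lemma poisson_limitE w (p : S) :
  poisson_limit w p = \1_regular_event w * (- c^-1 * ln (fine (poisson_sum (val p) w))).
Proof.
rewrite /poisson_limit indicE; case: pselect => gw; first by rewrite mem_set// mul1r.
by rewrite memNset// mul0r.
Qed.

Lemma poisson_limit_tilde w (p : S) : regular_event w ->
  ((poisson_limit w p)%:E = Psi_tilde c (N w) (val p))%E.
Proof.
move=> gw; rewrite poisson_limitE indicE mem_set// mul1r /Psi_tilde -/(poisson_sum (val p) w).
have [z0 zf] := poisson_sum_fin p gw.
by rewrite -[in RHS](fineK zf) lne_EFin// EFinM.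
Qed.

Let fp (p : 'rV[R]_n) x : R := \1_O x * expR (- (c * dot p x)).

Let mfp p : measurable_fun setT (fp p).
Proof.
by apply: measurable_funM; [exact: measurable_indic|exact: measurable_exp_dot].
Qed.

Let fp0 p x : 0 <= fp p x. Proof. by rewrite mulr_ge0 ?expR_ge0// indicE. Qed.

Let poisson_sumE p w : poisson_sum p w = (\esum_(x in N w) (fp p x)%:E)%E.
Proof. by apply: eq_esum => x /N_orthant Ox; rewrite /fp indicE mem_set// mul1r. Qed.

Lemma measurable_poisson_sum p : measurable_fun setT (poisson_sum p).
Proof.
rewrite (_ : poisson_sum p = fun w => (\esum_(x in N w) (fp p x)%:E)%E); last first.
  by apply/funext => w; exact: poisson_sumE.
exact: (measurable_esum_poisson N_poisson).
Qed.

Lemma measurable_poisson_limit :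
  measurable_fun setT (poisson_limit : Omega -> borel (concave_fun R n)).
Proof.
apply: (measurable_concave_fun (n_ge2 := n_ge2)) => k.
rewrite (_ : (fun w => _) = (fun w => \1_regular_event w *
    (- c^-1 * ln (fine (poisson_sum (val (rat_point R n_ge2 k)) w))))); last first.
  by apply/funext => w; exact: poisson_limitE.
apply: measurable_funM; first by apply: measurable_indic; exact: regular_event_prob.1.
apply: measurable_funM => //; apply: measurableT_comp; first exact: measurable_ln.
by apply: measurableT_comp; [exact: fine_measurable|exact: measurable_poisson_sum].
Qed.

(** A product of powers of Gumbel transforms is the exponential of minus one sum over
    the process, to which [poisson_laplace] applies. *)
Lemma poisson_limit_moments (k : nat) (q : nat -> S) (t : nat -> nat) :
  \int[P]_w (\prod_(i < k) gumbel (c * poisson_limit w (q i)) ^+ t i) =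
  expR (- fine (\int[m]_x (1 - expR (- \sum_(i < k) (t i)%:R * fp (val (q i)) x))%:E)%E).
Proof.
pose F x : R := \sum_(i < k) (t i)%:R * fp (val (q i)) x.
have F0 x : 0 <= F x by apply: sumr_ge0 => i _; rewrite mulr_ge0.
have mF : measurable_fun setT F.
  by apply: measurable_sum => i; apply: measurable_funM => //; exact: mfp.
have Fint : (\int[m]_x (F x)%:E < +oo)%E.
  under eq_integral do rewrite -sumEFin.
  rewrite ge0_integral_sum//; last 2 first.
  - by move=> i; apply/measurable_EFinP; apply: measurable_funM => //; exact: mfp.
  - by move=> i x _; rewrite lee_fin mulr_ge0.
  apply: lte_sum_pinfty => i _; under eq_integral do rewrite EFinM.
  rewrite ge0_integralZl//; last 2 first.
  - by apply/measurable_EFinP; exact: mfp.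
  - by move=> x _; rewrite lee_fin.
  rewrite lte_mul_pinfty// ?lee_fin//.
  have [j hj] := simplex_lower (q i).
  have j0 : 0 < j.+1%:R^-1 :> R by rewrite invr_gt0.
  apply: le_lt_trans (m_exp j0); apply: ge0_le_integral => //.
  - by move=> x _; rewrite lee_fin.
  - by apply/measurable_EFinP; exact: mfp.
  - by apply/measurable_EFinP; exact: mexp.
  - move=> x _; rewrite lee_fin /fp indicE; case: (boolP (x \in O));
      rewrite ?mul0r// inE !mul1r => Ox.
    rewrite ler_expR lerN2.
    have -> : c * dot (val (q i)) x = dot (c *: val (q i)) x.
      by rewrite /dot mulr_sumr; apply: eq_bigr => i' _; rewrite mxE mulrA.
    by apply: dot_ge_l1 => // i'; rewrite mxE.
rewrite /Rintegral.
have -> : (\int[P]_w (\prod_(i < k) gumbel (c * poisson_limit w (q i)) ^+ t i)%:E =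
    \int[P]_w (exp_neg (\esum_(x in N w) (F x)%:E))%:E)%E.
  have mL : measurable_fun setT (fun w =>
    (\prod_(i < k) gumbel (c * poisson_limit w (q i)) ^+ t i)%:E).
    apply/measurable_EFinP; apply: measurable_prod => i _; apply: measurable_funX.
    apply: (measurable_continuous_borel measurable_poisson_limit (F := fun f =>
      gumbel (c * f (q i)))).
    move=> f; apply: (@cvg_comp _ _ _ (fun f : concave_fun R n => c * f (q i)) gumbel);
      last exact: continuous_gumbel.
    have FF : ProperFilter (nbhs f) := nbhs_pfilter f.
    by apply: cvgM; [exact: cvg_cst|exact: continuous_concave_eval].
  have mRr : measurable_fun setT (fun w => (exp_neg (\esum_(x in N w) (F x)%:E))%:E : \bar R).
    apply/measurable_EFinP; apply: measurableT_comp; first exact: measurable_exp_neg.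
    exact: (measurable_esum_poisson N_poisson).
  apply: ae_eq_integral => //.
  exists (~` regular_event); split.
  - by apply: measurableC; exact: regular_event_prob.1.
  - exact: regular_event_prob.2.
  move=> w /= hw gw; apply: hw => _; congr EFin.
  have -> : (\esum_(x in N w) (F x)%:E = \sum_(i < k) \sum_(j < t i) poisson_sum (val (q i)) w)%E.
    under eq_esum do rewrite -sumEFin.
    rewrite esum_sum; last by move=> x i _ _; rewrite lee_fin mulr_ge0.
    apply: eq_bigr => i _; rewrite poisson_sumE -esum_sum; last by move=> *; rewrite lee_fin.
    by apply: eq_esum => x _; rewrite sumEFin sumr_const card_ord mulr_natl.
  have Z0 i : (0 <= poisson_sum (val (q i)) w)%E by apply: esum_ge0 => x _;
    rewrite lee_fin expR_ge0.
  rewrite exp_neg_sum; last by move=> i; exact: sume_ge0.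
  apply: eq_bigr => i _; rewrite exp_neg_sum// prodr_const card_ord; congr (_ ^+ _).
  have [z0 zf] := poisson_sum_fin (q i) gw.
  rewrite poisson_limitE indicE mem_set// mul1r -{2}(fineK zf) exp_negE ?(ltW z0)//.
  rewrite /gumbel; congr (expR (- _)).
  by rewrite mulNr mulrN opprK mulVKf ?gt_eqF// lnK.
by rewrite (poisson_laplace N_poisson).
Qed.

End poisson_limit.

(** * Convergence of the rescaled random functions *)
Section weak_limit.
Context (R : realType) (n : nat) (n_ge2 : (2 <= n)%N).
Local Notation S := (set_type (simplex R n)).
Local Notation leb := (lebesgue_rV R n).
Local Notation O := (orthant R n).
Context (alpha : R) (rho h : 'rV[R]_n -> R).
Local Notation beta := (n%:R + alpha).
Local Notation rescaled := (fun (kappa : R) (x : 'rV[R]_n) =>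
   kappa `^ (- alpha) * rho (kappa *: x)).
Hypotheses (rho0 : forall x, O x -> 0 <= rho x) (mrho : measurable_fun O rho)
  (h0 : forall x, O x -> 0 <= h x) (mh : measurable_fun O h)
  (h_gt0 : (0 < \int[leb]_(x in O) (h x)%:E)%E)
  (h_cvg : forall x, O x -> rescaled kappa x @[kappa --> 0^'+] --> h x)
  (h_unif : {uniform simplex R n, rescaled kappa @[kappa --> 0^'+] --> h}).
Context d0 (Omega0 : measurableType d0) (P0 : probability Omega0 R)
  (C : {RV P0 >-> 'rV[R]_n}).
Hypothesis law : forall A, measurable A ->
  distribution P0 C A = (\int[leb]_(x in A `&` O) (rho x)%:E)%E.
Context d (Omega : measurableType d) (P : probability Omega R)
  (X : nat -> {RV P >-> 'rV[R]_n}) (X_iid : iid_copies C X).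
Context (c : R) (c_gt0 : 0 < c) (lambda : nat -> R)
  (lambda_gt0 : forall K, (1 <= K)%N -> 0 < lambda K)
  (lambda_cvg : lambda K / K%:R `^ beta^-1 @[K --> \oo] --> c).

Local Notation m := (density_measure leb (measurable_limit_density mh) (limit_density_ge0 h0)).
Let nu : probability 'rV[R]_n R := distribution P0 C.

Let beta0 : 0 < beta.
Proof. exact: (beta_gt0 n_ge2 rho0 mrho h0 mh h_gt0 h_cvg h_unif (nu := nu) law). Qed.

Lemma intensity_exp_integrable a : 0 < a ->
  (\int[m]_x (\1_O x * expR (- (a * l1 x)))%:E < +oo)%E.
Proof.
move=> a0; rewrite integral_density_measure; last 2 first.
- apply/measurable_EFinP; apply: measurable_funM.
    by apply: measurable_indic; exact: measurable_orthant.
  by do 2 apply: measurableT_comp => //; apply: measurable_funM => //; exact: measurable_l1.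
- by move=> x; rewrite lee_fin mulr_ge0 ?expR_ge0// indicE.
have := limit_density_exp_integrable n_ge2 rho0 mrho h0 mh h_gt0 h_cvg h_unif (nu := nu) law a0.
congr (_ < _)%E; apply: eq_integral => x _; rewrite -EFinM; congr EFin.
by rewrite indicE /on_orthant; case: ifP => _; rewrite ?mul1r ?mul0r ?mulr0// mulrC.
Qed.

Let intensity_total : m setT = +oo%E.
Proof.
exact: (intensity_total_infinite n_ge2 rho0 mrho h0 mh h_gt0 h_cvg h_unif (nu := nu) law).
Qed.

Section moments.
Context (k : nat) (q : nat -> S) (t : nat -> nat).

Let pen (s : R) (x : 'rV[R]_n) : R := \sum_(i < k) (t i)%:R * expR (- (s * dot (val (q i)) x)).

Let pen0 s x : 0 <= pen s x.
Proof. by apply: sumr_ge0 => i _; rewrite mulr_ge0// expR_ge0. Qed.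

Let mpen s : measurable_fun setT (pen s).
Proof. by apply: measurable_sum => i; apply: measurable_funM => //; exact: measurable_exp_dot. Qed.

Let phiL x : R := 1 - expR (- \sum_(i < k) (t i)%:R * (\1_O x * expR (- (c * dot (val (q i)) x)))).

Let phiL0 x : 0 <= phiL x.
Proof.
rewrite subr_ge0 -[leRHS]expR0 ler_expR oppr_le0; apply: sumr_ge0 => i _.
by rewrite !mulr_ge0// expR_ge0.
Qed.

Let mphiL : measurable_fun setT phiL.
Proof.
apply: measurable_funB => //; do 2 apply: measurableT_comp => //.
apply: measurable_sum => i; do 2 apply: measurable_funM => //.
  by apply: measurable_indic; exact: measurable_orthant.
exact: measurable_exp_dot.
Qed.

Let lower : exists2 e : R, 0 < e & forall i, (i < k)%N -> forall j, e <= val (q i) 0 j.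
Proof.
exists (\big[Num.min/1]_(i < k) \big[Num.min/1]_(j < n) val (q i) 0 j).
  apply: lt_bigmin => // i _; apply: lt_bigmin => // j _.
  by case/andP: ((simplex_val (q i)).1 j).
move=> i ik j; apply: (@le_trans _ _ (\big[Num.min/1]_(j < n) val (q i) 0 j)).
  exact: (bigmin_le_cond 1 (fun i : 'I_k => \big[Num.min/1]_(j < n) val (q i) 0 j)
    (j := Ordinal ik) (P := xpredT) isT).
exact: bigmin_le_cond.
Qed.

Let pen_le s e x : 0 < s -> 0 < e -> O x ->
  (forall i, (i < k)%N -> forall j, e <= val (q i) 0 j) ->
  pen s x <= (\sum_(i < k) (t i)%:R) * expR (- (s * e * l1 x)).
Proof.
move=> s0 e0 Ox he; rewrite mulr_suml; apply: ler_sum => i _; apply: ler_wpM2l => //.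
rewrite ler_expR lerN2 -mulrA ler_pM2l//; apply: dot_ge_l1 => // j; exact: he.
Qed.

(* the maximum keeps [kappa 0] positive *)
Let kappa K : R := (maxn K 1)%:R `^ (- beta^-1).

Let kappa_gt0 K : 0 < kappa K.
Proof. by rewrite powR_gt0// ltr0n leq_max orbT. Qed.

Let kappa_beta K : (0 < K)%N -> kappa K `^ (- beta) = K%:R.
Proof.
move=> K0; rewrite /kappa (maxn_idPl K0) -powRrM mulrNN mulVf ?gt_eqF//.
by rewrite powRr1.
Qed.

Let kappaV K : (0 < K)%N -> kappa K = (K%:R `^ beta^-1)^-1.
Proof. by move=> K0; rewrite /kappa (maxn_idPl K0) powRN. Qed.

Let kappa_cvg0 : kappa K @[K --> \oo] --> 0.
Proof.
apply/cvgrPdist_le => e e0.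
near=> K; have K0 : (0 < K)%N by near: K; exact: nbhs_infty_gt.
rewrite sub0r normrN gtr0_norm// kappaV// invf_ple ?posrE ?powR_gt0 ?ltr0n//.
have -> : e^-1 = (e^-1 `^ beta) `^ beta^-1.
  by rewrite -powRrM divff ?gt_eqF// powRr1// invr_ge0 ltW.
apply: ge0_ler_powR; rewrite ?invr_ge0 ?(ltW beta0) ?nnegrE ?powR_ge0//.
by near: K; exact: nbhs_infty_ger.
Unshelve. all: by end_near. Qed.

(* The parameter of the rescaled test functions, which tends to [c].  The truncation
   makes one dominating function serve all [K]. *)
Let s_ K := Num.max (c / 2) (lambda K * kappa K).

Let s_E : \forall K \near \oo, s_ K = lambda K * kappa K.
Proof.
have c2 : c / 2 < c by rewrite ltr_pdivrMr//; move: c_gt0 => ?; lra.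
have /cvgr_gt/(_ _ c2) := lambda_cvg; apply: filterS2 (nbhs_infty_gt 0%N) => K K0 hK.
by rewrite /s_ max_r// kappaV// ltW.
Qed.

Let s_cvg : s_ K @[K --> \oo] --> c.
Proof.
apply: cvg_trans lambda_cvg; apply: near_eq_cvg.
apply: filterS2 (nbhs_infty_gt 0%N) s_E => K K0 ->.
by rewrite kappaV.
Qed.

(** The moment is the [K]-th power of an integral against the law of [C], namely of
    [1 - phi_ K] at the rescaled variable; then [rescaled_integral_cvg] and
    [cvg_pow_expR] give the limit. *)
Lemma empirical_moments_cvg :
  \int[P]_w (\prod_(i < k) expR (- \sum_(j < K) expR (- (lambda K * dot (val (q i)) (X j w))))
    ^+ t i)
    @[K --> \oo] --> expR (- fine (\int[m]_x (phiL x)%:E)%E).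
Proof.
have [e e0 he] := lower.
have s0 K : 0 < s_ K by rewrite /s_ lt_max divr_gt0.
have sge K : c / 2 <= s_ K by rewrite /s_ le_max lexx.
pose phi_ K x := 1 - expR (- pen (s_ K) x).
have phi01 K x : 0 <= phi_ K x <= 1.
  by rewrite subr_ge0 -[leRHS]expR0 ler_expR oppr_le0 pen0/= lerBlDr lerDl expR_ge0.
have mphi K : measurable_fun setT (phi_ K).
  by apply: measurable_funB => //; do 2 apply: measurableT_comp => //; exact: mpen.
pose D : R := \sum_(i < k) (t i)%:R; have D0 : 0 <= D by exact: sumr_ge0.
have a0 : 0 < c / 2 * e by rewrite mulr_gt0// divr_gt0.
have phi_le K x : O x -> phi_ K x <= D * expR (- (c / 2 * e * l1 x)).
  move=> Ox; apply: (@le_trans _ _ (pen (s_ K) x)).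
    by have := expR_ge1Dx (- pen (s_ K) x); rewrite /phi_; move: (pen _ _) (expR _) => *; lra.
  apply: le_trans (pen_le (s0 K) e0 Ox he) _; apply: ler_wpM2l => //.
  rewrite ler_expR lerN2 ler_wpM2r//; first exact/ltW/orthant_l1/Ox/(leq_trans _ n_ge2).
  by rewrite ler_pM2r.
have phi_cvg x : O x -> phi_ K x @[K --> \oo] --> phiL x.
  move=> Ox; have cexp (u : nat -> R) l : u K @[K --> \oo] --> l -> expR (- u K) @[K --> \oo] -->
    expR (- l).
    move=> ul; apply: (@cvg_comp _ _ _ (fun K => - u K) expR); first exact: (cvgN ul).
    exact: continuous_expR.
  apply: cvgB; first exact: cvg_cst.
  apply: (cexp); rewrite /pen; apply: cvg_big => [|i _]; first exact: add_continuous.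
  apply: cvgM; first exact: cvg_cst.
  rewrite indicE mem_set// mul1r; apply: (cexp).
  by apply: cvgM => //; exact: cvg_cst.
have lim := rescaled_integral_cvg n_ge2 rho0 mrho h0 mh h_gt0 h_cvg h_unif (nu := nu) law
  kappa_gt0 kappa_cvg0 a0 D0 mphi mphiL (fun K x => proj1 (andP (phi01 K x))) phi_le phi_cvg.
have LE : (\int[m]_x (phiL x)%:E = \int[leb]_x (phiL x * on_orthant h x)%:E)%E.
  rewrite integral_density_measure; last 2 first.
  - exact/measurable_EFinP.
  - by move=> x; rewrite lee_fin.
  by apply: eq_integral => x _; rewrite -EFinM mulrC.

have Lfin : (\int[m]_x (phiL x)%:E \is a fin_num)%E.
  rewrite LE; rewrite ge0_fin_numE; last first.
    by apply: integral_ge0 => x _; rewrite lee_fin mulr_ge0// limit_density_ge0.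
  have := limit_density_exp_integrable n_ge2 rho0 mrho h0 mh h_gt0 h_cvg h_unif (nu := nu) law a0.
  set B := integral _ _ _ => Boo.
  apply: (@le_lt_trans _ _ (D%:E * B)%E); last by rewrite lte_mul_pinfty// ?lee_fin.
  rewrite /B -ge0_integralZl//; last 2 first.
  - apply/measurable_EFinP; apply: measurable_funM; last exact: measurable_limit_density.
    by do 2 apply: measurableT_comp => //; apply: measurable_funM => //; exact: measurable_l1.
  - by move=> x _; rewrite lee_fin mulr_ge0 ?expR_ge0// limit_density_ge0.
  apply: ge0_le_integral => //.
  - by move=> x _; rewrite lee_fin mulr_ge0// limit_density_ge0.
  - by apply/measurable_EFinP; apply: measurable_funM => //; exact: measurable_limit_density.
  - apply/measurable_EFinP; apply: measurable_funM => //; apply: measurable_funM;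
      last exact: measurable_limit_density.
    by do 2 apply: measurableT_comp => //; apply: measurable_funM => //; exact: measurable_l1.
  - move=> x _; rewrite lee_fin /on_orthant mulrA; case: ifPn; last by rewrite !mulr0.
    rewrite inE => Ox; apply: ler_wpM2r; first exact: h0.
    rewrite -(cvg_lim (@Rhausdorff R) (phi_cvg x Ox)); apply: limr_le.
      by apply/cvg_ex; exists (phiL x); exact: phi_cvg.
    by near=> K; exact: phi_le.
pose x_ K := \int[nu]_x phi_ K ((kappa K)^-1 *: x).
have mphis K : measurable_fun setT (fun x : 'rV[R]_n => phi_ K ((kappa K)^-1 *: x)).
  exact: (measurableT_comp (mphi K) (measurable_rV_scale _)).
have xE K : ((x_ K)%:E = \int[nu]_x (phi_ K ((kappa K)^-1 *: x))%:E)%E.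
  rewrite /x_ /Rintegral fineK//; apply: expectation_fin_num01 => // x; exact: phi01.
have x1 K : 1 - x_ K = \int[nu]_x expR (- pen (s_ K) ((kappa K)^-1 *: x)).
  have <- : \int[nu]_x (1 : R) = 1 by rewrite Rintegral_cst// mul1r;
    exact: (congr1 fine (@probability_setT _ _ _ nu)).
  rewrite -RintegralB//; last 2 first.
  - by apply: (bounded_integrable _ (M := 1)) => // w; rewrite normr1.
  - apply: (bounded_integrable _ (M := 1)) => // w.
    by have /andP[? ?] := phi01 K ((kappa K)^-1 *: w); rewrite ger0_norm.
  by apply: eq_Rintegral => x _; rewrite /phi_ opprB addrCA subrr addr0.
have x01 K : 0 <= x_ K <= 1.
  rewrite Rintegral_ge0/=; last by move=> x _; case/andP: (phi01 K ((kappa K)^-1 *: x)).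
  by rewrite -subr_ge0 x1; apply: Rintegral_ge0 => x _; exact: expR_ge0.
have Kx : K%:R * x_ K @[K --> \oo] --> fine (\int[m]_x (phiL x)%:E)%E.
  apply: (@fine_cvg _ _ _ _ (fun K => (K%:R * x_ K)%:E)); rewrite fineK// LE.
  apply: cvg_trans lim; apply: near_eq_cvg.
  by near=> K; rewrite -xE EFinM kappa_beta//; near: K; exact: nbhs_infty_gt.
apply: cvg_trans (cvg_pow_expR x01 Kx); apply: near_eq_cvg; near=> K.
have sK : s_ K = lambda K * kappa K by near: K; exact: s_E.
pose g x := expR (- \sum_(i < k) (t i)%:R * expR (- (lambda K * dot (val (q i)) x))).
have gE x : g x = expR (- pen (s_ K) ((kappa K)^-1 *: x)).
  congr expR; congr (- _); apply: eq_bigr => i _; congr (_ * expR (- _)).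
  by rewrite dotZr sK mulrA mulfK// gt_eqF.
have mg : measurable_fun setT g.
  by do 2 apply: measurableT_comp => //; exact: (mpen (lambda K)).
have g01 x : 0 <= g x <= 1.
  rewrite expR_ge0/= -[leRHS]expR0 ler_expR oppr_le0; exact: (pen0 (lambda K)).
rewrite x1 (_ : \int[nu]_x _ = \int[nu]_x g x); last by apply: eq_Rintegral => x _; rewrite gE.
rewrite -(iid_expectation_prod X_iid K mg g01); apply: eq_Rintegral => w _.
rewrite -expR_sum; under [in RHS]eq_bigr do rewrite -expRM_natl.
rewrite -expR_sum; congr expR.
rewrite sumrN exchange_big/= -sumrN; apply: eq_bigr => i _.
by rewrite mulrN mulr_sumr.
Unshelve. all: by end_near. Qed.

End moments.

Local Notation a_ := (fun K => K%:R `^ beta^-1).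
Local Notation b_ := (fun K => K%:R `^ beta^-1 * ln K%:R / lambda K).

Definition empirical_field K w : concave_fun R n :=
  mk_concave (concave_empirical (b_ K) (fun k => X k w) (powR_ge0 K%:R beta^-1) (@lambda_gt0 K)).

Lemma measurable_empirical_field K :
  measurable_fun setT (empirical_field K : Omega -> borel (concave_fun R n)).
Proof.
apply: (measurable_concave_fun (n_ge2 := n_ge2)) => k.
by apply: measurable_empirical => j; exact: (@measurable_funPT _ _ _ _ (X j)).
Qed.

Context d' (Omega' : measurableType d') (P' : probability Omega' R)
  (N : Omega' -> set 'rV[R]_n) (N_orthant : forall w, N w `<=` O)
  (N_poisson : poisson_process P' (intensity h) N).

Let N_poisson_density : poisson_process P' m N.
Proof. by move: N_poisson; rewrite intensityE. Qed.

(** In [weak_convergence_criterion] the evaluations are transformed by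
    [s |-> gumbel (c s)].  The moments of the functions of index [K] are computed with
    [lambda K / K ^ (1 / beta)] in place of [c], and [gumbel_dist] bounds the
    difference uniformly. *)
Lemma empirical_field_cvg (F : concave_fun R n -> R) : continuous F ->
  (exists M, forall f, `|F f| <= M) ->
  \int[P]_w F (empirical_field K w) @[K --> \oo] -->
  \int[P']_w F (poisson_limit N_orthant c_gt0 w).
Proof.
pose D := rat_point R n_ge2.
pose u (x : R) := gumbel (c * x).
have cu : continuous u.
  move=> x; apply: (@cvg_comp _ _ _ (fun x : R => c * x) gumbel); last exact: continuous_gumbel.
  by apply: cvgM; [exact: cvg_cst|exact: cvg_id].
have um : {mono u : x y / x < y} by move=> x y; rewrite gumbel_mono ltr_pM2l.
have mPsi := measurable_poisson_limit n_ge2 N_orthant N_poisson_density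
  intensity_exp_integrable intensity_total c_gt0.
apply: (weak_convergence_criterion (n_ge2 := n_ge2) cu um measurable_empirical_field mPsi).
move=> l H HH.
pose V K w i := expR (- \sum_(k < K) expR (- (lambda K * dot (val (D i)) (X k w)))).
pose V' w i := u (poisson_limit N_orthant c_gt0 w (D i)).
have mu_eval d1 (T : measurableType d1) (Z : T -> concave_fun R n) i :
    measurable_fun setT (Z : T -> borel (concave_fun R n)) ->
    measurable_fun setT (fun w => u (Z w (D i))).
  move=> mZ; apply: (measurable_continuous_borel mZ (F := fun f => u (f (D i)))).
  move=> f; have FF : ProperFilter (nbhs f) := nbhs_pfilter f.
  by apply: (@cvg_comp _ _ _ (fun f : concave_fun R n => f (D i)) u);
    [exact: continuous_concave_eval|exact: cu].
have mV K i : measurable_fun setT (fun w => V K w i).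
  apply: measurableT_comp => //; apply: measurableT_comp => //.
  apply: measurable_sum => k.
  exact: (measurableT_comp (measurable_exp_dot (val (D i)) (lambda K))
    (@measurable_funPT _ _ _ _ (X k))).
have V01 K w i : 0 <= V K w i <= 1.
  by rewrite expR_ge0/= -[leRHS]expR0 ler_expR oppr_le0; apply: sumr_ge0 => k _; exact: expR_ge0.
have V'01 w i : 0 <= V' w i <= 1 by exact: gumbel01.
have mom k (t : nat -> nat) :
    \int[P]_w (\prod_(i < k) V K w i ^+ t i) @[K --> \oo] -->
      \int[P']_w (\prod_(i < k) V' w i ^+ t i).
  rewrite (poisson_limit_moments n_ge2 N_orthant N_poisson_density
    intensity_exp_integrable intensity_total c_gt0 k D t).
  exact: empirical_moments_cvg.
have limV := moments_lipschitz mV (fun i => mu_eval _ _ _ i mPsi) V01 V'01 mom HH.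
have [L L0 HL] := HH.
pose U K w i := u (empirical_field K w (D i)).
have a1 : c / (lambda K / a_ K) @[K --> \oo] --> (1 : R).
  have : c / (lambda K / a_ K) @[K --> \oo] --> c / c.
    by apply: cvgM; [exact: cvg_cst|apply: cvgV; rewrite ?gt_eqF].
  by rewrite divff ?gt_eqF.
have dist : \forall K \near \oo, forall w, `|H (U K w) - H (V K w)| <=
    L * (l%:R * 240 * `|c / (lambda K / a_ K) - 1|).
  near=> K => w; apply: le_trans (HL _ _) _; apply: ler_wpM2l => //.
  have K0 : (0 < K)%N by near: K; exact: nbhs_infty_gt.
  have aK0 : 0 < a_ K by rewrite powR_gt0// ltr0n.
  have lam0 := lambda_gt0 K0.
  apply: (@le_trans _ _ (\sum_(i < l) 240 * `|c / (lambda K / a_ K) - 1|)); last first.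
    by rewrite sumr_const card_ord -[leLHS]mulr_natl mulrA.
  apply: ler_sum => i _; rewrite /U /u.
  rewrite (_ : V K w i = gumbel (lambda K / a_ K *
      empirical (a_ K) (b_ K) (lambda K) K (fun k => X k w) (D i))); last first.
    by rewrite empirical_laplace.
  have -> : c * empirical_field K w (D i) = c / (lambda K / a_ K) *
      (lambda K / a_ K * empirical (a_ K) (b_ K) (lambda K) K (fun k => X k w) (D i)).
    by rewrite mulrA divfK// gt_eqF// divr_gt0.
  apply: gumbel_dist; apply/andP; split; apply: ltW; near: K.
    by apply: (cvgr_gt _ a1); lra.
  by apply: (cvgr_lt _ a1); lra.
have HU0 f : `|H f| <= `|H (fun=> 0)| + L * \sum_(k < l) `|f k|.
  have := HL f (fun=> 0); under eq_bigr do rewrite subr0.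
  by have := ler_normB (H f - H (fun=> 0)) (- H (fun=> 0)); rewrite opprK subrK normrN; lra.
have bnd d1 (T : measurableType d1) (Q : probability T R) (Z : T -> nat -> R) :
    (forall i, measurable_fun setT (Z ^~ i)) -> (forall w i, 0 <= Z w i <= 1) ->
    Q.-integrable setT (EFin \o (fun w => H (Z w))).
  move=> mZ Z01; apply: (bounded_integrable _ (M := `|H (fun=> 0)| + L * l%:R)).
    exact: measurable_lipschitz_cyl mZ HH.
  move=> w; apply: le_trans (HU0 _) _; rewrite lerD2l ler_wpM2l//.
  rewrite -[leRHS](_ : \sum_(i < l) 1 = _); last by rewrite sumr_const card_ord.
  by apply: ler_sum => i _; have /andP[? ?] := Z01 w i; rewrite ger0_norm.
apply/cvgrPdist_le => e e0; have e2 : 0 < e / 2 by rewrite divr_gt0.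
have small : L * (l%:R * 240 * `|c / (lambda K / a_ K) - 1|) @[K --> \oo] --> (0 : R).
  rewrite -(mulr0 L); apply: cvgM; first exact: cvg_cst.
  rewrite -(mulr0 (l%:R * 240)); apply: cvgM; first exact: cvg_cst.
  apply/norm_cvg0P.
  have : c / (lambda K / a_ K) - 1 @[K --> \oo] --> (1 : R) - 1 by apply: cvgB => //;
    exact: cvg_cst.
  by rewrite subrr.
near=> K.
have h1 : `|\int[P']_w H (V' w) - \int[P]_w H (V K w)| <= e / 2.
  by near: K; move/cvgrPdist_le: limV; apply.
have h2 : `|\int[P]_w H (U K w) - \int[P]_w H (V K w)| <= e / 2.
  apply: Rintegral_dist.
  - by apply: bnd => [i|w i]; [exact/mu_eval/measurable_empirical_field|exact: gumbel01].
  - by apply: bnd => //; exact: mV.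
  - move=> w; apply: (@le_trans _ _ (L * (l%:R * 240 * `|c / (lambda K / a_ K) - 1|))).
      by move: w; near: K.
    by apply: ltW; near: K; exact: (cvgr_lt _ small).
change (`|\int[P']_w H (V' w) - \int[P]_w H (U K w)| <= e).
move: h1 h2; move: (Rintegral _ _ _) (Rintegral _ _ _) (Rintegral _ _ _) => x y z.
rewrite !ler_norml => /andP[? ?] /andP[? ?].
by apply/andP; split; lra.
Unshelve. all: by end_near. Qed.

End weak_limit.

Theorem theorem5p2 (R : realType) (n : nat) (n_ge2 : (2 <= n)%N)
    (d0 : measure_display) (Omega0 : measurableType d0)
    (P0 : probability Omega0 R) (C : {RV P0 >-> 'rV[R]_n})
    (C_orthant : forall w, orthant R n (C w))
    (alpha : R) (h : 'rV[R]_n -> R)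
    (C_homogeneous : asymptotically_homogeneous C alpha h)
    (d : measure_display) (Omega : measurableType d) (P : probability Omega R)
    (X : nat -> {RV P >-> 'rV[R]_n}) (X_iid : iid_copies C X)
    (c : R) (c_gt0 : 0 < c)
    (lambda : nat -> R) (lambda_gt0 : forall K, (1 <= K)%N -> 0 < lambda K)
    (lambda_cvg :
      lambda K / K%:R `^ (n%:R + alpha)^-1 @[K --> \oo] --> c)
    (d' : measure_display) (Omega' : measurableType d')
    (P' : probability Omega' R) (N : Omega' -> set 'rV[R]_n)
    (N_orthant : forall w, N w `<=` orthant R n)
    (N_poisson : poisson_process P' (intensity h) N) :
  exists (Y : nat -> {RV P >-> borel (concave_fun R n)})
         (Psi : {RV P' >-> borel (concave_fun R n)}),
  [/\ forall K w (p : set_type (simplex R n)), (1 <= K)%N ->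
        (Y K w : concave_fun R n) p =
        K%:R `^ (n%:R + alpha)^-1 * Phi (lambda K) K (fun k => X k w) (val p)
        - K%:R `^ (n%:R + alpha)^-1 * ln K%:R / lambda K,
      {ae P', forall w, forall p : set_type (simplex R n),
        ((Psi w : concave_fun R n) p)%:E = Psi_tilde c (N w) (val p)}
    & converges_weakly Y Psi].
Proof.
have [rho [[rho0 mrho law] [h0 mh] h_gt0 h_cvg h_unif]] := C_homogeneous.
have m_exp := intensity_exp_integrable n_ge2 rho0 mrho h0 mh h_gt0 h_cvg h_unif law.
have m_total := intensity_total_infinite n_ge2 rho0 mrho h0 mh h_gt0 h_cvg h_unif
  (nu := distribution P0 C) law.
have N_density : poisson_process P'
  (density_measure (lebesgue_rV R n) (measurable_limit_density mh) (limit_density_ge0 h0)) N.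
  by move: N_poisson; rewrite intensityE.
pose Y K : {RV P >-> borel (concave_fun R n)} :=
  mfun_Sub (mem_set (measurable_empirical_field n_ge2 alpha X lambda_gt0 K)).
pose Psi : {RV P' >-> borel (concave_fun R n)} :=
  mfun_Sub (mem_set (measurable_poisson_limit n_ge2 N_orthant N_density m_exp m_total c_gt0)).
exists Y, Psi; split.
- by move=> K w p K1.
- have [mreg Preg] := regular_event_prob N_density m_exp m_total.
  exists (~` regular_event N); split; [exact: measurableC|exact: Preg|].
  by move=> w /= hw rw; apply: hw => p; exact: poisson_limit_tilde.
move=> F cF [M FM].
have EE d1 (T : measurableType d1) (Q : probability T R) (Z : T -> concave_fun R n) :
    measurable_fun setT (Z : T -> borel (concave_fun R n)) ->
    ('E_Q[fun w => F (Z w)] = (\int[Q]_w F (Z w))%R%:E)%E.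
  move=> mZ; rewrite unlock /Rintegral fineK//; apply: integrable_fin_num => //.
  apply: (bounded_integrable _ (M := M)); last by move=> w; exact: FM.
  exact: (measurable_continuous_borel mZ cF).
rewrite (EE _ _ P' Psi (@measurable_funPT _ _ _ _ Psi)).
rewrite (_ : (fun K => _) = fun K => (\int[P]_w F (Y K w))%:E); last first.
  by apply/funext => K; rewrite (EE _ _ P (Y K) (@measurable_funPT _ _ _ _ (Y K))).
apply: cvg_EFin; first exact: nearW.
have bF : exists M, forall f, `|F f| <= M by exists M.
exact: (empirical_field_cvg n_ge2 rho0 mrho h0 mh h_gt0 h_cvg h_unif law X_iid (c_gt0 := c_gt0)
  lambda_gt0 lambda_cvg (N_orthant := N_orthant) N_poisson cF bF).
Qed.
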